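(* Let $\Psi=(\psi,\psi^\sharp)\colon\mathcal M\to\mathcal N$ be a morphism of $\mathbb N$-manifolds of degree 2, with bodies $M$ and $N$, and let $c\in N$. Let $\mathcal I_c\subseteq C_{\mathcal N}$ be the subsheaf of ideals $\mathcal I_c(V)=\{f\in C_{\mathcal N}(V)\mid f_0(c)=0\text{ if }c\in V\}$ ($V\subseteq N$ open, $f_0$ the degree-zero component of $f$), and let $\mathcal I=\langle\psi^\sharp(\mathcal I_c)\rangle\subseteq C_{\mathcal M}$ be the sheaf of ideals generated by $\psi^\sharp(\mathcal I_c)$ in $C_{\mathcal M}$. If $c$ is a regular value of $\Psi$, then the sheaf of ideals $\mathcal I\subseteq C_{\mathcal M}$ is regular.
   Context: Manifolds are smooth and real. **$\mathbb N$-manifolds.** An $\mathbb N$-manifold of degree 2 and dimension $m_0|m_1|m_2$ is a pair $\mathcal M=(M,C_{\mathcal M})$, where $M$ (the body) is an $m_0$-dimensional manifold and $C_{\mathcal M}$ is a sheaf of ($\mathbb N$-graded) graded-commutative algebras on $M$ such that every point of $M$ has an open neighbourhood $U$ with $C_{\mathcal M}|_U\cong C^\infty_U\otimes\wedge\mathbb R^{m_1}\otimes\mathrm S\,\mathbb R^{m_2}$ (sheafification), elements of $\mathbb R^{m_q}$ having degree $q$. The resulting generators $\{x^i,e^\mu,p^I\}$ over $U$ (degrees $0,1,2$) are called local coordinates. $(C_{\mathcal M})_0=C^\infty_M$. A morphism $\mathcal M\to\mathcal N$ is a pair $(\psi,\psi^\sharp)$ with $\psi\colon M\to N$ smooth and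 $\psi^\sharp\colon C_{\mathcal N}\to\psi_*C_{\mathcal M}$ a morphism of sheaves of graded algebras. **Tangent spaces and tangent maps.** For $x\in M$, a homogeneous tangent vector of degree $|X_x|$ is a linear map $X_x\colon C_{\mathcal M}|_x\to\mathbb R$ on the stalk at $x$, of degree $|X_x|$, with $X_x(fg)=X_x(f)g_0(x)+(-1)^{|X_x||f|}f_0(x)X_x(g)$; these span the graded vector space $\mathcal T_x\mathcal M$. The tangent map $(d\Psi)_x\colon\mathcal T_x\mathcal M\to\mathcal T_{\psi(x)}\mathcal N$ is $(d\Psi)_x(X_x)(f)=X_x(\psi^\sharp f)$. **Regular value.** $c\in N$ is a regular value of $\Psi$ if $(d\Psi)_x$ is onto for all $x\in M$ with $\psi(x)=c$. **Regular sheaf of ideals.** A subsheaf of ideals $\mathcal I\subseteq C_{\mathcal M}$ is regular if $\mathcal I_0:=\mathcal I\cap(C_{\mathcal M})_0$ equals the vanishing ideal $I_S$ of a subset $S\subseteq M$ and there exist $r_j\in\{0,\dots,m_j\}$, $j=0,1,2$, such that any $x\in S$ has a neighbourhood $U\subseteq M$ with local coordinates $\{x^i,e^\mu,p^I\}$ for which $\{x^1,\dots,x^{r_0},e^1,\dots,e^{r_1},p^1,\dots,p^{r_2}\}$ generates the sheaf of ideals $\mathcal I|_U$. *)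

(* Defs.v *)
(* Only the canonical structures and coercions of mpoly are imported, because its
   notations clash with those of MathComp-Analysis. *)
From HB Require Import structures.
From mathcomp Require Import all_boot all_order all_algebra.
From mathcomp Require Import all_classical all_reals.
From mathcomp Require Import topology normedtype derive.
From mathcomp Require mpoly.
Import (canonicals, coercions) mpoly.

Set Implicit Arguments.
Unset Strict Implicit.
Unset Printing Implicit Defensive.

Import Order.TTheory GRing.Theory Num.Theory.
Import numFieldNormedType.Exports.

Local Open Scope classical_set_scope.
Local Open Scope ring_scope.

Record opens (X : topologicalType) := Opens {
  oset :> X -> Prop;
  open_oset : open oset }.

Definition opensT (X : topologicalType) : opens X := Opens openT.

Definition opens_preimage (X Y : topologicalType) (f : X -> Y)
    (cf : continuous f) (V : opens Y) : opens X :=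
  Opens (proj1 (continuousP f) cf V (open_oset V)).

Section Smooth.
Context {R : realType}.

Fixpoint Ck (m : nat) (k : nat) (A : set 'rV[R]_m) (f : 'rV[R]_m -> R) : Prop :=
  (forall x, A x -> {for x, continuous f}) /\
  if k is k'.+1 then
    forall i : 'I_m,
      (forall x, A x -> derivable f x (delta_mx 0 i)) /\
      Ck k' A (fun x => 'D_(delta_mx 0 i) f x)
  else True.

(* Meant for open sets A. *)
Definition Cinf (m : nat) (A : set 'rV[R]_m) (f : 'rV[R]_m -> R) : Prop :=
  forall k, Ck k A f.

Section Charts.
Context {m : nat} {X : topologicalType}.
Implicit Types (U : opens X) (phi : X -> 'rV[R]_m).

(* phi restricts to a homeomorphism from U onto an open subset of R^m. *)
Definition open_embedding U phi : Prop :=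
  [/\ forall x, U x -> {for x, continuous phi},
      forall x y, U x -> U y -> phi x = phi y -> x = y
    & forall V : opens X, V `<=` U -> open (phi @` V)].

(* f o phi^-1 is smooth on phi(A). *)
Definition smooth_via phi (A : set X) (f : X -> R) : Prop :=
  exists2 g : 'rV[R]_m -> R, Cinf (phi @` A) g & forall x, A x -> f x = g (phi x).

Definition smooth_transition (c d : opens X * (X -> 'rV[R]_m)) : Prop :=
  forall j, smooth_via c.2 (c.1 `&` d.1) (fun x => d.2 x 0 j).

End Charts.
End Smooth.

Record manifold (R : realType) (m : nat) := Manifold {
  carrier :> topologicalType;
  atlas : set (opens carrier * (carrier -> 'rV[R]_m));
  manifold_hausdorff : hausdorff_space carrier;
  manifold_second_countable : @second_countable carrier;
  atlas_cover : forall x : carrier, exists2 c, atlas c & c.1 x;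
  atlas_open_embedding : forall c, atlas c -> open_embedding c.1 c.2;
  atlas_transition : forall c d, atlas c -> atlas d -> smooth_transition c d }.

Section Manifold.
Context {R : realType} {m n : nat}.

(* Charts of the maximal atlas. *)
Definition is_chart (M : manifold R m) (U : opens M) (phi : M -> 'rV[R]_m) :=
  open_embedding U phi /\
  forall c, atlas c ->
    smooth_transition c (U, phi) /\ smooth_transition (U, phi) c.

Definition smooth_fun (M : manifold R m) (U : opens M) (f : M -> R) : Prop :=
  forall c, atlas c -> smooth_via c.2 (c.1 `&` U) f.

Definition smooth_map (M : manifold R m) (N : manifold R n) (psi : M -> N) :=
  continuous psi /\
  forall (c : opens M * (M -> 'rV[R]_m)) (d : opens N * (N -> 'rV[R]_n)),
    atlas c -> atlas d ->
    forall j, smooth_via c.2 (c.1 `&` psi @^-1` d.1) (fun x => d.2 (psi x) 0 j).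

End Manifold.

(* A sheaf of N-graded algebras is a sheaf of R-algebras that is, as a sheaf,
   the direct sum of its homogeneous parts: every section is, locally, a finite
   sum of homogeneous ones, and [gr k] takes the degree k component.  The
   R-algebra structure is given by the structure morphism [cst], which is
   central by [gr_cst] and [gr_comm].  The rings of sections are [pzRingType]s,
   since the sections over the empty set form the zero ring. *)
Record graded_sheaf (R : realType) (X : topologicalType) := GradedSheaf {
  sec : opens X -> pzRingType;
  cst : forall U, {rmorphism R -> sec U};
  res : forall U V : opens X, V `<=` U -> {rmorphism sec U -> sec V};
  gr : nat -> forall U, {additive sec U -> sec U};
  res_id : forall (U : opens X) (h : U `<=` U) (f : sec U), res h f = f;
  res_res : forall (U V W : opens X) (hVU : V `<=` U) (hWV : W `<=` V)
    (hWU : W `<=` U) (f : sec U), res hWV (res hVU f) = res hWU f;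
  res_cst : forall (U V : opens X) (h : V `<=` U) (a : R),
    res h (cst U a) = cst V a;
  res_gr : forall (U V : opens X) (h : V `<=` U) k (f : sec U),
    res h (gr k U f) = gr k V (res h f);
  sheaf_separated : forall (I : Type) (U : opens X) (V : I -> opens X)
    (hV : forall i, V i `<=` U) (f g : sec U),
    (forall x, U x -> exists i, V i x) ->
    (forall i, res (hV i) f = res (hV i) g) -> f = g;
  sheaf_gluing : forall (I : Type) (U : opens X) (V : I -> opens X)
    (hV : forall i, V i `<=` U) (s : forall i, sec (V i)),
    (forall x, U x -> exists i, V i x) ->
    (forall i j (W : opens X) (hi : W `<=` V i) (hj : W `<=` V j),
        res hi (s i) = res hj (s j)) ->
    exists f : sec U, forall i, res (hV i) f = s i;
  gr_gr : forall j k U (f : sec U),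
    gr j U (gr k U f) = if j == k then gr k U f else 0;
  gr_sum : forall (U : opens X) (f : sec U) (x : X), U x ->
    exists (V : opens X) (h : V `<=` U) (d : nat),
      V x /\ res h f = \sum_(k < d) gr k V (res h f);
  gr_cst : forall U (a : R), gr 0 U (cst U a) = cst U a;
  gr_mul : forall j k U (f g : sec U),
    gr j U f = f -> gr k U g = g -> gr (j + k) U (f * g) = f * g;
  gr_comm : forall j k U (f g : sec U),
    gr j U f = f -> gr k U g = g -> f * g = (-1) ^+ (j * k) * (g * f) }.

Definition homogeneous (R : realType) (X : topologicalType)
    (C : graded_sheaf R X) (k : nat) (U : opens X) (f : sec C U) : Prop :=
  gr C k U f = f.

(* Wedge R^p (x) S R^q.  The value of v at the subset A of 'I_p is the polynomial
   coefficient in S R^q of the ordered product e^A of the e^mu, mu in A. *)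
Definition wsym (R : realType) (p q : nat) :=
  {ffun {set 'I_p} -> mpoly.mpoly q R}.

Section LocalModel.
Context {R : realType} {p q : nat}.
Local Notation W := (wsym R p q).

(* e^B e^C = (-1)^(inversions B C) e^(B u C) for disjoint B and C. *)
Definition inversions (B C : {set 'I_p}) : nat :=
  #|[pred bc : 'I_p * 'I_p | [&& bc.1 \in B, bc.2 \in C & (bc.2 < bc.1)%N]]|.

Definition wmul (v w : W) : W :=
  [ffun A : {set 'I_p} => \sum_(B : {set 'I_p} | B \subset A)
    (-1) ^+ inversions B (finset.setD A B) * (v B * w (finset.setD A B))].

Definition wcst (a : R) : W :=
  [ffun A : {set 'I_p} => if A == finset.set0 then mpoly.mpolyC q a else 0].

Definition wgen1 (mu : 'I_p) : W :=
  [ffun A : {set 'I_p} => (A == finset.set1 mu)%:R].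

Definition wgen2 (i : 'I_q) : W :=
  [ffun A : {set 'I_p} =>
    if A == finset.set0 then mpoly.mpolyX R (mpoly.mnm1 i) else 0].

Definition whomogeneous (k : nat) (v : W) : Prop :=
  forall (A : {set 'I_p}) (a : mpoly.multinom q),
    mpoly.mcoeff a (v A) != 0 -> (#|A| + (mpoly.mdeg a).*2)%N = k.

(* The sections over V of the sheaf associated with C^oo (x) Wedge R^p (x) S R^q,
   as functions with values in Wedge R^p (x) S R^q: the coefficients are smooth and,
   locally, only finitely many of them are nonzero. *)
Definition model_section (m : nat) (M : manifold R m) (V : opens M)
    (s : M -> W) : Prop :=
  (forall (A : {set 'I_p}) (a : mpoly.multinom q),
      smooth_fun V (fun x => mpoly.mcoeff a (s x A))) /\
  (forall x, V x -> exists (V' : opens M) (d : nat),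
      V' x /\ forall y, V' y -> V y ->
        forall (A : {set 'I_p}) (a : mpoly.multinom q),
          (d < mpoly.mdeg a)%N -> mpoly.mcoeff a (s y A) = 0).

(* tau is an isomorphism of sheaves of graded algebras from C|_U onto the local
   model on U; tau V f only matters on V, for V contained in U. *)
Record trivialization (m : nat) (M : manifold R m) (C : graded_sheaf R M)
    (U : opens M) (tau : forall V : opens M, sec C V -> M -> W) : Prop := {
  triv_section : forall (V : opens M) (f : sec C V), V `<=` U ->
    model_section V (tau V f);
  triv_res : forall (V V' : opens M) (h : V' `<=` V) (f : sec C V) x,
    V `<=` U -> V' x -> tau V' (res C h f) x = tau V f x;
  triv_cst : forall (V : opens M) a x, V `<=` U -> V x ->
    tau V (cst C V a) x = wcst a;
  triv_add : forall (V : opens M) (f g : sec C V) x, V `<=` U -> V x ->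
    tau V (f + g) x = tau V f x + tau V g x;
  triv_mul : forall (V : opens M) (f g : sec C V) x, V `<=` U -> V x ->
    tau V (f * g) x = wmul (tau V f x) (tau V g x);
  triv_homogeneous : forall k (V : opens M) (f : sec C V) x, V `<=` U -> V x ->
    homogeneous k f -> whomogeneous k (tau V f x);
  triv_inj : forall (V : opens M) (f g : sec C V), V `<=` U ->
    (forall x, V x -> tau V f x = tau V g x) -> f = g;
  triv_surj : forall (V : opens M) (s : M -> W), V `<=` U ->
    model_section V s -> exists f : sec C V, forall x, V x -> tau V f x = s x }.

End LocalModel.

(* [fn f] is the smooth function f_0 on U (its values outside U are
   irrelevant); the fields about fn say that it identifies the degree 0
   part of the structure sheaf with the sheaf of smooth functions on the body. *)
Record Nmanifold (R : realType) (m0 m1 m2 : nat) := NManifold {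
  body :> manifold R m0;
  sheaf : graded_sheaf R body;
  fn : forall U : opens body, sec sheaf U -> body -> R;
  fn_gr0 : forall (U : opens body) (f : sec sheaf U) x, U x ->
    fn (gr sheaf 0 U f) x = fn f x;
  fn_res : forall (U V : opens body) (h : V `<=` U) (f : sec sheaf U) x, V x ->
    fn (res sheaf h f) x = fn f x;
  fn_cst : forall (U : opens body) (a : R) x, U x -> fn (cst sheaf U a) x = a;
  fn_add : forall (U : opens body) (f g : sec sheaf U) x, U x ->
    fn (f + g) x = fn f x + fn g x;
  fn_mul : forall (U : opens body) (f g : sec sheaf U) x, U x ->
    fn (f * g) x = fn f x * fn g x;
  fn_smooth : forall (U : opens body) (f : sec sheaf U), smooth_fun U (fn f);
  fn_inj : forall (U : opens body) (f g : sec sheaf U),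
    homogeneous 0 f -> homogeneous 0 g ->
    (forall x, U x -> fn f x = fn g x) -> f = g;
  fn_surj : forall (U : opens body) (u : body -> R), smooth_fun U u ->
    exists2 f : sec sheaf U, homogeneous 0 f & forall x, U x -> fn f x = u x;
  locally_trivial : forall x : body, exists2 U : opens body, U x &
    exists tau : forall V : opens body, sec sheaf V -> body -> wsym R m1 m2,
      trivialization U tau }.

Definition local_coordinates (R : realType) (m0 m1 m2 : nat)
    (M : Nmanifold R m0 m1 m2) (U : opens M)
    (x : 'I_m0 -> sec (sheaf M) U) (e : 'I_m1 -> sec (sheaf M) U)
    (p : 'I_m2 -> sec (sheaf M) U) : Prop :=
  exists (phi : M -> 'rV[R]_m0)
         (tau : forall V : opens M, sec (sheaf M) V -> M -> wsym R m1 m2),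
  [/\ is_chart U phi /\ trivialization U tau,
      forall i, homogeneous 0 (x i) /\ forall y, U y -> fn (x i) y = phi y 0 i,
      forall mu y, U y -> tau U (e mu) y = wgen1 mu
    & forall i y, U y -> tau U (p i) y = wgen2 i].

Record Nmorphism (R : realType) (m0 m1 m2 n0 n1 n2 : nat)
    (M : Nmanifold R m0 m1 m2) (N : Nmanifold R n0 n1 n2) := NMorphism {
  bmap :> M -> N;
  bmap_smooth : smooth_map bmap;
  bmap_pre := opens_preimage (proj1 bmap_smooth);
  sharp : forall V : opens N,
    {rmorphism sec (sheaf N) V -> sec (sheaf M) (bmap_pre V)};
  sharp_cst : forall V a,
    sharp V (cst (sheaf N) V a) = cst (sheaf M) (bmap_pre V) a;
  sharp_homogeneous : forall k V (f : sec (sheaf N) V),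
    homogeneous k f -> homogeneous k (sharp V f);
  sharp_res : forall (V V' : opens N) (h : V' `<=` V)
    (h' : bmap_pre V' `<=` bmap_pre V) (f : sec (sheaf N) V),
    sharp V' (res (sheaf N) h f) = res (sheaf M) h' (sharp V f) }.

Section Tangent.
Context {R : realType} {m0 m1 m2 : nat} (M : Nmanifold R m0 m1 m2).
Local Notation C := (sheaf M).

(* A map on the stalk at x is given by its values X U f on the germs at x of the
   sections f over the open neighbourhoods U of x; the values X U f for U not
   containing x are irrelevant. *)
Definition stalk_map := forall U : opens M, sec C U -> R.

Definition stalk_linear (x : M) (X : stalk_map) : Prop :=
  (forall (U V : opens M) (h : V `<=` U) (f : sec C U), V x ->
     X V (res C h f) = X U f) /\
  (forall (U : opens M) (a : R) (f g : sec C U), U x ->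
     X U (cst C U a * f + g) = a * X U f + X U g).

(* R sits in degree 0, hence a map of degree k kills the germs of degree d
   unless d + k = 0. *)
Definition homogeneous_tangent (x : M) (k : int) (X : stalk_map) : Prop :=
  [/\ stalk_linear x X,
      forall (U : opens M) (d : nat) (f : sec C U), U x -> homogeneous d f ->
        d%:Z + k != 0 -> X U f = 0
    & forall (U : opens M) (d : nat) (f g : sec C U), U x -> homogeneous d f ->
        X U (f * g) = X U f * fn g x + (-1) ^+ (`|k|%N * d) * fn f x * X U g].

Definition tangent (x : M) (X : stalk_map) : Prop :=
  exists (r : nat) (k : 'I_r -> int) (Y : 'I_r -> stalk_map),
    (forall i, homogeneous_tangent x (k i) (Y i)) /\
    (forall (U : opens M) (f : sec C U), U x -> X U f = \sum_(i < r) Y i U f).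

End Tangent.

Definition tangent_map (R : realType) (m0 m1 m2 n0 n1 n2 : nat)
    (M : Nmanifold R m0 m1 m2) (N : Nmanifold R n0 n1 n2) (Psi : Nmorphism M N)
    (X : stalk_map M) : stalk_map N :=
  fun V f => X (bmap_pre Psi V) (sharp Psi V f).

Definition regular_value (R : realType) (m0 m1 m2 n0 n1 n2 : nat)
    (M : Nmanifold R m0 m1 m2) (N : Nmanifold R n0 n1 n2) (Psi : Nmorphism M N)
    (c : N) : Prop :=
  forall x : M, Psi x = c ->
  forall Y : stalk_map N, tangent (Psi x) Y ->
  exists2 X : stalk_map M, tangent x X &
    forall (V : opens N) (f : sec (sheaf N) V), V (Psi x) ->
      tangent_map Psi X f = Y V f.

Section Ideals.
Context {R : realType} {X : topologicalType} (C : graded_sheaf R X).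
Implicit Types I J G : forall V : opens X, set (sec C V).

(* J restricts to a sheaf of (two-sided) ideals of C|_U. *)
Definition ideal_sheaf_on (U : opens X) J : Prop :=
  forall V : opens X, V `<=` U ->
  [/\ J V 0 /\ forall f g, J V f -> J V g -> J V (f + g),
      forall a f, J V f -> J V (a * f) /\ J V (f * a),
      forall (V' : opens X) (h : V' `<=` V) f, J V f -> J V' (res C h f)
    & forall f, (forall x, V x -> exists (V' : opens X) (h : V' `<=` V),
                   V' x /\ J V' (res C h f)) -> J V f].

(* The smallest sheaf of ideals of C|_U that contains the sections in G. *)
Definition generated_on (U : opens X) G (V : opens X) : set (sec C V) :=
  [set f | forall J, ideal_sheaf_on U J ->
     (forall W : opens X, W `<=` U -> G W `<=` J W) -> J V f].

End Ideals.
Arguments generated_on {R X C} U G V _.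

Section RegularIdeals.
Context {R : realType} {m0 m1 m2 : nat} (M : Nmanifold R m0 m1 m2).
Local Notation C := (sheaf M).

(* The restrictions to V of x^1..x^r0, e^1..e^r1, p^1..p^r2. *)
Definition coordinate_gens (r0 r1 r2 : nat) (U : opens M)
    (x : 'I_m0 -> sec C U) (e : 'I_m1 -> sec C U) (p : 'I_m2 -> sec C U)
    (V : opens M) : set (sec C V) :=
  [set f | exists h : V `<=` U,
    [\/ exists2 i : 'I_m0, (i < r0)%N & f = res C h (x i),
        exists2 i : 'I_m1, (i < r1)%N & f = res C h (e i)
      | exists2 i : 'I_m2, (i < r2)%N & f = res C h (p i)]].

Arguments coordinate_gens r0 r1 r2 {U} x e p V _.

Definition regular_ideal (I : forall V : opens M, set (sec C V)) : Prop :=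
  ideal_sheaf_on (opensT M) I /\
  exists S : set M,
    (forall (V : opens M) (f : sec C V), homogeneous 0 f ->
       (I V f <-> forall x, V x -> S x -> fn f x = 0)) /\
    exists r0 r1 r2 : nat, [/\ (r0 <= m0)%N, (r1 <= m1)%N, (r2 <= m2)%N &
      forall x, S x -> exists2 U : opens M, U x &
        exists (xx : 'I_m0 -> sec C U) (ee : 'I_m1 -> sec C U)
               (pp : 'I_m2 -> sec C U),
          local_coordinates xx ee pp /\
          forall V : opens M, V `<=` U ->
            I V = generated_on U (coordinate_gens r0 r1 r2 xx ee pp) V].

End RegularIdeals.

Definition point_ideal (R : realType) (n0 n1 n2 : nat)
    (N : Nmanifold R n0 n1 n2) (c : N) (V : opens N) : set (sec (sheaf N) V) :=
  [set f | V c -> fn f c = 0].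
Arguments point_ideal {R n0 n1 n2 N} c V _.

(* The sheaf of ideals of C_M generated by the image under Psi^# of sections of
   C_N; such an image is a section over a preimage, and generates the same sheaf
   of ideals as all its restrictions. *)
Definition pullback_ideal (R : realType) (m0 m1 m2 n0 n1 n2 : nat)
    (M : Nmanifold R m0 m1 m2) (N : Nmanifold R n0 n1 n2) (Psi : Nmorphism M N)
    (J : forall V : opens N, set (sec (sheaf N) V)) :
    forall U : opens M, set (sec (sheaf M) U) :=
  generated_on (opensT M) (fun U => [set g |
    exists (V : opens N) (h : U `<=` bmap_pre Psi V) (f : sec (sheaf N) V),
      J V f /\ g = res (sheaf M) h (sharp Psi V f)]).

(* Main.v *)
(** Near a point [x] of the fibre over [c], surjectivity of the tangent map gives
    right inverses of the three Jacobian matrices at [x]: those of the pulled-back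
    coordinates of degree 0, 1 and 2 of [N] with respect to the coordinates of
    [M].  The matrices can thus be completed to invertible ones, and the
    pulled-back coordinates to local coordinates of [M]: in degree 0 by the
    inverse function theorem, in degrees 1 and 2 by an automorphism of the local
    model depending smoothly on the point.

    The ideal of [c] is generated by the coordinates of [N] centred at [c], by the
    expansion of a section in monomials and Hadamard's lemma for its part of
    degree 0.  Hence the pulled-back ideal is generated near [x] by the first
    [n0], [n1], [n2] of the new coordinates, and away from the fibre it is the
    unit ideal.  Hadamard's lemma also shows that its part of degree 0 consists of
    the functions vanishing on the fibre. *)

Require Import Defs.
From HB Require Import structures.
From mathcomp Require Import all_boot all_order all_algebra.
From mathcomp Require Import reals.
From mathcomp Require boolp.
From mathcomp Require mpoly.
Import (canonicals, coercions) mpoly.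
From mathcomp Require Import ring lra zify.

Set Implicit Arguments.
Unset Strict Implicit.
Unset Printing Implicit Defensive.

Import Order.TTheory GRing.Theory Num.Theory.

Local Open Scope ring_scope.

(** * The algebra of the local model *)

Section Inversions.
Context {p : nat}.
Implicit Types A B C D : {set 'I_p}.

(** A tangent vector is a derivation at a point, so it kills every product of two sections whose
    degree-zero parts vanish there. In degree 2 the tangent map thus sees only the part of a
    pulled-back coordinate that is linear in the $p^I$, while the coordinate itself may contain
    terms $e^\mu e^\nu$. The change of generators is therefore triangular rather than linear,
    $e'=Ae$, $p'=Bp+N(e)$ with $N$ quadratic; solving for $e$ first inverts it, so $A$ and $B$ alone
    decide invertibility. Smoothness is given by iterated partial derivatives. The chain rule and
    the inverse function theorem accordingly rest on a mean value formula that moves one coordinate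
    at a time. A trivialization, the map [fn] and $\psi^\sharp$ are separate data. They are linked
    through invertibility: a section of degree 0 that is nonzero at a point is invertible near it.
    The ideal generated by sections is an intersection over all sheaves of ideals containing them,
    so membership is proved locally and against an arbitrary such sheaf. *)

Lemma inversionsE B C : inversions B C =
  (\sum_(b in B) \sum_(c in C) (c < b))%N.
Proof.
rewrite /inversions -sum1_card pair_big_dep /=.
rewrite [RHS]big_mkcond [LHS]big_mkcond /=; apply: eq_bigr => -[b c] _ /=.
by rewrite !inE /=; case: (b \in B); case: (c \in C); case: (c < b)%N.
Qed.

Lemma inversionsUl B C D : [disjoint B & C] ->
  inversions (setU B C) D = (inversions B D + inversions C D)%N.
Proof. by move=> dBC; rewrite !inversionsE -bigU//; apply: eq_bigl => b; rewrite !inE. Qed.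

Lemma inversionsUr B C D : [disjoint C & D] ->
  inversions B (setU C D) = (inversions B C + inversions B D)%N.
Proof.
move=> dCD; rewrite !inversionsE -big_split; apply: eq_bigr => b _ /=.
by rewrite -bigU//; apply: eq_bigl => c; rewrite !inE.
Qed.

(** Every pair of $B\times C$ is out of order in exactly one of the two products, the sets having no
    common element. This is the source of the sign $(-1)^{|B||C|}$ of graded commutativity. *)
Lemma inversionsC B C : [disjoint B & C] ->
  (inversions B C + inversions C B)%N = (#|B| * #|C|)%N.
Proof.
move=> dBC; rewrite !inversionsE [X in (_ + X)%N]exchange_big /=.
rewrite -big_split /= -sum1_card big_distrl /=; apply: eq_bigr => b bB.
rewrite mul1n -big_split /= -sum1_card; apply: eq_bigr => c cC.
have : b != c by apply: contraTneq bB => ->; rewrite (disjointFl dBC).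
by rewrite -val_eqE /=; case: ltngtP.
Qed.

End Inversions.

(** A second name for [wsym], under which [wmul] becomes the ring multiplication. *)
Definition walg (R : realType) (p q : nat) : Type := wsym R p q.

Section WAlg.
Context {R : realType} {p q : nat}.
Local Notation W := (walg R p q).
Local Notation S := (mpoly.mpoly q R).
Implicit Types (A B C D : {set 'I_p}) (u v w : W) (s t : S).

HB.instance Definition _ := GRing.Zmodule.copy W {ffun {set 'I_p} -> S}.

(** The monomial $s\,e^A$. *)
Definition wb A s : W := [ffun B : {set 'I_p} => if B == A then s else 0].

Lemma wb_is_additive A : zmod_morphism (wb A).
Proof. by move=> s t; apply/ffunP => B; rewrite !ffunE; case: eqP => _; rewrite ?subr0. Qed.
HB.instance Definition _ A := GRing.isZmodMorphism.Build S W (wb A) (wb_is_additive A).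

Lemma wb_sum v : v = \sum_A wb A (v A).
Proof.
apply/ffunP => B; rewrite sum_ffunE (bigD1 B)//= ffunE eqxx big1 ?addr0// => A AB.
by rewrite ffunE eq_sym (negbTE AB).
Qed.

Definition wmulW (u v : W) : W := wmul u v.

Lemma wmulDl : left_distributive wmulW +%R.
Proof.
move=> u v w; apply/ffunP => A; rewrite !ffunE -big_split; apply: eq_bigr => B _ /=.
by rewrite ffunE !mulrDl mulrDr.
Qed.

Lemma wmulDr : right_distributive wmulW +%R.
Proof.
move=> u v w; apply/ffunP => A; rewrite !ffunE -big_split; apply: eq_bigr => B _ /=.
by rewrite ffunE !mulrDr.
Qed.

Lemma wmul_wb B C s t : wmulW (wb B s) (wb C t) =
  if [disjoint B & C] then wb (setU B C) ((-1) ^+ inversions B C * (s * t)) else 0.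
Proof.
apply/ffunP => A; rewrite ffunE.
transitivity (if (B \subset A) && (setD A B == C)
    then (-1) ^+ inversions B C * (s * t) else 0).
  have [BA|nBA] /= := boolP (B \subset A); last first.
    rewrite big1// => D DA; rewrite !ffunE; case: eqP => [DB|_]; last by rewrite mul0r mulr0.
    by rewrite -DB DA in nBA.
  rewrite (bigD1 B)//= big1 => [|D /andP[_ DB]]; last first.
    by rewrite !ffunE (negbTE DB) mul0r mulr0.
  rewrite addr0 !ffunE eqxx; case: eqP => [->//|_]; by rewrite !mulr0.
case: ifP => [/andP[BA /eqP <-]|H].
  have -> : [disjoint B & setD A B].
    by rewrite -setI_eq0 setIDA setIC -setIDA setDv setI0.
  have -> : B :|: (A :\: B) = A.
    by apply/setP => x; rewrite !inE; have [/(subsetP BA)->|] := boolP (x \in B).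
  by rewrite ffunE eqxx.
case: ifP => dBC; rewrite ffunE//; case: eqP => // AE.
case/negP: H; rewrite AE subsetUl /= setDUl setDv set0U; apply/eqP/setDidPl.
by rewrite disjoint_sym.
Qed.

(** Monomials generate the model additively. Associativity, centrality of the coefficients and
    multiplicativity of substitutions are reduced to monomials in this way, one variable at a
    time. *)
Lemma wb_ext (V : zmodType) (F G : W -> V) :
  {morph F : u v / u + v} -> {morph G : u v / u + v} ->
  (forall A s, F (wb A s) = G (wb A s)) -> F =1 G.
Proof.
move=> FD GD FG.
have F0 : F 0 = 0 by apply: (addrI (F 0)); rewrite -FD !addr0.
have G0 : G 0 = 0 by apply: (addrI (G 0)); rewrite -GD !addr0.
move=> u; rewrite (wb_sum u).
elim: (index_enum _) => [|A r IHr]; first by rewrite !big_nil F0 G0.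
by rewrite !big_cons FD GD IHr FG.
Qed.

Lemma wmul0w v : wmulW (0 : W) v = 0.
Proof. by apply: (addrI (wmulW 0 v)); rewrite -wmulDl !addr0. Qed.

Lemma wmulw0 v : wmulW v (0 : W) = 0.
Proof. by apply: (addrI (wmulW v 0)); rewrite -wmulDr !addr0. Qed.

(** On three monomials both bracketings vanish unless the index sets are pairwise disjoint.
    Otherwise the additivity of [inversions] gives both the same sign, with one contribution from
    each of the three pairs of sets. *)
Lemma wmulA : associative wmulW.
Proof.
move=> u v w; move: u; apply: wb_ext => [u u'|u u'|B s].
- by rewrite wmulDl.
- by rewrite !wmulDl.
move: v; apply: wb_ext => [v v'|v v'|C t].
- by rewrite wmulDl wmulDr.
- by rewrite wmulDr wmulDl.
move: w; apply: wb_ext => [w w'|w w'|D x].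
- by rewrite !wmulDr.
- by rewrite wmulDr.
rewrite !wmul_wb; case: (boolP [disjoint C & D]) => dCD; last first.
  rewrite wmulw0; case: ifP => dBC; last by rewrite wmul0w.
  rewrite wmul_wb; case: ifP => //; rewrite -setI_eq0 setIUl setU_eq0 => /andP[_].
  by rewrite setI_eq0 (negbTE dCD).
case: (boolP [disjoint B & C]) => dBC; last first.
  rewrite wmul0w wmul_wb; case: ifP => //.
  by rewrite -setI_eq0 setIUr setU_eq0 setI_eq0 (negbTE dBC).
rewrite !wmul_wb -!setI_eq0 setIUr setIUl !setU_eq0 !setI_eq0 dCD dBC andbT /=.
case: ifP => // dBD; rewrite setUA; congr wb.
rewrite (inversionsUl D dBC) (inversionsUr B dCD) !exprD.
by ring.
Qed.

Lemma wmul1w : left_id (wcst 1 : W) wmulW.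
Proof.
have -> : wcst 1 = wb set0 1 :> W by [].
apply: wb_ext => [u v|//|A s]; first by rewrite wmulDr.
rewrite wmul_wb -setI_eq0 set0I eqxx set0U mul1r inversionsE big_pred0 ?mul1r//.
by move=> b; rewrite inE.
Qed.

Lemma wmulw1 : right_id (wcst 1 : W) wmulW.
Proof.
have -> : wcst 1 = wb set0 1 :> W by [].
apply: wb_ext => [u v|//|A s]; first by rewrite wmulDl.
rewrite wmul_wb -setI_eq0 setI0 eqxx setU0 mulr1 inversionsE big1 ?mul1r//.
by move=> b _; rewrite big_pred0// => c; rewrite inE.
Qed.

Lemma wcst1_neq0 : wcst 1 != 0 :> W.
Proof.
apply/eqP => /ffunP /(_ set0) /eqP.
by rewrite !ffunE eqxx oner_eq0.
Qed.

HB.instance Definition _ := GRing.Zmodule_isNzRing.Build W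
  wmulA wmul1w wmulw1 wmulDl wmulDr wcst1_neq0.

End WAlg.

Section WAlgTheory.
Context {R : realType} {p q : nat}.
Local Notation W := (walg R p q).
Local Notation S := (mpoly.mpoly q R).
Implicit Types (A B C D : {set 'I_p}) (u v w : W) (s t : S).

Lemma wbM B C s t : wb B s * wb C t =
  if [disjoint B & C] then wb (B :|: C) ((-1) ^+ inversions B C * (s * t)) else 0 :> W.
Proof. exact: wmul_wb. Qed.

Lemma inversions0l A : inversions set0 A = 0%N.
Proof. by rewrite inversionsE big_pred0 // => b; rewrite inE. Qed.

Lemma inversions0r A : inversions A set0 = 0%N.
Proof.
by rewrite inversionsE big1// => b _; rewrite big_pred0// => c; rewrite inE.
Qed.

Lemma wb0M s C t : wb set0 s * wb C t = wb C (s * t) :> W.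
Proof. by rewrite wbM -setI_eq0 set0I eqxx set0U inversions0l mul1r. Qed.

Lemma wbM0 s C t : wb C t * wb set0 s = wb C (t * s) :> W.
Proof. by rewrite wbM -setI_eq0 setI0 eqxx setU0 inversions0r mul1r. Qed.

Lemma wb0_comm s u : GRing.comm u (wb set0 s).
Proof.
rewrite /GRing.comm; move: u; apply: wb_ext => [u v|u v|A t].
- by rewrite mulrDl.
- by rewrite mulrDr.
- by rewrite wb0M wbM0 mulrC.
Qed.

Definition wC (a : R) : W := wcst a.

Lemma wCE a : wC a = wb set0 (mpoly.mpolyC q a).
Proof. by []. Qed.

Lemma wC_is_additive : zmod_morphism wC.
Proof. by move=> a b; rewrite !wCE mpoly.mpolyCB raddfB. Qed.
Lemma wC_is_multiplicative : monoid_morphism wC.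
Proof. by split=> [|a b]; rewrite ?wCE// mpoly.mpolyCM wb0M. Qed.
HB.instance Definition _ := GRing.isZmodMorphism.Build R W wC wC_is_additive.
HB.instance Definition _ := GRing.isMonoidMorphism.Build R W wC wC_is_multiplicative.

Lemma wC_comm a u : GRing.comm u (wC a).
Proof. exact: wb0_comm. Qed.

Lemma wcoefC a u A m : mpoly.mcoeff m ((wC a * u) A) = a * mpoly.mcoeff m (u A).
Proof.
have -> : (wC a * u) A = mpoly.mpolyC q a * u A; last by rewrite mpoly.mcoeffCM.
move: u; apply: wb_ext => [u v|u v|B s].
- by rewrite mulrDr ffunE.
- by rewrite ffunE mulrDr.
- by rewrite wCE wb0M !ffunE; case: eqP; rewrite ?mulr0.
Qed.

Definition wparity (b : bool) v := forall A, v A != 0 -> odd #|A| = b.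

(** The coefficients in $\mathrm S\,\mathbb R^q$ are central, so exchanging two monomials costs
    $(-1)^{|B||C|}$, in which only the parities of the exterior degrees enter. *)
Lemma wparity_comm b c u v : wparity b u -> wparity c v ->
  u * v = (-1) ^+ (b && c) * (v * u).
Proof.
move=> ub vc; rewrite (wb_sum u) (wb_sum v) !big_distrlr /= exchange_big /= mulr_sumr.
apply: eq_bigr => C _; rewrite mulr_sumr; apply: eq_bigr => B _.
have [->|/ub uB] := eqVneq (u B) 0; first by rewrite raddf0 mul0r mulr0 mulr0.
have [->|/vc vC] := eqVneq (v C) 0; first by rewrite raddf0 mul0r !mulr0.
rewrite !wbM [in RHS]disjoint_sym setUC; case: ifP => [dBC|_]; last by rewrite mulr0.
rewrite -[(-1) ^+ (b && c)]/((-1) ^+ (b && c) : W).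
have -> : (-1) ^+ (b && c) = wb set0 ((-1) ^+ (b && c)) :> W.
  by case: (b && c); rewrite ?expr0 ?expr1 ?raddfN.
rewrite wb0M; congr wb; rewrite [RHS]mulrA -exprD [u B * _]mulrC; congr (_ * _).
rewrite -[LHS]signr_odd -[RHS]signr_odd oddD; congr ((-1) ^+ nat_of_bool _).
rewrite oddb -uB -vC -oddM -(inversionsC dBC) oddD.
by rewrite -addbA addbb addbF.
Qed.

Lemma whomogeneous_parity k v : whomogeneous k v -> wparity (odd k) v.
Proof.
move=> vk A vA; have : mpoly.mlead (v A) \in mpoly.msupp (v A) by exact: mpoly.mlead_supp.
by rewrite mpoly.mcoeff_msupp => /vk <-; rewrite oddD odd_double addbF.
Qed.

Lemma whomogeneous_comm k v u : whomogeneous k v -> ~~ odd k -> GRing.comm u v.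
Proof.
move=> vk /negbTE ek; rewrite /GRing.comm; move: u.
apply: wb_ext => [u w|u w|A s]; [by rewrite mulrDl|by rewrite mulrDr|].
have up : wparity (odd #|A|) (wb A s).
  by move=> B; rewrite ffunE; have [->//|] := eqVneq B A; rewrite eqxx.
by rewrite (wparity_comm up (whomogeneous_parity vk)) ek andbF mul1r.
Qed.

Lemma whomogeneous_anticomm u v : whomogeneous 1 u -> whomogeneous 1 v ->
  u * v = - (v * u).
Proof.
move=> u1 v1; rewrite (wparity_comm (whomogeneous_parity u1) (whomogeneous_parity v1)).
by rewrite expr1 mulN1r.
Qed.

Lemma whomogeneous0 k : whomogeneous k (0 : W).
Proof. by move=> A m; rewrite ffunE mpoly.mcoeff0 eqxx. Qed.

Lemma whomogeneousD k u v : whomogeneous k u -> whomogeneous k v ->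
  whomogeneous k (u + v).
Proof.
move=> uk vk A m; rewrite ffunE mpoly.mcoeffD => H.
have [u0|] := eqVneq (mpoly.mcoeff m (u A)) 0; last exact: uk.
by apply: vk; rewrite u0 add0r in H.
Qed.

Lemma whomogeneousN k u : whomogeneous k u -> whomogeneous k (- u).
Proof. by move=> uk A m; rewrite ffunE mpoly.mcoeffN oppr_eq0; exact: uk. Qed.

Lemma whomogeneous_sum k I (r : seq I) (P : pred I) (F : I -> W) :
  (forall i, P i -> whomogeneous k (F i)) -> whomogeneous k (\sum_(i <- r | P i) F i).
Proof.
move=> Fk; elim/big_ind: _ => //; first exact: whomogeneous0.
by move=> u v; exact: whomogeneousD.
Qed.

Lemma whomogeneousM j k u v : whomogeneous j u -> whomogeneous k v ->
  whomogeneous (j + k) (u * v).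
Proof.
move=> uj vk; rewrite (wb_sum u) (wb_sum v) big_distrlr /=.
apply: whomogeneous_sum => B _; apply: whomogeneous_sum => C _.
rewrite wbM; case: ifP => [dBC|_]; last exact: whomogeneous0.
move=> A m; rewrite ffunE; case: (A =P _) => [->|_]; last by rewrite mpoly.mcoeff0 eqxx.
rewrite -signr_odd -[(-1) ^+ _ * _]/((-1) ^+ _ * _).
have -> : (-1) ^+ odd (inversions B C) * (u B * v C) =
    mpoly.mpolyC q ((-1) ^+ odd (inversions B C)) * (u B * v C).
  by case: odd; rewrite ?expr0 ?expr1 ?raddfN /= ?mpoly.mpolyC1.
rewrite mpoly.mcoeffCM mulf_eq0 negb_or => /andP[_].
rewrite -mpoly.mcoeff_msupp => /mpoly.msuppM_le /allpairsP[[m1 m2] /= [h1 h2 ->]].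
move: h1 h2; rewrite !mpoly.mcoeff_msupp => /uj <- /vk <-.
rewrite mpoly.mdegD cardsU (_ : B :&: C = set0) ?cards0 ?subn0; last first.
  by apply/eqP; rewrite setI_eq0.
by rewrite doubleD addnACA.
Qed.

Lemma whomogeneous_C a : whomogeneous 0 (wC a).
Proof.
move=> A m; rewrite ffunE; case: (A =P _) => [->|_]; last by rewrite mpoly.mcoeff0 eqxx.
rewrite mpoly.mcoeffC; have [->|] := eqVneq m (@mpoly.mnm0 q); last by rewrite mulr0 eqxx.
by rewrite cards0 mpoly.mdeg0.
Qed.

Lemma whomogeneous1 : whomogeneous 0 (1 : W).
Proof. by rewrite -[1](rmorph1 wC); exact: whomogeneous_C. Qed.

Lemma whomogeneousX k u n : whomogeneous k u -> whomogeneous (n * k) (u ^+ n).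
Proof.
move=> uk; elim: n => [|n IHn]; first exact: whomogeneous1.
by rewrite exprS mulSn; exact: whomogeneousM.
Qed.

Lemma whomogeneous_wgen1 mu : whomogeneous 1 (wgen1 mu : W).
Proof.
move=> A m; rewrite ffunE; case: (A =P _) => [->|_]; last by rewrite mpoly.mcoeff0 eqxx.
rewrite mpoly.mcoeff1; have [->|] := eqVneq m (@mpoly.mnm0 q); last by rewrite eqxx.
by rewrite cards1 mpoly.mdeg0.
Qed.

Lemma whomogeneous_wgen2 i : whomogeneous 2 (wgen2 i : W).
Proof.
move=> A m; rewrite ffunE; case: (A =P _) => [->|_]; last by rewrite mpoly.mcoeff0 eqxx.
rewrite mpoly.mcoeffX; have [<-|] := eqVneq (mpoly.mnm1 i) m; last by rewrite eqxx.
by rewrite cards0 mpoly.mdeg1.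
Qed.

End WAlgTheory.

(** * Ordered products of anticommuting elements *)

Section OrderedProducts.
Context {R : realType} {p q : nat}.
Local Notation W := (walg R p q).
Implicit Types (A B C : {set 'I_p}) (E : 'I_p -> W).

Definition eprod E A : W := \prod_(i < p | i \in A) E i.

Lemma wsqr_eq0 (u : W) : u * u = - (u * u) -> u * u = 0.
Proof.
move=> H; apply/ffunP => A; apply/mpoly.mpolyP => m.
have /ffunP/(_ A) /(congr1 (mpoly.mcoeff m)) := H.
rewrite !ffunE mpoly.mcoeffN mpoly.mcoeff0 => /eqP.
by rewrite -addr_eq0 -mulr2n mulrn_eq0 => /eqP.
Qed.

(* The sign counts the factors that [E mu] crosses. *)
Lemma eprod_cons E A mu : (forall i j, E i * E j = - (E j * E i)) ->
  E mu * eprod E A = if mu \in A then 0 else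
    (-1) ^+ inversions [set mu] A * eprod E (mu |: A).
Proof.
move=> Ea.
have [s1 [s2 [es us1 us2]]] : exists s1 s2, [/\ index_enum 'I_p = s1 ++ mu :: s2,
    all (fun i : 'I_p => i < mu)%N s1 & all (fun i : 'I_p => mu < i)%N s2].
  have : mu \in index_enum 'I_p by exact: mem_index_enum.
  have : sorted ltn (map val (index_enum 'I_p)).
    by rewrite [index_enum _]unlock -enumT val_enum_ord iota_ltn_sorted.
  rewrite (sorted_pairwise ltn_trans) => srt mui; move: srt; case/splitPr: mui => s1 s2.
  rewrite map_cat /= pairwise_cat /= allrel_consr => /and3P[/andP[h1 _] _ /andP[h2 _]].
  exists s1, s2; split=> //.
    by move: h1; rewrite all_map; apply: sub_all.
  by move: h2; rewrite all_map; apply: sub_all.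
have swap s : E mu * (\prod_(i <- s | i \in A) E i) =
    (-1) ^+ count (mem A) s * ((\prod_(i <- s | i \in A) E i) * E mu).
  elim: s => [|i s IHs]; first by rewrite !big_nil mulr1 !mul1r.
  rewrite !big_cons /=; case: (i \in A) => //=.
  rewrite mulrA Ea mulNr -[in LHS]mulrA IHs exprS mulN1r mulNr.
  by congr (- _); rewrite !mulrA commr_sign.
have noA s : mu \notin s -> \prod_(i <- s | i \in mu |: A) E i = \prod_(i <- s | i \in A) E i.
  move=> ns; rewrite big_seq_cond [RHS]big_seq_cond; apply: eq_bigl => i.
  by rewrite !inE; have [->|//] := eqVneq i mu; rewrite (negbTE ns).
have ns1 : mu \notin s1 by apply/negP => /(allP us1); rewrite ltnn.
have ns2 : mu \notin s2 by apply/negP => /(allP us2); rewrite ltnn.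
have cnt : count (mem A) s1 = inversions [set mu] A.
  rewrite inversionsE big_set1 -sum1_count big_mkcond /= [RHS]big_mkcond /= es.
  rewrite big_cat big_cons /= ltnn if_same add0n [X in _ = (_ + X)%N]big1_seq ?addn0.
    by apply: eq_big_seq => i /(allP us1) ->.
  by move=> i /andP[_ /(allP us2) mi]; rewrite ltnNge (ltnW mi) /= if_same.
rewrite /eprod es !big_cat !big_cons /= mulrA swap cnt.
case: ifP => mA; rewrite -!mulrA.
  by rewrite [E mu * (E mu * _)]mulrA (wsqr_eq0 (Ea mu mu)) mul0r !mulr0.
by rewrite !inE eqxx /= !noA.
Qed.

Lemma eprod0 E : eprod E set0 = 1.
Proof. by rewrite /eprod big_pred0// => i; rewrite inE. Qed.

Lemma eprod1 E mu : eprod E [set mu] = E mu.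
Proof. by rewrite /eprod (big_pred1 mu)// => i; rewrite inE. Qed.

(** Induction on [A], peeling off one factor at each step. Any anticommuting family thus obeys the
    sign rule of the generators $e^\mu$, which is what makes substitution for them
    multiplicative. *)
Lemma eprodM E A B : (forall i j, E i * E j = - (E j * E i)) ->
  eprod E A * eprod E B =
  if [disjoint A & B] then (-1) ^+ inversions A B * eprod E (A :|: B) else 0.
Proof.
move=> Ea; have [n] := ubnP #|A|; elim: n A => // n IHn A.
have [->|[mu muA]] := set_0Vmem A.
  by move=> _; rewrite eprod0 mul1r -setI_eq0 set0I eqxx set0U inversions0l mul1r.
rewrite (cardsD1 mu A) muA add1n ltnS => /IHn IH.
have nmu : mu \in A :\ mu = false by rewrite !inE eqxx.
have AE : mu |: (A :\ mu) = A by rewrite setD1K.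
have -> : eprod E A = (-1) ^+ inversions [set mu] (A :\ mu) * (E mu * eprod E (A :\ mu)).
  by rewrite (eprod_cons _ _ Ea) nmu AE mulrA -exprD addnn -signr_odd odd_double mul1r.
rewrite -!mulrA IH -[in RHS]AE.
have -> : [disjoint mu |: A :\ mu & B] = (mu \notin B) && [disjoint A :\ mu & B].
  by rewrite -setI_eq0 setIUl setU_eq0 !setI_eq0 disjoints1.
case: ifP => dB; last by rewrite andbF !mulr0.
rewrite andbT [E mu * _]mulrA [E mu * _]commr_sign -mulrA (eprod_cons _ _ Ea) inE nmu /=.
case: ifP => mB; first by rewrite !mulr0.
have dmu : [disjoint [set mu] & A :\ mu] by rewrite disjoints1 nmu.
rewrite !mulrA -!exprD setUA; congr (_ * _).
rewrite (inversionsUl _ dmu) (inversionsUr _ dB).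
rewrite -[LHS]signr_odd -[RHS]signr_odd !oddD; congr ((-1) ^+ nat_of_bool _).
by case: (odd _); case: (odd _); case: (odd _).
Qed.

Lemma whomogeneous_eprod E A : (forall i, whomogeneous 1 (E i)) ->
  whomogeneous #|A| (eprod E A).
Proof.
move=> E1; rewrite /eprod -sum1_card.
elim: (index_enum _) => [|i r IHr]; first by rewrite !big_nil; exact: whomogeneous1.
by rewrite !big_cons; case: ifP => // _; exact: whomogeneousM.
Qed.

Lemma wgen1E mu : wgen1 mu = wb [set mu] 1 :> W.
Proof. by apply/ffunP => A; rewrite !ffunE; case: eqP. Qed.

Lemma wgen2E i : wgen2 i = wb set0 (mpoly.mpolyX R (mpoly.mnm1 i)) :> W.
Proof. by apply/ffunP => A; rewrite !ffunE. Qed.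

Lemma eprod_wgen1 A : eprod (@wgen1 R p q : 'I_p -> W) A = wb A 1.
Proof.
have Ea i j : (wgen1 i : W) * wgen1 j = - ((wgen1 j : W) * wgen1 i).
  by apply: whomogeneous_anticomm; exact: whomogeneous_wgen1.
have [n] := ubnP #|A|; elim: n A => // n IHn A.
have [->|[mu muA]] := set_0Vmem A; first by rewrite eprod0.
rewrite (cardsD1 mu A) muA add1n ltnS => /IHn IH.
have nmu : mu \in A :\ mu = false by rewrite !inE eqxx.
have := eprod_cons (A :\ mu) mu Ea; rewrite nmu IH setD1K// wgen1E wbM disjoints1 nmu /=.
rewrite setD1K// mulr1 -[in LHS]signr_odd -[in RHS]signr_odd.
case: odd; rewrite ?expr0 ?mul1r ?expr1 ?mulr1 //= mulN1r raddfN.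
by move/oppr_inj.
Qed.

End OrderedProducts.

(** * Substitution endomorphisms of the local model *)

Section Lift.
Context {R : realType} {p q : nat}.
Local Notation W := (walg R p q).
Local Notation S := (mpoly.mpoly q R).
Variables (E : 'I_p -> W) (P : 'I_q -> W).
Hypothesis E1 : forall i, whomogeneous 1 (E i).
Hypothesis P2 : forall i, whomogeneous 2 (P i).
Implicit Types (A B : {set 'I_p}) (u v w : W) (s t : S).

(** The algebra endomorphism that substitutes [E] for the odd and [P] for the even generators,
    written out on monomials. *)
Definition wlift v : W := \sum_A mpoly.mmap (@wC R p q) P (v A) * eprod E A.

Let Ea i j : E i * E j = - (E j * E i).
Proof. exact: whomogeneous_anticomm. Qed.

Lemma P_comm i u : GRing.comm u (P i).
Proof. exact: (whomogeneous_comm _ (@P2 i)). Qed.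

Lemma mmap1_comm m u : GRing.comm u (mpoly.mmap1 P m).
Proof. by apply: commr_prod => i _; apply: commrX; exact: P_comm. Qed.

Lemma mmap_comm s u : GRing.comm u (mpoly.mmap (@wC R p q) P s).
Proof.
apply: commr_sum => m _; apply: commrM; last exact: mmap1_comm.
exact: wC_comm.
Qed.

(** The target is not commutative, but the [P i] have even degree and are therefore central, as are
    the constants. *)
Lemma wmmapM s t : mpoly.mmap (@wC R p q) P (s * t) =
  mpoly.mmap (@wC R p q) P s * mpoly.mmap (@wC R p q) P t.
Proof.
have h1 i x : GRing.comm x (P i) by exact: P_comm.
have h2 (s' : S) m m' : GRing.comm (wC (mpoly.mcoeff m s') : W) (mpoly.mmap1 P m').
  exact: mmap1_comm.
by have [M _] := mpoly.commr_mmap_is_multiplicative h1 h2.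
Qed.

Lemma wliftD u v : wlift (u + v) = wlift u + wlift v.
Proof.
rewrite /wlift -big_split; apply: eq_bigr => A _ /=.
by rewrite ffunE raddfD mulrDl.
Qed.

Lemma wlift0 : wlift 0 = 0.
Proof. by apply: (addrI (wlift 0)); rewrite -wliftD !addr0. Qed.

Lemma wlift_wb A s : wlift (wb A s) = mpoly.mmap (@wC R p q) P s * eprod E A.
Proof.
rewrite /wlift (bigD1 A)//= ffunE eqxx big1 ?addr0// => B BA.
by rewrite ffunE (negbTE BA) raddf0 mul0r.
Qed.

Lemma wliftM u v : wlift (u * v) = wlift u * wlift v.
Proof.
move: u; apply: wb_ext => [u u'|u u'|A s]; rewrite ?mulrDl ?wliftD ?mulrDl//.
move: v; apply: wb_ext => [v v'|v v'|B t]; rewrite ?mulrDr ?wliftD ?mulrDr//.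
rewrite wbM !wlift_wb; set es := eprod E A.
rewrite [RHS](_ : _ = mpoly.mmap (@wC R p q) P (s * t) * (es * eprod E B)); last first.
  by rewrite wmmapM -!mulrA; congr (_ * _); rewrite !mulrA mmap_comm.
rewrite eprodM//; case: ifP => dAB; last first.
  by rewrite mulr0 wlift0.
rewrite wlift_wb [RHS]mulrA; congr (_ * _).
rewrite -signr_odd -[in RHS]signr_odd; case: odd; rewrite ?expr0 ?expr1 ?mulr1 ?mul1r//.
by rewrite mulrN1 mulN1r raddfN.
Qed.

Lemma wlift_C a : wlift (wC a) = wC a.
Proof. by rewrite wCE wlift_wb mpoly.mmapC eprod0 mulr1. Qed.

Lemma wlift1 : wlift 1 = 1.
Proof. by rewrite -(rmorph1 (@wC R p q)) wlift_C. Qed.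

Lemma wliftN u : wlift (- u) = - wlift u.
Proof. by apply: (addrI (wlift u)); rewrite -wliftD !subrr wlift0. Qed.

Lemma wlift_wgen1 i : wlift (wgen1 i) = E i.
Proof.
rewrite wgen1E wlift_wb eprod1 -(mpoly.mpolyC1) mpoly.mmapC.
by rewrite /= rmorph1 mul1r.
Qed.

Lemma wlift_wgen2 i : wlift (wgen2 i) = P i.
Proof. by rewrite wgen2E wlift_wb mpoly.mmapX mpoly.mmap1U eprod0 mulr1. Qed.

Lemma wlift_homogeneous k v : whomogeneous k v -> whomogeneous k (wlift v).
Proof.
move=> vk; apply: whomogeneous_sum => A _; rewrite /mpoly.mmap mulr_suml.
rewrite big_seq; apply: whomogeneous_sum => m; rewrite mpoly.mcoeff_msupp => /vk <-.
rewrite addnC; apply: whomogeneousM; last exact: whomogeneous_eprod.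
rewrite -[X in whomogeneous X]add0n; apply: whomogeneousM; first exact: whomogeneous_C.
rewrite /mpoly.mmap1 mpoly.mdegE -mul2n big_distrr /=.
elim: (index_enum _) => [|i r IHr]; first by rewrite !big_nil; exact: whomogeneous1.
rewrite !big_cons; apply: whomogeneousM => //.
by rewrite mulnC; exact: whomogeneousX.
Qed.

End Lift.

Section LiftComp.
Context {R : realType} {p q : nat}.
Local Notation W := (walg R p q).
Variables (E E' : 'I_p -> W) (P P' : 'I_q -> W).
Hypothesis E1 : forall i, whomogeneous 1 (E i).
Hypothesis P2 : forall i, whomogeneous 2 (P i).

Lemma wlift_sum I (r : seq I) (Q : pred I) (F : I -> W) :
  wlift E P (\sum_(i <- r | Q i) F i) = \sum_(i <- r | Q i) wlift E P (F i).
Proof. by elim/big_rec2: _ => [|i x y _ <-]; rewrite ?wlift0 ?wliftD. Qed.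

Lemma wlift_prod I (r : seq I) (Q : pred I) (F : I -> W) :
  wlift E P (\prod_(i <- r | Q i) F i) = \prod_(i <- r | Q i) wlift E P (F i).
Proof. by elim/big_rec2: _ => [|i x y _ <-]; rewrite ?wlift1 ?wliftM. Qed.

Lemma wliftX n (u : W) : wlift E P (u ^+ n) = wlift E P u ^+ n.
Proof. by elim: n => [|n IHn]; rewrite ?expr0 ?wlift1// !exprS wliftM// IHn. Qed.

Lemma wlift_comp v : wlift E P (wlift E' P' v) =
  wlift (fun i => wlift E P (E' i)) (fun i => wlift E P (P' i)) v.
Proof.
rewrite {2}/wlift wlift_sum; apply: eq_bigr => A _.
rewrite wliftM// /eprod wlift_prod; congr (_ * _).
rewrite /mpoly.mmap wlift_sum; apply: eq_bigr => m _.
rewrite wliftM// wlift_C /mpoly.mmap1 wlift_prod; congr (_ * _).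
by apply: eq_bigr => i _; rewrite wliftX.
Qed.

Lemma wlift_id v : wlift (@wgen1 R p q) (@wgen2 R p q) v = v.
Proof.
rewrite /wlift [RHS]wb_sum; apply: eq_bigr => A _.
rewrite eprod_wgen1; suff -> s : mpoly.mmap (@wC R p q) (@wgen2 R p q) s = wb set0 s.
  by rewrite wb0M mulr1.
rewrite [RHS](congr1 (wb set0) (mpoly.mpolyE s)) raddf_sum; apply: eq_bigr => m _ /=.
rewrite wCE -mpoly.mul_mpolyC -wb0M; congr (_ * _).
rewrite mpoly.mpolyXE_id /mpoly.mmap1.
elim/big_rec2: _ => [//|i x y _ ->]; rewrite -wb0M; congr (_ * _).
elim: (m i) => [//|n IHn]; by rewrite !exprS -wb0M IHn wgen2E.
Qed.

End LiftComp.

(** * Completing a right-invertible matrix to an invertible one *)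

Section MatrixExtension.
Context {F : fieldType}.

(** A right inverse forces rank [n], so $A=C\,(1\;0)\,E$ with [C] and [E] invertible. The missing
    rows are taken from the last $m-n$ rows of [E]; the first [n] rows of [K] vanish, so those of
    the sum are the rows of [A]. *)
Lemma right_inverse_extension n m (A : 'M[F]_(n, m)) (B : 'M[F]_(m, n)) :
  A *m B = 1%:M -> exists2 K : 'M[F]_m, (forall i j : 'I_m, (i < n)%N -> K i j = 0)
    & (pid_mx n : 'M_(m, n)) *m A + K \in unitmx.
Proof.
move=> AB; have nm : (n <= m)%N := mulmx1_min AB.
have rA : \rank A = n.
  apply/eqP; rewrite eqn_leq rank_leq_row -{1}(mxrank1 F n) -AB.
  exact: mxrankM_maxl.
pose C := col_ebase A; pose E := row_ebase A.
have uC : C \in unitmx by exact: col_ebase_unit.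
have uE : E \in unitmx by exact: row_ebase_unit.
have AE : A = C *m pid_mx n *m E by rewrite -{1}(mulmx_ebase A) rA.
exists (copid_mx n *m E) => [i j ilt|].
  rewrite mulmxBl mul1mx !mxE (bigD1 i)//= big1 ?addr0 => [|k ki]; last first.
    by rewrite mxE [_ == _]eq_sym -[_ == _]/(k == i) (negbTE ki) mul0r.
  by rewrite mxE eqxx ilt mul1r subrr.
rewrite AE !mulmxA -mulmxDl unitmx_mul uE andbT.
pose P : 'M[F]_(m, n) := pid_mx n; pose Q : 'M[F]_(n, m) := pid_mx n.
pose D : 'M[F]_m := copid_mx n.
have QP : Q *m P = 1%:M by rewrite /Q /P pid_mx_id// pid_mx_1.
have QD : Q *m D = 0 by exact: mul_pid_mx_copid.
have DP : D *m P = 0 by exact: mul_copid_mx_pid.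
have PQ : P *m Q + D = 1%:M by rewrite /P /Q /D /copid_mx pid_mx_id// addrC subrK.
rewrite -/P -/Q -/D.
(* In block form the matrix is diagonal with blocks [C] and 1, so its inverse has blocks $C^{-1}$
   and 1. *)
suff /mulmx1_unit[] : (P *m C *m Q + D) *m (P *m invmx C *m Q + D) = 1%:M by [].
have XY : (P *m C *m Q) *m (P *m invmx C *m Q) = P *m Q.
  by rewrite !mulmxA -[P *m C *m Q *m P]mulmxA QP mulmx1 -[P *m C *m _]mulmxA mulmxV// mulmx1.
have XD : P *m C *m Q *m D = 0 by rewrite -mulmxA QD mulmx0.
have DY : D *m (P *m invmx C *m Q) = 0 by rewrite !mulmxA DP !mul0mx.
have DD : D *m D = D by exact: copid_mx_id.
clearbody D.
by rewrite mulmxDl !mulmxDr XY XD DY DD addr0 add0r.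
Qed.

End MatrixExtension.

(** * Coefficients, and the expansion of elements of degree at most 2 *)

Section Coefficients.
Context {R : realType} {p q : nat}.
Local Notation W := (walg R p q).
Implicit Types (A B : {set 'I_p}) (u v w : W).

Definition wcf A m v : R := mpoly.mcoeff m (v A).

Lemma wcf_is_additive A m : zmod_morphism (wcf A m).
Proof. by move=> u v; rewrite /wcf !ffunE raddfB. Qed.
HB.instance Definition _ A m := GRing.isZmodMorphism.Build W R (wcf A m) (wcf_is_additive A m).

Lemma wcfP u v : (forall A m, wcf A m u = wcf A m v) -> u = v.
Proof. by move=> uv; apply/ffunP => A; apply/mpoly.mpolyP => m; exact: uv. Qed.

Lemma wcfC a u A m : wcf A m (wC a * u) = a * wcf A m u.
Proof. exact: wcoefC. Qed.

Lemma wcf_wb A m B s : wcf A m (wb B s) = if A == B then mpoly.mcoeff m s else 0.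
Proof. by rewrite /wcf ffunE; case: eqP => _ //; rewrite mpoly.mcoeff0. Qed.

Lemma wcf_gen1 A m mu : wcf A m (wgen1 mu) = ((A == [set mu]) && (m == mpoly.mnm0))%:R.
Proof. by rewrite wgen1E wcf_wb; case: eqP => _ //; rewrite mpoly.mcoeff1. Qed.

Lemma wcf_gen2 A m i : wcf A m (wgen2 i) = ((A == set0) && (m == mpoly.mnm1 i))%:R.
Proof. by rewrite wgen2E wcf_wb; case: eqP => _ //; rewrite mpoly.mcoeffX eq_sym. Qed.

(** The constant term, which for a trivialized section turns out to be the value of its degree-zero
    part. *)
Definition wbody v : R := wcf set0 mpoly.mnm0 v.
Lemma wbody_is_additive : zmod_morphism wbody.
Proof. exact: wcf_is_additive. Qed.
HB.instance Definition _ := GRing.isZmodMorphism.Build W R wbody wbody_is_additive.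

Lemma mcoeff0M (s t : mpoly.mpoly q R) : mpoly.mcoeff mpoly.mnm0 (s * t) =
  mpoly.mcoeff mpoly.mnm0 s * mpoly.mcoeff mpoly.mnm0 t.
Proof. by have [+ _] := mpoly.mcoeff0_is_multiplicative q R; apply. Qed.

Lemma wmul_set0 u v : (u * v) set0 = u set0 * v set0.
Proof.
rewrite [LHS]ffunE (big_pred1 set0) => [|B]; last by rewrite subset0.
by rewrite setD0 inversions0l mul1r.
Qed.

Lemma wmul_set1 u v mu : (u * v) [set mu] = u set0 * v [set mu] + u [set mu] * v set0.
Proof.
rewrite [LHS]ffunE (bigD1 set0) ?sub0set//= (big_pred1 [set mu]); last first.
  move=> B /=; rewrite subset1 andb_orl andbN orbF; case: eqP => //= ->.
  by rewrite -card_gt0 cards1.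
by rewrite setD0 setDv inversions0l inversions0r !mul1r.
Qed.

(** The coefficient of a generator is a derivation over [wbody]: it is the value at a point of
    $\partial/\partial e^\mu$, and this rule is what makes it a tangent vector. *)
Lemma wcf_set1M u v mu : wcf [set mu] mpoly.mnm0 (u * v) =
  wcf [set mu] mpoly.mnm0 u * wbody v + wbody u * wcf [set mu] mpoly.mnm0 v.
Proof. by rewrite /wbody /wcf wmul_set1 raddfD /= !mcoeff0M addrC. Qed.

Lemma wcf_mnm1M u v i : wcf set0 (mpoly.mnm1 i) (u * v) =
  wcf set0 (mpoly.mnm1 i) u * wbody v + wbody u * wcf set0 (mpoly.mnm1 i) v.
Proof.
(* The coefficient of $p^i$ is the constant term of the derivative with respect to $p^i$, so the
   Leibniz rule for polynomials applies. *)
have dE (s : mpoly.mpoly q R) : mpoly.mcoeff (mpoly.mnm1 i) s =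
    mpoly.mcoeff mpoly.mnm0 (mpoly.mderiv i s).
  by rewrite mpoly.mcoeff_deriv mpoly.add0m mpoly.mnm0E.
by rewrite /wbody /wcf wmul_set0 !dE mpoly.mderivM raddfD /= !mcoeff0M.
Qed.

Lemma whomogeneous_wcf k v A m : whomogeneous k v ->
  (#|A| + (mpoly.mdeg m).*2)%N <> k -> wcf A m v = 0.
Proof. by move=> vk Ak; apply/eqP/negPn/negP => /vk. Qed.

Lemma wbody_homogeneous k v : whomogeneous k v -> k <> 0%N -> wbody v = 0.
Proof.
by move=> vk k0; apply: (whomogeneous_wcf vk); rewrite cards0 mpoly.mdeg0 => /esym.
Qed.

Lemma whomogeneous_wb A : whomogeneous #|A| (wb A 1 : W).
Proof.
move=> B m; rewrite -[mpoly.mcoeff _ _]/(wcf B m _) wcf_wb.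
case: (B =P A) => [->|]; last by rewrite eqxx.
rewrite mpoly.mcoeff1; have [->|] := eqVneq m mpoly.mnm0; last by rewrite eqxx.
by rewrite mpoly.mdeg0 addn0.
Qed.

Lemma whomogeneousCM k a v : whomogeneous k v -> whomogeneous k (wC a * v).
Proof. by move=> vk; rewrite -[k]add0n; apply: whomogeneousM vk; exact: whomogeneous_C. Qed.

Lemma homogeneous_ext k u v : whomogeneous k u -> whomogeneous k v ->
  (forall A m, (#|A| + (mpoly.mdeg m).*2)%N = k -> wcf A m u = wcf A m v) -> u = v.
Proof.
move=> uk vk uv; apply: wcfP => A m.
have [/uv //|/eqP H] := eqVneq (#|A| + (mpoly.mdeg m).*2)%N k.
by rewrite !(whomogeneous_wcf _ H).
Qed.

Lemma wdecomp0 v : whomogeneous 0 v -> v = wC (wbody v).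
Proof.
move=> v0; apply: (homogeneous_ext v0); first exact: whomogeneous_C.
move=> A m /eqP.
rewrite addn_eq0 double_eq0 cards_eq0 mpoly.mdeg_eq0 => /andP[/eqP -> /eqP ->].
by rewrite wCE wcf_wb eqxx mpoly.mcoeffC eqxx mulr1.
Qed.

Lemma wdecomp1 v : whomogeneous 1 v ->
  v = \sum_mu wC (wcf [set mu] mpoly.mnm0 v) * wgen1 mu.
Proof.
move=> v1; apply: (homogeneous_ext v1).
  by apply: whomogeneous_sum => mu _; apply: whomogeneousCM; exact: whomogeneous_wgen1.
move=> A m H; have m0 : m = mpoly.mnm0.
  apply/eqP; rewrite -mpoly.mdeg_eq0; move: H; case: (mpoly.mdeg m) => //= k.
  by rewrite doubleS !addnS.
have /eqP/cards1P[mu ->] : #|A| = 1%N by move: H; rewrite m0 mpoly.mdeg0 addn0.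
rewrite m0 raddf_sum (bigD1 mu)//= big1 ?addr0.
  by rewrite wcfC wcf_gen1 !eqxx mulr1.
move=> nu /negbTE numu; rewrite wcfC wcf_gen1 (_ : [set mu] == [set nu] = false) ?mulr0//.
by apply/eqP => /set1_inj e; rewrite e eqxx in numu.
Qed.

Lemma wdecomp2 v : whomogeneous 2 v ->
  v = \sum_i wC (wcf set0 (mpoly.mnm1 i) v) * wgen2 i +
      \sum_(A : {set 'I_p} | #|A| == 2) wC (wcf A mpoly.mnm0 v) * wb A 1.
Proof.
move=> v2; apply: (homogeneous_ext v2).
  apply: whomogeneousD.
    by apply: whomogeneous_sum => i _; apply: whomogeneousCM; exact: whomogeneous_wgen2.
  apply: whomogeneous_sum => A /eqP A2; apply: whomogeneousCM.
  by have := @whomogeneous_wb A; rewrite A2.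
move=> A m H; rewrite raddfD !raddf_sum /=.
case dm: (mpoly.mdeg m) H => [|[|k]] H; last by move: H; rewrite !doubleS !addnS.
- have /eqP m0 : m == mpoly.mnm0 by rewrite -mpoly.mdeg_eq0 dm.
  rewrite addn0 in H; rewrite big1 ?add0r => [|i _]; last first.
    rewrite wcfC wcf_gen2 m0; case: eqP => [A0|_]; last by rewrite mulr0.
    by rewrite A0 cards0 in H.
  rewrite (bigD1 A) ?H//= big1 ?addr0 => [|B /andP[_ /negbTE BA]].
    by rewrite wcfC wcf_wb eqxx m0 mpoly.mcoeff1 eqxx mulr1.
  by rewrite wcfC wcf_wb eq_sym BA mulr0.
- have /eqP A0 : A == set0 by rewrite -cards_eq0; apply/eqP; move: H; lia.
  have /existsP[i /eqP mi] : [exists i, m == mpoly.mnm1 i] by rewrite -mpoly.mdeg_eq1 dm.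
  rewrite [X in _ + X]big1 ?addr0 => [|B /eqP B2]; last first.
    rewrite wcfC wcf_wb A0 eq_sym -cards_eq0 B2 mulr0//.
  rewrite (bigD1 i)//= big1 ?addr0 => [|j /negbTE ji].
    by rewrite wcfC wcf_gen2 A0 mi !eqxx mulr1.
  by rewrite wcfC wcf_gen2 mi mpoly.eq_mnm1 [i == j]eq_sym ji andbF mulr0.
Qed.

End Coefficients.

(** * Triangular changes of the odd and even generators *)

Section CoordinateChange.
Context {R : realType} {p q : nat}.
Local Notation W := (walg R p q).
Variables (A : 'M[R]_p) (B : 'M[R]_q) (N : 'I_q -> {set 'I_p} -> R).
Hypotheses (uA : A \in unitmx) (uB : B \in unitmx).

Definition free2 (c : {set 'I_p} -> R) : W :=
  \sum_(S : {set 'I_p} | #|S| == 2) wC (c S) * wb S 1.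

Lemma whomogeneous_free2 c : whomogeneous 2 (free2 c).
Proof.
apply: whomogeneous_sum => S /eqP S2; apply: whomogeneousCM.
by have := @whomogeneous_wb R p q S; rewrite S2.
Qed.

Lemma wlift_free2 E P c : (forall i, whomogeneous 1 (E i)) ->
  (forall i, whomogeneous 2 (P i)) ->
  wlift E P (free2 c) = \sum_(S : {set 'I_p} | #|S| == 2) wC (c S) * eprod E S.
Proof.
move=> E1 P2; rewrite /free2 wlift_sum; apply: eq_bigr => S _.
rewrite wliftM// wlift_C wlift_wb -mpoly.mpolyC1 mpoly.mmapC /= rmorph1.
by rewrite mul1r.
Qed.

(** The change $e'=Ae$, $p'=Bp+N(e)$ at a single point, with [free2] supplying the quadratic term
    $N(e)$. *)
Definition newE mu : W := \sum_l wC (A mu l) * wgen1 l.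
Definition newP i : W := \sum_j wC (B i j) * wgen2 j + free2 (N i).
Definition oldE mu : W := \sum_l wC (invmx A mu l) * wgen1 l.
(** Solves $p'=Bp+N(e)$ for $p$: the quadratic term is moved to the other side after its odd
    generators have been expressed as $e=A^{-1}e'$. *)
Definition oldP i : W :=
  \sum_j wC (invmx B i j) * (wgen2 j - wlift oldE (@wgen2 R p q) (free2 (N j))).

Lemma whomogeneous_newE mu : whomogeneous 1 (newE mu).
Proof. by apply: whomogeneous_sum => l _; apply: whomogeneousCM; exact: whomogeneous_wgen1. Qed.
Lemma whomogeneous_oldE mu : whomogeneous 1 (oldE mu).
Proof. by apply: whomogeneous_sum => l _; apply: whomogeneousCM; exact: whomogeneous_wgen1. Qed.
Lemma whomogeneous_newP i : whomogeneous 2 (newP i).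
Proof.
apply: whomogeneousD; last exact: whomogeneous_free2.
by apply: whomogeneous_sum => l _; apply: whomogeneousCM; exact: whomogeneous_wgen2.
Qed.
Lemma whomogeneous_oldP i : whomogeneous 2 (oldP i).
Proof.
apply: whomogeneous_sum => l _; apply: whomogeneousCM.
apply: whomogeneousD; first exact: whomogeneous_wgen2.
apply: whomogeneousN; apply: wlift_homogeneous; last exact: whomogeneous_free2.
- exact: whomogeneous_oldE.
- exact: whomogeneous_wgen2.
Qed.

Lemma mx_sum_inv n (C D : 'M[R]_n) (g : 'I_n -> W) i : C *m D = 1%:M ->
  \sum_j wC (C i j) * (\sum_k wC (D j k) * g k) = g i.
Proof.
move=> CD; transitivity (\sum_k wC ((C *m D) i k) * g k).
  under eq_bigr do rewrite mulr_sumr.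
  rewrite exchange_big; apply: eq_bigr => k _; rewrite mxE raddf_sum mulr_suml.
  by apply: eq_bigr => j _; rewrite mulrA -rmorphM.
rewrite CD (bigD1 i)//= mxE eqxx mul1r big1 ?addr0// => k ki.
by rewrite mxE eq_sym (negbTE ki) raddf0 mul0r.
Qed.

Let E1 := whomogeneous_oldE.
Let P1 := whomogeneous_oldP.
Let E1' := whomogeneous_newE.
Let P1' := whomogeneous_newP.

Lemma old_newE mu : wlift oldE oldP (newE mu) = wgen1 mu.
Proof.
rewrite /newE wlift_sum -[RHS](mx_sum_inv (@wgen1 R p q) mu (mulmxV uA)).
apply: eq_bigr => l _; rewrite wliftM; [|exact: E1|exact: P1].
by rewrite wlift_C wlift_wgen1.
Qed.

Lemma new_oldE mu : wlift newE newP (oldE mu) = wgen1 mu.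
Proof.
rewrite /oldE wlift_sum -[RHS](mx_sum_inv (@wgen1 R p q) mu (mulVmx uA)).
apply: eq_bigr => l _; rewrite wliftM; [|exact: E1'|exact: P1'].
by rewrite wlift_C wlift_wgen1.
Qed.

Let g2 := @whomogeneous_wgen2 R p q.

Lemma old_newP i : wlift oldE oldP (newP i) = wgen2 i.
Proof.
rewrite /newP wliftD wlift_sum.
have -> : \sum_j wlift oldE oldP (wC (B i j) * wgen2 j) =
    \sum_j wC (B i j) * oldP j.
  apply: eq_bigr => j _; rewrite wliftM; [|exact: E1|exact: P1].
  by rewrite wlift_C wlift_wgen2.
by rewrite (mx_sum_inv _ _ (mulmxV uB)) !wlift_free2 ?subrK.
Qed.

Lemma new_oldP i : wlift newE newP (oldP i) = wgen2 i.
Proof.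
rewrite /oldP wlift_sum -[RHS](mx_sum_inv (@wgen2 R p q) i (mulVmx uB)).
apply: eq_bigr => j _; rewrite wliftM; [|exact: E1'|exact: P1'].
rewrite wlift_C wliftD wliftN wlift_wgen2; congr (_ * _).
rewrite wlift_comp; [|exact: E1'|exact: P1'].
have -> : (fun mu => wlift newE newP (oldE mu)) = @wgen1 R p q.
  by apply: boolp.funext => mu; exact: new_oldE.
rewrite (wlift_free2 (P := fun i => wlift newE newP (wgen2 i))); last first.
- by move=> k; apply: wlift_homogeneous; [exact: E1'|exact: P1'|exact: g2].
- exact: whomogeneous_wgen1.
rewrite /newP [X in _ - X](_ : _ = free2 (N j)) ?addrK//.
by apply: eq_bigr => S _; rewrite eprod_wgen1.
Qed.

(** The composite of two substitutions is again a substitution, and this one fixes all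
    generators. *)
Lemma old_newK v : wlift oldE oldP (wlift newE newP v) = v.
Proof.
rewrite wlift_comp; [|exact: E1|exact: P1].
have -> : (fun i => wlift oldE oldP (newE i)) = @wgen1 R p q.
  by apply: boolp.funext => i; exact: old_newE.
have -> : (fun i => wlift oldE oldP (newP i)) = @wgen2 R p q.
  by apply: boolp.funext => i; exact: old_newP.
exact: wlift_id.
Qed.

Lemma new_oldK v : wlift newE newP (wlift oldE oldP v) = v.
Proof.
rewrite wlift_comp; [|exact: E1'|exact: P1'].
have -> : (fun i => wlift newE newP (oldE i)) = @wgen1 R p q.
  by apply: boolp.funext => i; exact: new_oldE.
have -> : (fun i => wlift newE newP (oldP i)) = @wgen2 R p q.
  by apply: boolp.funext => i; exact: new_oldP.
exact: wlift_id.
Qed.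

End CoordinateChange.

From mathcomp Require Import interval_inference all_classical all_reals topology.
From mathcomp Require Import normedtype derive realfun sequences measure.
From mathcomp Require Import lebesgue_measure lebesgue_integral ftc.

Import numFieldNormedType.Exports.

Local Open Scope classical_set_scope.
Local Open Scope ring_scope.

(** * Calculus on R^m *)

Section CkBasics.
Context {R : realType} {m : nat}.
Implicit Types (A B : set 'rV[R]_m) (f g : 'rV[R]_m -> R).

Local Notation ei i := (delta_mx (0 : 'I_1) i : 'rV[R]_m).

Lemma Ck_continuous k A f x : Ck k A f -> A x -> {for x, continuous f}.
Proof. by case: k => [|k] [+ _]; apply. Qed.

Lemma Ck_derivable k A f i x : Ck k.+1 A f -> A x -> derivable f x (ei i).
Proof. by move=> [_ /(_ i) [+ _]]; apply. Qed.

Lemma Ck_derive k A f i : Ck k.+1 A f -> Ck k A ('D_(ei i) f).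
Proof. by move=> [_ /(_ i) [_]]. Qed.

Lemma Ck_leS k A f : Ck k.+1 A f -> Ck k A f.
Proof.
elim: k f => [|k IHk] f [cf df]; first by split.
by split => // i; have [dfi Dfi] := df i; split => //; exact: IHk.
Qed.

(** Each clause of [Ck] is a condition at single points on functions defined on all of $\mathbb
    R^m$, so the set can be cut down to points. Together with [Ck_ext] this makes smoothness a local
    property. *)
Lemma Ck_pointwise k A f : (forall x, A x -> Ck k [set x] f) -> Ck k A f.
Proof.
elim: k f => [|k IHk] f fA; first by split => // x /fA [+ _]; apply.
split=> [x /fA [+ _]|i]; first exact.
split=> [x /fA [_ /(_ i) [+ _]]|]; first exact.
by apply: IHk => x /fA; exact: Ck_derive.
Qed.

Lemma Ck_sub k A B f : B `<=` A -> Ck k A f -> Ck k B f.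
Proof.
move=> BA; elim: k f => [|k IHk] f [cf df]; first by split => // x /BA /cf.
split => [x /BA /cf //|i]; have [dfi Dfi] := df i.
by split; [move=> x /BA; exact: dfi|exact: IHk].
Qed.

Lemma open_near A x : open A -> A x -> \forall y \near x, A y.
Proof. by move=> oA Ax; exact: open_nbhs_nbhs. Qed.

Lemma near_eq_continuous f g x : (\forall y \near x, f y = g y) ->
  {for x, continuous f} -> {for x, continuous g}.
Proof.
move=> fg cf; have fgx : f x = g x := nbhs_singleton fg.
suff : g @ x --> g x by [].
by rewrite -fgx; exact: (cvg_trans (near_eq_cvg fg) cf).
Qed.

(** Derivatives at a point of [A] depend only on nearby values, and these are taken in [A] because
    [A] is open. *)
Lemma Ck_ext k A f g : open A -> {in A, f =1 g} -> Ck k A f -> Ck k A g.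
Proof.
move=> oA; elim: k f g => [|k IHk] f g fg [cf df].
  split => // x Ax; apply: near_eq_continuous (cf _ Ax).
  by near=> y; apply: fg; rewrite inE; near: y; exact: open_near.
have fgx x : A x -> \forall y \near x, f y = g y.
  by move=> Ax; near=> y; apply: fg; rewrite inE; near: y; exact: open_near.
split=> [x Ax|i]; first by apply: near_eq_continuous (fgx x Ax) (cf _ Ax).
have [dfi Dfi] := df i; split=> [x Ax|].
  by apply: (near_eq_derivable (fgx x Ax)); exact: dfi.
apply: IHk Dfi => x; rewrite inE => Ax.
by apply: near_eq_derive; exact: fgx.
Unshelve. all: by end_near. Qed.

Lemma Cinf_sub A B f : B `<=` A -> Cinf A f -> Cinf B f.
Proof. by move=> BA fA k; exact: Ck_sub (fA k). Qed.

Lemma Cinf_local A f : (forall x, A x -> exists B, [/\ open B, B x &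
  exists2 g, Cinf B g & {in B, f =1 g}]) -> Cinf A f.
Proof.
move=> H k; apply: Ck_pointwise => x /H [B [oB Bx [g gB fg]]].
have : Ck k B f by apply: (Ck_ext oB _ (gB k)) => y /fg ->.
by apply: Ck_sub => y ->.
Qed.

Lemma Ck_cst k A a : Ck k A (fun=> a).
Proof.
elim: k a => [|k IHk] a; first by split => // x _; exact: cst_continuous.
split=> [x _|i]; first exact: cst_continuous.
split => [x _|]; first exact: derivable_cst.
have -> : 'D_(ei i) (fun=> a : R) = (fun=> 0) by apply/funext => x; exact: derive_cst.
exact: IHk.
Qed.

Lemma Ck_add k A f g : open A -> Ck k A f -> Ck k A g ->
  Ck k A (fun x => f x + g x).
Proof.
move=> oA; elim: k f g => [|k IHk] f g fA gA.
  split => // x Ax; apply: continuousD.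
    exact: Ck_continuous fA Ax.
  exact: Ck_continuous gA Ax.
split=> [x Ax|i].
  apply: continuousD.
    exact: Ck_continuous fA Ax.
  exact: Ck_continuous gA Ax.
split=> [x Ax|].
  apply: derivableD.
    exact: Ck_derivable fA Ax.
  exact: Ck_derivable gA Ax.
apply: (@Ck_ext _ _ (fun x => 'D_(ei i) f x + 'D_(ei i) g x)) => //.
  move=> x; rewrite inE => Ax.
  rewrite -deriveD//.
    exact: Ck_derivable fA Ax.
  exact: Ck_derivable gA Ax.
by apply: IHk; exact: Ck_derive.
Qed.

Lemma Ck_mul k A f g : open A -> Ck k A f -> Ck k A g ->
  Ck k A (fun x => f x * g x).
Proof.
move=> oA; elim: k f g => [|k IHk] f g fA gA.
  split => // x Ax; apply: continuousM.
    exact: Ck_continuous fA Ax.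
  exact: Ck_continuous gA Ax.
split=> [x Ax|i].
  apply: continuousM.
    exact: Ck_continuous fA Ax.
  exact: Ck_continuous gA Ax.
split=> [x Ax|].
  apply: derivableM.
    exact: Ck_derivable fA Ax.
  exact: Ck_derivable gA Ax.
apply: (@Ck_ext _ _ (fun x => f x * 'D_(ei i) g x + g x * 'D_(ei i) f x)) => //.
  move=> x; rewrite inE => Ax.
  rewrite deriveM//.
    exact: Ck_derivable fA Ax.
  exact: Ck_derivable gA Ax.
apply: Ck_add => //; apply: IHk; by [exact: Ck_leS|exact: Ck_derive].
Qed.

Lemma Ck_sum k A (I : Type) (r : seq I) (P : pred I) (F : I -> 'rV[R]_m -> R) :
  open A -> (forall i, P i -> Ck k A (F i)) ->
  Ck k A (fun x => \sum_(i <- r | P i) F i x).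
Proof.
move=> oA FA; elim: r => [|i r IHr].
  apply: Ck_ext (Ck_cst k A 0) => // x _; by rewrite big_nil.
case Pi: (P i); last by apply: Ck_ext IHr => // x _; rewrite big_cons Pi.
apply: (@Ck_ext _ _ (fun x => F i x + \sum_(j <- r | P j) F j x)) => //.
  by move=> x _; rewrite big_cons Pi.
by apply: Ck_add => //; exact: FA.
Qed.

Lemma Ck_prod k A (I : Type) (r : seq I) (P : pred I) (F : I -> 'rV[R]_m -> R) :
  open A -> (forall i, P i -> Ck k A (F i)) ->
  Ck k A (fun x => \prod_(i <- r | P i) F i x).
Proof.
move=> oA FA; elim: r => [|i r IHr].
  apply: Ck_ext (Ck_cst k A 1) => // x _; by rewrite big_nil.
case Pi: (P i); last by apply: Ck_ext IHr => // x _; rewrite big_cons Pi.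
apply: (@Ck_ext _ _ (fun x => F i x * \prod_(j <- r | P j) F j x)) => //.
  by move=> x _; rewrite big_cons Pi.
by apply: Ck_mul => //; exact: FA.
Qed.

Lemma is_derive_coord (x v : 'rV[R]_m) j :
  is_derive x v (fun u : 'rV[R]_m => u 0 j) (v 0 j).
Proof.
pose c := (fun h : R => h^-1 *: (((fun u : 'rV[R]_m => u 0 j) \o shift x)
  (h *: v) - x 0 j)).
have cv : c @ 0^' --> v 0 j.
  suff e : {near 0^', (fun=> v 0 j) =1 c}.
    exact: (cvg_trans (near_eq_cvg e) (cvg_cst _)).
  near=> h; rewrite /c /= !mxE addrK /GRing.scale /= mulrA mulVf ?mul1r//.
  by near: h; exact: nbhs_dnbhs_neq.
split; last exact: cvg_lim cv.
by apply/cvg_ex; exists (v 0 j).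
Unshelve. all: by end_near. Qed.

Lemma Ck_coord k A j : Ck k A (fun u => u 0 j).
Proof.
case: k => [|k]; first by split => // x _; exact: coord_continuous.
split=> [x _|i]; first exact: coord_continuous.
split=> [x _|].
  by have [] := is_derive_coord x (ei i) j.
have -> : 'D_(ei i) (fun u : 'rV[R]_m => u 0 j) = (fun=> (ei i) 0 j).
  by apply/funext => x; have [_ ->] := is_derive_coord x (ei i) j.
exact: Ck_cst.
Qed.

Lemma Ck_inv k A f : open A -> (forall x, A x -> f x != 0) -> Ck k A f ->
  Ck k A (fun x => (f x)^-1).
Proof.
move=> oA; elim: k f => [|k IHk] f f0 fA.
  by split => // x Ax; apply: continuousV; [exact: f0|exact: Ck_continuous fA Ax].
split=> [x Ax|i].
  by apply: continuousV; [exact: f0|exact: Ck_continuous fA Ax].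
split=> [x Ax|].
  by apply: derivableV; [exact: f0|exact: Ck_derivable fA Ax].
apply: (@Ck_ext _ _ (fun x => - 1 * ((f x)^-1 * (f x)^-1) * 'D_(ei i) f x)) => //.
  move=> x; rewrite inE => Ax.
  rewrite deriveV//; last exact: Ck_derivable fA Ax.
    by rewrite /GRing.scale /= expr2 invfM mulN1r.
  exact: f0.
apply: Ck_mul => //; last exact: Ck_derive.
apply: Ck_mul => //; first exact: Ck_cst.
by apply: Ck_mul => //; apply: IHk => //; exact: Ck_leS.
Qed.

End CkBasics.

Section RowVectors.
Context {R : realType} {m : nat}.
Implicit Types (a u v w : 'rV[R]_m) (r : R).

Lemma rV_norm_le u r : 0 <= r -> (forall j, `|u 0 j| <= r) -> `|u| <= r.
Proof.
move=> r0 ur; rewrite [leLHS]mx_normrE.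
by apply/bigmax_leP; split => // -[i j] _ /=; rewrite ord1.
Qed.

Lemma rV_coord_le u j : `|u 0 j| <= `|u|.
Proof.
rewrite [leRHS]mx_normrE.
exact: (le_bigmax _ (fun ij : 'I_1 * 'I_m => `|u ij.1 ij.2|) (0, j)).
Qed.

Lemma rV_ballP a r u : 0 < r ->
  ball a r u <-> forall j, `|a 0 j - u 0 j| < r.
Proof.
move=> r0; split=> [[_ au] j|au]; first exact: au.
by split => // i j; rewrite ord1; exact: au.
Qed.

Lemma rV_ball_gt0 a r u : ball a r u -> 0 < r.
Proof. by case. Qed.

End RowVectors.

(** * Mean value formula with partial derivatives *)

Section MeanValue.
Context {R : realType}.

Lemma is_derive_line (V : normedModType R) (f : V -> R) (w v : V) (t : R) :
  derivable f (w + t *: v) v ->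
  is_derive t 1 (fun s : R => f (w + s *: v)) ('D_v f (w + t *: v)).
Proof.
move=> df.
have e : (fun h : R => h^-1 *: (((fun s : R => f (w + s *: v)) \o shift t)
    (h *: 1) - f (w + t *: v))) =
  (fun h : R => h^-1 *: ((f \o shift (w + t *: v)) (h *: v) - f (w + t *: v))).
  apply/funext => h /=; congr (_ *: (f _ - _)).
  by rewrite [h%:A]mulr1 scalerDl addrCA addrA.
by split; rewrite /derivable /derive e.
Qed.

Lemma MVT_between (g : R -> R) (a b : R) :
  (forall t, a <= t <= b \/ b <= t <= a -> derivable g t 1) ->
  exists2 c, a <= c <= b \/ b <= c <= a & g b - g a = 'D_1 g c * (b - a).
Proof.
move=> dg; have [ab|/ltW ba] := leP a b.
  have [] := @MVT_segment _ g (fun x => 'D_1 g x) a b ab.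
  - move=> x; rewrite in_itv/= => /andP[/ltW ax /ltW xb].
    by apply: derivableP; apply: dg; left; rewrite ax.
  - apply: derivable_within_continuous => x; rewrite in_itv/= => xab.
    by apply: dg; left.
  - by move=> c; rewrite in_itv/= => cab ->; exists c => //; left.
have [] := @MVT_segment _ g (fun x => 'D_1 g x) b a ba.
- move=> x; rewrite in_itv/= => /andP[/ltW ax /ltW xb].
  by apply: derivableP; apply: dg; right; rewrite ax.
- apply: derivable_within_continuous => x; rewrite in_itv/= => xab.
  by apply: dg; right.
- move=> c; rewrite in_itv/= => cab e; exists c; first by right.
  by rewrite -[LHS]opprB e -mulrN opprB.
Qed.

Context {m : nat}.
Implicit Types (a u v w : 'rV[R]_m) (r : R) (f : 'rV[R]_m -> R).
Local Notation ei i := (delta_mx (0 : 'I_1) i : 'rV[R]_m).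

Lemma between_dist (a b c d r : R) : a <= c <= b \/ b <= c <= a ->
  `|d - a| < r -> `|d - b| < r -> `|d - c| < r.
Proof.
move=> H; rewrite !ltr_norml => /andP[a1 a2] /andP[b1 b2].
by apply/andP; case: H => /andP[h1 h2]; split; lra.
Qed.

(* Moving from [u] to [v] one coordinate at a time only uses partial
   derivatives, so no total differentiability is needed. *)
Lemma mean_value_partials a r f u v :
  (forall x i, ball a r x -> derivable f x (ei i)) ->
  ball a r u -> ball a r v ->
  exists2 xi : 'I_m -> 'rV[R]_m,
    (forall i, ball a r (xi i) /\ `|xi i - u| <= `|v - u|)
    & f v - f u = \sum_i 'D_(ei i) f (xi i) * (v 0 i - u 0 i).
Proof.
move=> df au av; have r0 := rV_ball_gt0 au.
pose w (k : nat) := \row_(j < m) (if (j < k)%N then v 0 j else u 0 j).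
have w0 : w 0%N = u by apply/rowP => j; rewrite mxE.
have wm : w m = v by apply/rowP => j; rewrite mxE ltn_ord.
have wS (i : 'I_m) t : w i + (t - u 0 i) *: ei i =
    \row_j (if j == i then t else w i 0 j).
  apply/rowP => j; rewrite !mxE eqxx /=; case: (eqVneq j i) => [->|ji].
    by rewrite ltnn mulr1 addrC subrK.
  by rewrite mulr0 addr0.
have wS1 (i : 'I_m) : w i.+1 = w i + (v 0 i - u 0 i) *: ei i.
  rewrite wS; apply/rowP => j; rewrite !mxE ltnS leq_eqVlt -val_eqE /=.
  by case: eqVneq => [/val_inj->|].
have step (i : 'I_m) : exists2 x, ball a r x /\ `|x - u| <= `|v - u| &
    f (w i.+1) - f (w i) = 'D_(ei i) f x * (v 0 i - u 0 i).
  have wt t : u 0 i <= t + u 0 i <= v 0 i \/ v 0 i <= t + u 0 i <= u 0 i ->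
      ball a r (w i + t *: ei i) /\ `|w i + t *: ei i - u| <= `|v - u|.
    move=> ut; rewrite -(addrK (u 0 i) t) wS; split.
      apply/rV_ballP => // j; rewrite !mxE.
      move/rV_ballP : au => /(_ r0) au; move/rV_ballP : av => /(_ r0) av.
      case: eqVneq => [->|_]; first exact: between_dist ut (au i) (av i).
      by case: ifP => _; [exact: av|exact: au].
    apply: rV_norm_le => // j; apply: (le_trans _ (rV_coord_le _ j)); rewrite !mxE.
    case: eqVneq => [->|_].
      by case: ut => /andP[h1 h2]; [rewrite !ger0_norm; lra|rewrite !ler0_norm; lra].
    by case: ifP => _ //; rewrite subrr normr0.
  have := @MVT_between (fun t => f (w i + t *: ei i)) 0 (v 0 i - u 0 i).
  case.
    move=> t tb; have [|bt _] := wt t.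
      by case: tb => /andP[h1 h2]; [left|right]; apply/andP; split; lra.
    by have [] := is_derive_line (df _ i bt).
  move=> t tb; rewrite scale0r addr0 subr0 wS1 => ->.
  have [|bt nt] := wt t.
    by case: tb => /andP[h1 h2]; [left|right]; apply/andP; split; lra.
  exists (w i + t *: ei i) => //.
  by have [_ ->] := is_derive_line (df _ i bt).
have [xi xiP] := choice (fun i => (let: ex_intro2 x p q := step i in
  ex_intro (fun x => (ball a r x /\ `|x - u| <= `|v - u|) /\
    f (w i.+1) - f (w i) = 'D_(ei i) f x * (v 0 i - u 0 i)) x (conj p q))).
exists xi => [i|]; first by have [] := xiP i.
rewrite -wm -w0 -(telescope_sumr (fun k => f (w k)) (leq0n m)) big_mkord.
by apply: eq_bigr => i _; have [_ ->] := xiP i; rewrite wm w0.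
Qed.

End MeanValue.

(** * Chain rule *)

Section ChainRule.
Context {R : realType}.

Lemma near_eq_cvg_to (T : Type) (U : topologicalType) (F : set_system T)
    (FF : Filter F) (f g : T -> U) (l : U) :
  {near F, f =1 g} -> f @ F --> l -> g @ F --> l.
Proof. by move=> fg fl; exact: (cvg_trans (near_eq_cvg fg) fl). Qed.

Lemma cvg_sumr (T I : Type) (F : set_system T) (FF : Filter F) (r : seq I)
    (f : I -> T -> R) (l : I -> R) :
  (forall i, f i @ F --> l i) ->
  (fun x => \sum_(i <- r) f i x) @ F --> \sum_(i <- r) l i.
Proof.
move=> fl; elim: r => [|i r IHr].
  under eq_fun do rewrite big_nil.
  by rewrite big_nil; exact: cvg_cst.
under eq_fun do rewrite big_cons.
by rewrite big_cons; apply: cvgD.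
Qed.

Lemma cvg_rV (T : Type) (F : set_system T) (FF : Filter F) n
    (f : T -> 'rV[R]_n) (l : 'rV[R]_n) :
  (forall j, (fun t => f t 0 j) @ F --> l 0 j) -> f @ F --> l.
Proof.
move=> fl; apply/cvgrPdist_le => e e0.
have : \forall t \near F, forall j, `|l 0 j - f t 0 j| <= e.
  apply: filter_forall => j.
  by have /cvgrPdist_le := fl j; apply.
apply: filterS => t H; apply: rV_norm_le (ltW e0) _ => j.
by rewrite !mxE.
Qed.

(** Convergence along the line only: the increment of each component is [h] times a convergent
    difference quotient. *)
Lemma derivable_cvg_line (V : normedModType R) n (F : V -> 'rV[R]_n) x v :
  (forall j, derivable (fun y => F y 0 j) x v) ->
  (fun h : R => F (h *: v + x)) @ 0^' --> F x.
Proof.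
move=> dF; apply: cvg_rV => j.
have := dF j; rewrite /derivable => /cvg_ex[/= l dl].
have h0 : (fun h : R => h) @ 0^' --> (0 : R) by apply: cvg_within_filter; exact: cvg_id.
have c0 : (fun h : R => h * (h^-1 *: (F (h *: v + x) 0 j - F x 0 j)) + F x 0 j)
    @ 0^' --> F x 0 j.
  rewrite -[X in _ --> X]add0r -[X in _ --> X + _](mul0r l).
  by apply: cvgD; [exact: cvgM|exact: cvg_cst].
apply: near_eq_cvg_to c0; near=> h => /=.
rewrite /GRing.scale /= mulrA mulfV ?mul1r ?subrK//.
by near: h; exact: nbhs_dnbhs_neq.
Unshelve. all: by end_near. Qed.

Context {n : nat}.
Local Notation ei j := (delta_mx (0 : 'I_1) j : 'rV[R]_n).

(** The mean value formula writes the increment of [f] between [F x] and [F (h *: v + x)] with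
    partial derivatives at intermediate points. These points tend to [F x] with [h], and the partial
    derivatives of [f] are continuous there. *)
Lemma is_derive_comp_partials (V : normedModType R) (B : set 'rV[R]_n)
    (f : 'rV[R]_n -> R) (F : V -> 'rV[R]_n) x v :
  open B -> B (F x) -> Ck 1 B f ->
  (forall j, derivable (fun y => F y 0 j) x v) ->
  is_derive x v (fun y => f (F y))
    (\sum_j 'D_(ei j) f (F x) * 'D_v (fun y => F y 0 j) x).
Proof.
move=> oB BFx fB dF; set b := F x.
have [r r0 rB] : exists2 r : R, 0 < r & ball b r `<=` B.
  by have := open_near oB BFx => /nbhs_ballP[r r0 rB]; exists r.
pose g (h : R) := F (h *: v + x).
have gx : g @ 0^' --> b := derivable_cvg_line dF.
have H h : exists xi : 'I_n -> 'rV[R]_n, (forall j, `|xi j - b| <= `|g h - b|) /\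
    (ball b r (g h) -> f (g h) - f b =
      \sum_j 'D_(ei j) f (xi j) * (g h 0 j - b 0 j)).
  have [bg|bg] := pselect (ball b r (g h)).
    have [|||xi xi1 xi2] := @mean_value_partials _ _ b r f b (g h).
    - by move=> y i /rB By; exact: Ck_derivable fB By.
    - exact: ballxx.
    - exact: bg.
    exists xi; split; last by [].
    by move=> j; have [] := xi1 j.
  by exists (fun=> b); split => // j; rewrite subrr normr0.
have [xi xiP] := choice H.
have xib j : (fun h => xi h j) @ 0^' --> b.
  apply/cvgrPdist_lt => e e0.
  have /cvgrPdist_lt/(_ e e0) := gx; apply: filterS => h.
  rewrite distrC => /(le_lt_trans _) gb; rewrite distrC; apply: gb.
  by have [+ _] := xiP h; apply.
have main : (fun h => \sum_j 'D_(ei j) f (xi h j) *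
      (h^-1 *: (F (h *: v + x) 0 j - F x 0 j))) @ 0^' -->
    \sum_j 'D_(ei j) f b * 'D_v (fun y => F y 0 j) x.
  apply: cvg_sumr => j; apply: cvgM; last exact: dF j.
  have cD : {for b, continuous ('D_(ei j) f)}.
    exact: Ck_continuous (Ck_derive j fB) BFx.
  exact: (cvg_comp _ _ (xib j) cD).
have gr : (fun h => h^-1 *: (((fun y => f (F y)) \o shift x) (h *: v) - f (F x)))
    @ 0^' --> \sum_j 'D_(ei j) f b * 'D_v (fun y => F y 0 j) x.
  apply: near_eq_cvg_to main; near=> h.
  have [_ /= ->] := xiP h; last first.
    near: h; have /cvgrPdist_lt/(_ r r0) := gx.
    by apply: filterS => h; rewrite -ball_normE.
  rewrite scaler_sumr; apply: eq_bigr => j _.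
  by rewrite -scalerAr.
split; last exact: cvg_lim gr.
by apply/cvg_ex; eexists; exact: gr.
Unshelve. all: by end_near. Qed.

End ChainRule.

Section CkComp.
Context {R : realType} {m n : nat}.
Local Notation ej j := (delta_mx (0 : 'I_1) j : 'rV[R]_n).
Local Notation ei i := (delta_mx (0 : 'I_1) i : 'rV[R]_m).

(** By the chain rule each partial derivative is a sum of products of $\partial_j f\circ F$, covered
    by the induction hypothesis, with partial derivatives of the components of [F]. *)
Lemma Ck_comp k (A : set 'rV[R]_m) (B : set 'rV[R]_n) (f : 'rV[R]_n -> R)
    (F : 'rV[R]_m -> 'rV[R]_n) :
  open A -> open B -> (forall x, A x -> B (F x)) ->
  (forall j, Ck k A (fun x => F x 0 j)) -> Ck k B f ->
  Ck k A (fun x => f (F x)).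
Proof.
move=> oA oB AB; have cF k' : (forall j, Ck k' A (fun x => F x 0 j)) ->
    forall x, A x -> {for x, continuous F}.
  move=> FA x Ax; suff : F @ nbhs x --> F x by [].
  apply: cvg_rV => j; exact: (Ck_continuous (FA j) Ax).
elim: k f => [|k IHk] f FA fB.
  split => // x Ax; apply: continuous_comp; first exact: cF Ax.
  exact: Ck_continuous fB (AB _ Ax).
have Ck1 k' C g : @Ck R n k'.+1 C g -> Ck 1 C g.
  by elim: k' => // k' IH /Ck_leS.
have dF x i : A x -> is_derive x (ei i) (fun y => f (F y))
    (\sum_j 'D_(ej j) f (F x) * 'D_(ei i) (fun y => F y 0 j) x).
  move=> Ax; apply: is_derive_comp_partials oB (AB _ Ax) (Ck1 _ _ _ fB) _ => j.
  exact: Ck_derivable (FA j) Ax.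
split=> [x Ax|i].
  apply: continuous_comp; first exact: cF FA _ Ax.
  exact: Ck_continuous fB (AB _ Ax).
split=> [x /(dF x i)[]//|].
apply: (@Ck_ext _ _ _ _ (fun x => \sum_j 'D_(ej j) f (F x) *
  'D_(ei i) (fun y => F y 0 j) x)) => //.
  by move=> x; rewrite inE => /(dF x i)[_ ->].
apply: Ck_sum => // j _; apply: Ck_mul => //; last exact: Ck_derive.
apply: (IHk ('D_(ej j) f)); last exact: Ck_derive.
by move=> j'; exact: Ck_leS.
Qed.

Lemma Cinf_comp (A : set 'rV[R]_m) (B : set 'rV[R]_n) (f : 'rV[R]_n -> R)
    (F : 'rV[R]_m -> 'rV[R]_n) :
  open A -> open B -> (forall x, A x -> B (F x)) ->
  (forall j, Cinf A (fun x => F x 0 j)) -> Cinf B f ->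
  Cinf A (fun x => f (F x)).
Proof. by move=> oA oB AB FA fB k; exact: (Ck_comp oA oB AB (fun j => FA j k) (fB k)). Qed.

End CkComp.

(** * Inverse function theorem *)

Section InverseFunction.
Context {R : realType} {m : nat}.
Implicit Types (A : set 'rV[R]_m) (F G : 'rV[R]_m -> 'rV[R]_m) (a u v : 'rV[R]_m).
Local Notation ei i := (delta_mx (0 : 'I_1) i : 'rV[R]_m).

(** The transposed Jacobian matrix: vectors are rows, so the linear part of [F] at [u] is
    multiplication by this matrix on the right. *)
Definition partial_mx F u : 'M[R]_m :=
  \matrix_(i, j) 'D_(ei i) (fun y => F y 0 j) u.

Lemma mulmx_bounded (L : 'M[R]_m) :
  exists2 C : R, 0 < C & forall v : 'rV[R]_m, `|v *m L| <= C * `|v|.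
Proof.
pose C := 1 + \sum_(k < m) \sum_(j < m) `|L k j|.
have S0 : 0 <= \sum_(k < m) \sum_(j < m) `|L k j|.
  by apply: sumr_ge0 => k _; apply: sumr_ge0 => j _.
have C0 : 0 < C by rewrite /C; lra.
exists C => // v; apply: rV_norm_le; first by rewrite mulr_ge0 // ltW.
move=> j; rewrite mxE; apply: (le_trans (ler_norm_sum _ _ _)).
apply: (@le_trans _ _ (\sum_(k < m) `|L k j| * `|v|)).
  apply: ler_sum => k _; rewrite normrM mulrC; apply: ler_wpM2l => //.
  exact: rV_coord_le.
rewrite -mulr_suml; apply: ler_wpM2r => //.
apply: (@le_trans _ _ (\sum_(k < m) \sum_(j < m) `|L k j|)); last by rewrite /C; lra.
apply: ler_sum => k _; rewrite (bigD1 j) //= lerDl.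
exact: sumr_ge0.
Qed.

Lemma Ck_det n k A (M : 'rV[R]_m -> 'M[R]_n) : open A ->
  (forall i j, Ck k A (fun u => M u i j)) -> Ck k A (fun u => \det (M u)).
Proof.
move=> oA MA; rewrite /determinant; apply: Ck_sum => // s _.
apply: Ck_mul => //; first exact: Ck_cst.
by apply: Ck_prod => // i _.
Qed.

(** Cramer's formula: the entries of the inverse are polynomials in the entries of [M], divided by
    the determinant. *)
Lemma Ck_invmx n k A (M : 'rV[R]_m -> 'M[R]_n) : open A ->
  (forall u, A u -> M u \in unitmx) ->
  (forall i j, Ck k A (fun u => M u i j)) ->
  forall i j, Ck k A (fun u => invmx (M u) i j).
Proof.
move=> oA uM MA i j.
apply: (@Ck_ext _ _ _ _ (fun u => (\det (M u))^-1 * \adj (M u) i j)) => //.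
  by move=> u; rewrite inE => /uM uMu; rewrite /invmx uMu [RHS]mxE.
apply: Ck_mul => //.
  apply: Ck_inv => //; last exact: Ck_det.
  by move=> u /uM; rewrite unitmxE unitfE.
apply: (@Ck_ext _ _ _ _ (fun u => cofactor (M u) j i)) => //.
  by move=> u _; rewrite mxE.
apply: Ck_mul => //; first exact: Ck_cst.
apply: Ck_det => // i' j'.
apply: (@Ck_ext _ _ _ _ (fun u => M u (lift j i') (lift i j'))) => //.
by move=> u _; rewrite /= !mxE.
Qed.

Lemma Ck_subtract k A (f g : 'rV[R]_m -> R) : open A -> Ck k A f -> Ck k A g ->
  Ck k A (fun x => f x - g x).
Proof.
move=> oA fA gA; apply: (@Ck_ext _ _ _ _ (fun x => f x + (- 1) * g x)) => //.
  by move=> x _; rewrite mulN1r.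
by apply: Ck_add => //; apply: Ck_mul => //; exact: Ck_cst.
Qed.

(** The map $H(u)=u-F(u)L$ has zero partial derivatives at [a], hence small ones on a ball, and by
    the mean value formula it contracts distances by $1/2$ there. *)
Lemma near_linear_estimate A F a (L : 'M[R]_m) : open A -> A a ->
  (forall j, Cinf A (fun u => F u 0 j)) -> partial_mx F a *m L = 1%:M ->
  exists2 r, 0 < r &
    [/\ ball a r `<=` A, forall u, ball a r u -> partial_mx F u \in unitmx
      & forall u v, ball a r u -> ball a r v ->
        `|(u - v) - (F u - F v) *m L| <= 2^-1 * `|u - v|].
Proof.
move=> oA Aa FA JL.
pose H u := u - F u *m L.
have HA j k : Ck k A (fun u => H u 0 j).
  apply: (@Ck_ext _ _ _ _ (fun u => u 0 j - \sum_k F u 0 k * L k j)) => //.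
    by move=> u _; rewrite /H !mxE.
  apply: Ck_subtract => //; first exact: Ck_coord.
  by apply: Ck_sum => // i _; apply: Ck_mul => //; [exact: FA|exact: Ck_cst].
have H0 i j : 'D_(ei i) (fun u => H u 0 j) a = 0.
  have -> : (fun u => H u 0 j) =
      (fun u => u 0 j - (\sum_k (fun u => F u 0 k * L k j)) u).
    by apply/funext => u; rewrite /H !mxE fct_sumE.
  have dF k : is_derive a (ei i) (fun u => F u 0 k * L k j)
      (partial_mx F a i k * L k j).
    have dk : derivable (fun u => F u 0 k) a (ei i).
      exact: Ck_derivable (FA k 1%N) Aa.
    have := is_deriveZ (L k j) (derivableP dk).
    rewrite (_ : L k j \*: _ = (fun u => F u 0 k * L k j)); last first.
      by apply/funext => u /=; rewrite mulrC.
    by rewrite /partial_mx mxE mulrC.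
  have dS := is_derive_sum dF.
  have dc := is_derive_coord a (ei i) j.
  have [_ ->] := is_deriveB dc dS.
  have := congr1 (fun M : 'M_m => M i j) JL; rewrite !mxE => ->.
  by rewrite eqxx /= eq_sym subrr.
(* The mean value formula has [m] terms, so $m\varepsilon\le 1/2$ is required; [m.+1] keeps the
   denominator nonzero when $m=0$. *)
pose eps : R := (2 * m.+1%:R)^-1.
have eps0 : 0 < eps by rewrite invr_gt0 mulr_gt0.
have nA : \forall u \near a, A u by exact: open_near.
have nH : \forall u \near a, forall ij : 'I_m * 'I_m,
    `|'D_(ei ij.1) (fun u => H u 0 ij.2) u| <= eps.
  have FF : Filter (nbhs a) by exact: nbhs_filter.
  apply: (filter_forall (F := nbhs a)) => -[i j] /=.
  have cD : {for a, continuous ('D_(ei i) (fun u => H u 0 j))}.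
    exact: Ck_continuous (Ck_derive i (HA j 1%N)) Aa.
  have /cvgrPdist_le/(_ _ eps0) : 'D_(ei i) (fun u => H u 0 j) @ a -->
    'D_(ei i) (fun u => H u 0 j) a by exact: cD.
  by apply: filterS => u; rewrite H0 sub0r normrN.
have nJ : \forall u \near a, partial_mx F u \in unitmx.
  have cJ : {for a, continuous (fun u => \det (partial_mx F u))}.
    apply: (@Ck_continuous _ _ 0%N A) => //.
    apply: Ck_det => // i j.
    apply: (@Ck_ext _ _ _ _ ('D_(ei i) (fun u => F u 0 j))) => //.
      by move=> u _; rewrite mxE.
    exact: Ck_derive (FA j 1%N).
  have d0 : \det (partial_mx F a) != 0.
    by rewrite -unitfE -unitmxE; have [] := mulmx1_unit JL.
  have : \forall u \near a, \det (partial_mx F u) != 0.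
    have e0 : 0 < `|\det (partial_mx F a)| by rewrite normr_gt0.
    have /cvgrPdist_lt/(_ _ e0) : (fun u => \det (partial_mx F u)) @ a -->
      \det (partial_mx F a) by exact: cJ.
    apply: filterS => u; apply: contraTneq => ->.
    by rewrite subr0 ltxx.
  by apply: filterS => u; rewrite unitmxE unitfE.
have : \forall u \near a, [/\ A u, partial_mx F u \in unitmx &
    forall ij : 'I_m * 'I_m, `|'D_(ei ij.1) (fun u => H u 0 ij.2) u| <= eps].
  by apply: filterS3 nA nJ nH => u hA hJ hH; split.
move=> /nbhs_ballP[r r0 rP]; exists r => //; split.
- by move=> u /rP[].
- by move=> u /rP[].
move=> u v au av.
have -> : (u - v) - (F u - F v) *m L = H u - H v.
  by rewrite /H mulmxBl !opprB [in LHS](addrC (F v *m L)) addrACA (addrC (- v)).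
apply: rV_norm_le; first by rewrite mulr_ge0 ?invr_ge0.
move=> j; rewrite !mxE.
have [|xi xi1] := @mean_value_partials _ _ a r (fun u => H u 0 j) v u _ av au.
  by move=> x i /rP[Ax _ _]; exact: Ck_derivable (HA j 1%N) Ax.
rewrite /= => E; rewrite [leLHS](_ : _ = `|H u 0 j - H v 0 j|); last by rewrite /H !mxE.
rewrite E.
apply: (le_trans (ler_norm_sum _ _ _)).
apply: (@le_trans _ _ (\sum_(k < m) eps * `|u - v|)).
  apply: ler_sum => k _; rewrite normrM; apply: ler_pM => //.
    by have [/rP[_ _ /(_ (k, j))]] := xi1 k.
  by have := rV_coord_le (u - v) k; rewrite !mxE.
rewrite sumr_const card_ord -[leLHS]mulr_natl mulrA; apply: ler_wpM2r => //.
rewrite /eps invfM mulrCA ler_piMr ?invr_ge0//.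
by rewrite ler_pdivrMr ?mul1r ?ler_nat.
Qed.

End InverseFunction.

HB.instance Definition _ (R : realType) m := Complete.on 'rV[R]_m.

Section InverseFunctionThm.
Context {R : realType} {m : nat}.
Implicit Types (A : set 'rV[R]_m) (F G : 'rV[R]_m -> 'rV[R]_m) (a u v : 'rV[R]_m).
Local Notation ei i := (delta_mx (0 : 'I_1) i : 'rV[R]_m).

(** A solution of $F(u)=y$ is a fixed point of $u\mapsto u-(F(u)-y)L$, a Newton step with frozen
    derivative. By the estimate this map contracts by $1/2$ on a closed ball about [x], and Banach's
    theorem solves the equation for all [y] close to [F x]. *)
Lemma near_linear_open (B : set 'rV[R]_m) F (L J : 'M[R]_m) : L *m J = 1%:M ->
  (forall u v, B u -> B v -> `|(u - v) - (F u - F v) *m L| <= 2^-1 * `|u - v|) ->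
  forall V, open V -> V `<=` B -> open (F @` V).
Proof.
move=> LJ E V oV VB; rewrite openE => _ [x Vx <-].
have [C C0 LC] := mulmx_bounded L.
have [s0 /= s00 sV] : exists2 s : R, 0 < s & ball x s `<=` V.
  by have := open_near oV Vx => /nbhs_ballP[s s0 sV]; exists s.
(* Halving the radius puts the closed ball inside [V]. *)
pose s := s0 / 2.
have s_gt0 : 0 < s by rewrite divr_gt0.
pose U : set 'rV[R]_m := [set u | `|x - u| <= s].
have UV : U `<=` V.
  move=> u Uu; apply: sV; rewrite -ball_normE /=; apply: (le_lt_trans Uu).
  by rewrite /s; lra.
(* This radius gives $|(y-F(x))L|\le s/2$. The contraction adds at most another $s/2$, so the closed
   ball of radius [s] is mapped into itself. *)
apply/nbhs_ballP; exists (s / (2 * C)); first by apply: divr_gt0 => //; rewrite mulr_gt0.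
move=> y; rewrite -ball_normE /= => Fxy.
pose f u := u - (F u - y) *m L.
have fU : {homo f : u / U u}.
  move=> u Uu; rewrite /U /= -normrN opprB.
  have -> : f u - x = ((u - x) - (F u - F x) *m L) + (y - F x) *m L.
    rewrite /f !mulmxBl; move: (F u *m L) (F x *m L) (y *m L) => p q t.
    by apply/rowP => j; rewrite !mxE; ring.
  apply: (le_trans (ler_normD _ _)).
  have h1 := E u x (VB _ (UV _ Uu)) (VB _ Vx).
  have h2 := LC (y - F x).
  have h3 : C * `|y - F x| <= s / 2.
    rewrite distrC -ler_pdivlMl//; apply: (le_trans (ltW Fxy)).
    by rewrite invfM mulrA mulrC.
  have h4 : `|u - x| <= s by rewrite distrC.
  lra.
have cf : is_contraction (mkfun fU : {fun U >-> U}).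
  have q0 : 0 <= 2^-1 :> R by rewrite invr_ge0.
  exists (NngNum q0); split => /=; first by rewrite invf_lt1// ltr1n.
  move=> [u v] /= [Uu Uv]; rewrite (_ : f u - f v = (u - v) - (F u - F v) *m L).
    by apply: E; apply: VB; apply: UV.
  rewrite /f !mulmxBl; move: (F u *m L) (F v *m L) (y *m L) => p q t.
  by apply/rowP => j; rewrite !mxE; ring.
have cU : closed U.
  rewrite (_ : U = (fun u => `|x - u|) @^-1` [set t | t <= s]) //.
  apply: closed_comp; last exact: closed_le.
  move=> u _; apply: continuous_comp; last exact: norm_continuous.
  by apply: continuousB; [exact: cst_continuous|exact: cvg_id].
have [|p Up pf] := banach_fixed_point cf cU.
  by exists x; rewrite /U /= subrr normr0 ltW.
exists p; first exact: UV.
have : (F p - y) *m L = 0.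
  have pf' : p = p - (F p - y) *m L by exact: pf.
  by apply: oppr_inj; apply: (addrI p); rewrite -pf' oppr0 addr0.
move/(congr1 (mulmx^~ J)); rewrite -mulmxA LJ mulmx1 mul0mx => /eqP.
by rewrite subr_eq0 => /eqP.
Qed.

(** The estimate yields $|u-v|\le 2C\,|F(u)-F(v)|$, hence injectivity and a Lipschitz inverse [G].
    The partial derivatives of [G] are the entries of [invmx (partial_mx F (G y))], and this formula
    raises the differentiability class of [G] by one at each step. *)
Theorem inverse_function A F a (L : 'M[R]_m) : open A -> A a ->
  (forall j, Cinf A (fun u => F u 0 j)) -> partial_mx F a *m L = 1%:M ->
  exists (B : set 'rV[R]_m) (G : 'rV[R]_m -> 'rV[R]_m),
    [/\ open B, B a, B `<=` A,
        forall V, open V -> V `<=` B -> open (F @` V)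
      & (forall x, B x -> G (F x) = x) /\
        forall j, Cinf (F @` B) (fun y => G y 0 j)].
Proof.
move=> oA Aa FA JL.
have [r r0 [rA uJ E]] := near_linear_estimate oA Aa FA JL.
pose B : set 'rV[R]_m := ball a r.
have oF := near_linear_open (mulmx1C JL) E.
have [C C0 LC] := mulmx_bounded L.
have lip u v : B u -> B v -> `|u - v| <= 2 * C * `|F u - F v|.
  move=> Bu Bv; have h1 := E _ _ Bu Bv; have h2 := LC (F u - F v).
  have h3 := ler_normD ((u - v) - (F u - F v) *m L) ((F u - F v) *m L).
  by rewrite subrK in h3; lra.
have injF u v : B u -> B v -> F u = F v -> u = v.
  move=> Bu Bv Fuv; have := lip _ _ Bu Bv.
  by rewrite Fuv subrr normr0 mulr0 normr_le0 subr_eq0 => /eqP.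
(* Outside the image of the ball, [G] takes the default value [a]. *)
pose G y := xget a [set x | B x /\ F x = y].
have GF x : B x -> G (F x) = x.
  move=> Bx; rewrite /G; case: xgetP => [z -> [Bz Fz]|/(_ x)[]//].
  exact: injF.
have oB : open B by exact: ball_open.
have oFB : open (F @` B) by exact: oF.
have GB y : (F @` B) y -> B (G y) by move=> [x Bx <-]; rewrite GF.
have FG y : (F @` B) y -> F (G y) = y by move=> [x Bx <-]; rewrite GF.
have cG y : (F @` B) y -> G @ y --> G y.
  move=> By; apply/(cvgrPdist_le (F := nbhs y) (FF := nbhs_filter y)) => e e0.
  have : \forall z \near y, `|y - z| < e / (2 * C).
    apply/nbhs_ballP; exists (e / (2 * C)); first by apply: divr_gt0; rewrite // mulr_gt0.
    by move=> z; rewrite -ball_normE.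
  have := open_near oFB By; apply: filterS2 => z Bz yz.
  apply: (le_trans (lip _ _ (GB _ By) (GB _ Bz))); rewrite !FG//.
  by rewrite -ler_pdivlMl ?mulr_gt0// mulrC ltW.
have dG y i : (F @` B) y -> forall j, is_derive y (ei i) (fun z => G z 0 j)
    (invmx (partial_mx F (G y)) i j).
  move=> By; pose x := G y; have Bx : B x := GB _ By.
  pose M := partial_mx F x; have uM : M \in unitmx := uJ _ Bx.
  have nB : \forall h \near (0 : R)^', (F @` B) (h *: ei i + y).
    have : (fun h : R => h *: ei i + y) @ (0 : R)^' --> y.
      have h0 : (fun h : R => h) @ 0^' --> (0 : R).
        by apply: cvg_within_filter; exact: cvg_id.
      rewrite -[X in _ --> X]add0r -(scale0r (ei i)).
      by apply: cvgD; [apply: cvgZl|exact: cvg_cst].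
    by move=> H; exact: H _ (open_near oFB By).
  pose g h := G (h *: ei i + y).
  have gx : g @ 0^' --> x.
    have h0 : (fun h : R => h) @ 0^' --> (0 : R).
      by apply: cvg_within_filter; exact: cvg_id.
    have hy : (fun h : R => h *: ei i + y) @ (0 : R)^' --> y.
      rewrite -[X in _ --> X]add0r -(scale0r (ei i)).
      by apply: cvgD; [apply: cvgZl|exact: cvg_cst].
    exact: (cvg_comp _ _ hy (cG _ By)).
  have H h : exists xi : 'I_m * 'I_m -> 'rV[R]_m,
      (forall kj, `|xi kj - x| <= `|g h - x|) /\
      (B (g h) -> forall j, F (g h) 0 j - F x 0 j =
        \sum_k 'D_(ei k) (fun y => F y 0 j) (xi (k, j)) * (g h 0 k - x 0 k)).
    have [bg|bg] := pselect (B (g h)); last first.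
      by exists (fun=> x); split => // kj; rewrite subrr normr0.
    have Hj j : exists xi : 'I_m -> 'rV[R]_m,
        (forall k, `|xi k - x| <= `|g h - x|) /\ F (g h) 0 j - F x 0 j =
        \sum_k 'D_(ei k) (fun y => F y 0 j) (xi k) * (g h 0 k - x 0 k).
      have [|xi xi1 xi2] := @mean_value_partials _ _ a r (fun u => F u 0 j) x (g h) _ Bx bg.
        by move=> z k /rA Az; exact: Ck_derivable (FA j 1%N) Az.
      by exists xi; split => // k; have [] := xi1 k.
    have [xi xiP] := choice Hj.
    exists (fun kj => xi kj.2 kj.1); split=> [[k j]|_ j] /=.
      by have [+ _] := xiP j; apply.
    by have [] := xiP j.
  have [xi xiP] := choice H.
  have xix kj : (fun h => xi h kj) @ 0^' --> x.
    apply/cvgrPdist_lt => e e0.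
    have /cvgrPdist_lt/(_ e e0) := gx; apply: filterS => h.
    rewrite distrC => /(le_lt_trans _) gb; rewrite distrC; apply: gb.
    by have [+ _] := xiP h; apply.
  (* By the mean value formula the difference quotients $w_h$ of [G] satisfy $w_hD_h=e_i$. They are
     bounded by $2C$ and $D_h$ tends to [M], so $w_hM$ tends to $e_i$ as well, and $w_h$ to
     $e_iM^{-1}$. *)
  pose D h k j := 'D_(ei k) (fun y => F y 0 j) (xi h (k, j)).
  have DM k j : (fun h => `|D h k j - M k j|) @ 0^' --> (0 : R).
    have cD : {for x, continuous ('D_(ei k) (fun y => F y 0 j))}.
      exact: Ck_continuous (Ck_derive k (FA j 1%N)) (rA _ Bx).
    have DMkj : (fun h => D h k j) @ 0^' --> M k j.
      by rewrite /M mxE; exact: (cvg_comp _ _ (xix (k, j)) cD).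
    apply/cvgrPdist_lt => e e0.
    have /cvgrPdist_lt/(_ e e0) := DMkj; apply: filterS => h.
    by rewrite distrC sub0r normrN normr_id.
  pose w h := h^-1 *: (g h - x).
  have wi : (fun h => w h *m M) @ 0^' --> ei i.
    apply: cvg_rV => j.
    have S0 : (fun h => 2 * C * \sum_k `|D h k j - M k j|) @ 0^' --> (0 : R).
      have S1 := @cvg_sumr _ _ _ (0 : R)^' _ (index_enum 'I_m)
        (fun k h => `|D h k j - M k j|) (fun=> 0) (DM ^~ j).
      rewrite big1// in S1.
      rewrite -[X in _ --> X](mulr0 (2 * C)).
      by apply: cvgM; [exact: cvg_cst|exact: S1].
    apply/cvgrPdist_le => e e0.
    have nS : \forall h \near (0 : R)^',
      `|0 - 2 * C * \sum_k `|D h k j - M k j| | <= e.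
      by have /cvgrPdist_le/(_ e e0) := S0.
    have neq0 : \forall h \near (0 : R)^', h != 0 by exact: nbhs_dnbhs_neq.
    apply: filterS3 neq0 nB nS => h h0 nBh; rewrite sub0r normrN => Se.
    have Bg : B (g h) by exact: GB.
    have Fg : F (g h) = h *: ei i + y by exact: FG.
    have Fx : F x = y by exact: FG.
    have wb : `|w h| <= 2 * C.
      rewrite /w normrZ normfV ler_pdivrMl ?normr_gt0//.
      apply: (le_trans (lip _ _ Bg Bx)); rewrite Fg Fx addrK normrZ mulrC.
      rewrite -mulrA ler_pM2l ?normr_gt0// ler_piMl ?mulr_ge0 ?(ltW C0)//.
      apply: rV_norm_le => // k; rewrite mxE eqxx /=.
      by case: (k == i); rewrite ?normr1 ?normr0.
    apply: le_trans Se.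
    have eij : (ei i) 0 j = \sum_k D h k j * w h 0 k.
      have [_ /(_ Bg j)] := xiP h; rewrite Fg Fx.
      rewrite mxE [X in X + y 0 j](_ : _ = h * (ei i) 0 j); last by rewrite mxE.
      rewrite addrK => /(congr1 (fun t => h^-1 * t)).
      rewrite mulrA mulVf// mul1r => ->; rewrite mulr_sumr.
      by apply: eq_bigr => k _; rewrite /w !mxE mulrCA.
    rewrite eij mxE -sumrB.
    apply: (le_trans (ler_norm_sum _ _ _)).
    rewrite (le_trans _ (ler_norm _))// mulr_sumr; apply: ler_sum => k _.
    rewrite mulrC -mulrBr normrM; apply: ler_wpM2r => //.
    by apply: le_trans wb; exact: rV_coord_le.
  have wl : w @ 0^' --> ei i *m invmx M.
    apply: cvg_rV => j.
    have -> : (fun h => w h 0 j) = (fun h => \sum_k (w h *m M) 0 k * invmx M k j).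
      by apply/funext => h; rewrite -[w h in LHS](mulmxK uM) mxE.
    rewrite mxE; apply: (@cvg_sumr _ _ _ (0 : R)^' _ _
      (fun k h => (w h *m M) 0 k * invmx M k j)) => k.
    apply: cvgM; last exact: cvg_cst.
    exact: (cvg_comp _ _ wi (@coord_continuous _ _ _ 0 k _)).
  move=> j.
  have wj : (fun h => w h 0 j) @ 0^' --> invmx M i j.
    have := cvg_comp _ _ wl (@coord_continuous _ _ _ 0 j _).
    by rewrite -rowE mxE.
  have gr : (fun h => h^-1 *: (((fun z => G z 0 j) \o shift y) (h *: ei i) - G y 0 j))
      @ 0^' --> invmx M i j.
    by apply: near_eq_cvg_to wj; apply: nearW => h; rewrite /w !mxE.
  split; last exact: cvg_lim gr.
  by apply/cvg_ex; eexists; exact: gr.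
exists B, G; split => //; first exact: ballxx.
split=> // j k; move: j; elim: k => [|k IHk] j.
  split=> // y By.
  exact: (cvg_comp _ _ (cG _ By) (@coord_continuous _ _ _ 0 j _)).
split=> [y By|i].
  exact: (cvg_comp _ _ (cG _ By) (@coord_continuous _ _ _ 0 j _)).
split=> [y /(dG _ i)/(_ j)[]//|].
apply: (@Ck_ext _ _ _ _ (fun y => invmx (partial_mx F (G y)) i j)) => //.
  by move=> y; rewrite inE => /(dG _ i)/(_ j)[_ ->].
have Ci : Ck k B (fun u => invmx (partial_mx F u) i j).
  apply: (@Ck_invmx _ _ _ _ _ (partial_mx F)) => // i' j'.
  apply: (@Ck_ext _ _ _ _ ('D_(ei i') (fun u => F u 0 j'))) => //.
    by move=> u _; rewrite mxE.
  exact: Ck_derive (Ck_sub rA (FA j' k.+1)).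
exact: (Ck_comp oFB oB GB IHk Ci).
Qed.

End InverseFunctionThm.

Lemma rV_ball_open (R : realType) m (a : 'rV[R]_m) r : open (ball a r).
Proof.
have [r0|r0] := ltP 0 r; first exact: ball_open.
rewrite (_ : ball a r = set0); first exact: open0.
by rewrite -subset0 => u /rV_ball_gt0; rewrite ltNge r0.
Qed.

(** * Hadamard's lemma *)

Section Hadamard.
Context {R : realType} {m : nat}.
Variables (a : 'rV[R]_m) (r : R).
Implicit Types (u v : 'rV[R]_m) (h : 'rV[R]_m -> R) (i j : 'I_m).
Local Notation ei i := (delta_mx (0 : 'I_1) i : 'rV[R]_m).
Local Notation B := (ball a r).
Local Notation mu := (@lebesgue_measure R).

(** The path that leads, in the direction [i] only, from [u] with its [i]-th coordinate reset to
    that of [a] back to [u]. *)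
Definition seg i (t : R) u : 'rV[R]_m :=
  \row_j (if j == i then a 0 i + t * (u 0 i - a 0 i) else u 0 j).

Lemma seg_add i t u (s : R) j :
  seg i t (s *: ei j + u) = seg i t u + (s * (if j == i then t else 1)) *: ei j.
Proof.
apply/rowP => k; rewrite !mxE eqxx /=.
have [->|ki] := eqVneq k i.
  by have [_|_] := eqVneq i j; rewrite /=; ring.
by have [<-|kj] := eqVneq k j; rewrite ?(negbTE ki) /=; ring.
Qed.

Lemma seg_lineE i t u : seg i t u = seg i 0 u + t *: ((u 0 i - a 0 i) *: ei i).
Proof.
apply/rowP => k; rewrite !mxE eqxx /=.
by have [_|_] := eqVneq k i; rewrite /=; ring.
Qed.

Lemma seg_dist i t u : 0 <= t <= 1 -> `|a - seg i t u| <= `|a - u|.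
Proof.
move=> /andP[t0 t1]; apply: rV_norm_le => // j.
apply: le_trans (rV_coord_le _ j); rewrite !mxE.
case: (eqVneq j i) => [->|//].
rewrite (_ : _ - _ = t * (a 0 i - u 0 i)); last by ring.
by rewrite normrM ger0_norm// ler_piMl.
Qed.

Lemma seg_ball i t u : 0 <= t <= 1 -> B u -> B (seg i t u).
Proof. by rewrite -ball_normE /= => t01; exact/le_lt_trans/seg_dist. Qed.

(** Closed balls of $\mathbb R^m$ are compact. The bound is applied to partial derivatives, for
    Lipschitz estimates and for domination under the integral. *)
Lemma bounded_on_closed_ball h (rho : R) : Ck 0 B h -> rho < r ->
  exists2 K, 0 <= K & forall x, `|a - x| <= rho -> `|h x| <= K.
Proof.
move=> [hB _] rr; pose A : set 'rV[R]_m := [set x | `|a - x| <= rho].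
have AB x : A x -> B x by rewrite -ball_normE /= => /le_lt_trans; apply.
have bA : bounded_set A.
  exists (`|a| + rho); split; first exact: num_real.
  move=> y /ltW ay x Ax; apply: le_trans ay.
  rewrite -[x](subKr a); apply: (le_trans (ler_normB _ _)).
  by rewrite lerD2l.
have cA : closed A.
  rewrite (_ : A = (fun u => `|a - u|) @^-1` [set t | t <= rho]) //.
  apply: closed_comp; last exact: closed_le.
  move=> u _; apply: continuous_comp; last exact: norm_continuous.
  by apply: continuousB; [exact: cst_continuous|exact: cvg_id].
have hA : {within A, continuous h}.
  by apply: continuous_in_subspaceT => x; rewrite inE => /AB; exact: hB.
have := compact_bounded (continuous_compact hA (bounded_closed_compact bA cA)).
move=> [K [_ KP]]; exists (`|K| + 1) => // x Ax.
by apply: (KP (`|K| + 1)); [rewrite (le_lt_trans (ler_norm K))// ltrDl|exists x].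
Qed.

(** The factor in the remainder of Hadamard's lemma in the direction [i]. Differentiating
    [h (seg i t u)] with respect to the [i]-th coordinate of [u] produces a factor $t$; the weight
    $t^n$ makes the family closed under partial derivatives. *)
Definition seg_integral i n h u : R :=
  \int[mu]_(t in `[0%R, 1%R]) (t ^+ n * h (seg i t u)).

Lemma seg_continuous i n h u (t : R) : Ck 0 B h -> 0 <= t <= 1 -> B u ->
  {for t, continuous (fun t : R => t ^+ n * h (seg i t u))}.
Proof.
move=> [hB _] t01 Bu; apply: continuousM; first exact: exprn_continuous.
apply: continuous_comp; last by apply: hB; exact: seg_ball.
have : (fun s : R => seg i 0 u + s *: ((u 0 i - a 0 i) *: ei i)) @ t -->
    seg i 0 u + t *: ((u 0 i - a 0 i) *: ei i).
  by apply: cvgD; [exact: cvg_cst|apply: cvgZl; exact: cvg_id].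
by rewrite -seg_lineE -(funext (fun s => seg_lineE i s u)).
Qed.

Lemma seg_integrable i n h u : Ck 0 B h -> B u ->
  mu.-integrable `[0%R, 1%R] (EFin \o (fun t : R => t ^+ n * h (seg i t u))).
Proof.
move=> hB Bu; apply: continuous_compact_integrable; first exact: segment_compact.
apply: continuous_in_subspaceT => t; rewrite inE /= in_itv /= => t01.
exact: seg_continuous.
Qed.

Lemma cst_integrable (K : R) :
  mu.-integrable `[0%R, 1%R] (EFin \o (fun=> K)).
Proof.
apply: continuous_compact_integrable; first exact: segment_compact.
by apply: continuous_in_subspaceT => t _; exact: cst_continuous.
Qed.

Lemma Rintegral01_cst (K : R) : \int[mu]_(t in `[0%R, 1%R]) K = K.
Proof.
rewrite Rintegral_cst// [X in fine X](_ : _ = 1%E) ?mulr1//.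
by have := @lebesgue_measure_itv R `[0%R, 1%R]; rewrite /= lte_fin ltr01 oppr0 adde0.
Qed.

Lemma integrable01B (f g : R -> R) :
  mu.-integrable `[0%R, 1%R] (EFin \o f) -> mu.-integrable `[0%R, 1%R] (EFin \o g) ->
  mu.-integrable `[0%R, 1%R] (EFin \o (fun t => f t - g t)).
Proof.
move=> fi gi; rewrite (_ : EFin \o _ = ((EFin \o f) \- (EFin \o g))%E)//.
exact: integrableB.
Qed.

Lemma expr01 n (t : R) : 0 <= t <= 1 -> 0 <= t ^+ n <= 1.
Proof. by move=> /andP[t0 t1]; rewrite exprn_ge0// exprn_ile1. Qed.

(** Bounds on the partial derivatives of [h] make the integrand Lipschitz in [u], uniformly in
    $t$. *)
Lemma seg_integral_continuous i n h u : Ck 1 B h -> B u ->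
  {for u, continuous (seg_integral i n h)}.
Proof.
move=> h1 Bu; have h0 := Ck_leS h1.
have au : `|a - u| < r by move: Bu; rewrite -ball_normE.
(* Halfway between $|a-u|$ and $r$: the closed ball of radius [rho] lies in [B] and still contains a
   neighbourhood of [u]. *)
pose rho := (`|a - u| + r) / 2.
have rr : rho < r by rewrite /rho; lra.
have aurho : `|a - u| < rho by rewrite /rho; lra.
have KP (j : 'I_m) := bounded_on_closed_ball (Ck_derive j h1) rr.
have [K K0 hK] : exists2 K, 0 <= K & forall x j, `|a - x| <= rho -> `|'D_(ei j) h x| <= K.
  have [Kj KjP] := choice (fun j => let: ex_intro2 K p q := KP j in
    ex_intro (fun K => 0 <= K /\ forall x, `|a - x| <= rho -> `|'D_(ei j) h x| <= K) K (conj p q)).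
  exists (\sum_j Kj j); first by apply: sumr_ge0 => j _; have [] := KjP j.
  move=> x j ax; rewrite (bigD1 j)//= ler_wpDr//.
    by apply: sumr_ge0 => k _; have [] := KjP k.
  by have [_ ->] := KjP j.
have lip v : `|a - v| < rho -> `|seg_integral i n h u - seg_integral i n h v| <= m%:R * K * `|u - v|.
  move=> av.
  have Bv : B v by rewrite -ball_normE /=; exact: lt_trans rr.
  rewrite /seg_integral -RintegralB//; [|exact: seg_integrable..].
  have iB := integrable01B (seg_integrable i n h0 Bu) (seg_integrable i n h0 Bv).
  apply: (le_trans (le_normr_Rintegral _ _)) => //.
  rewrite -[leRHS]Rintegral01_cst; apply: le_Rintegral => //.
  - exact: (@integrable_norm _ _ _ mu).
  - exact: cst_integrable.
  move=> t; rewrite /= in_itv /= => t01.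
  rewrite -mulrBr normrM (le_trans (ler_piMl _ _))//.
    by have /andP[t0 t1] := expr01 n t01; rewrite ger0_norm.
  have bs w : `|a - w| < rho -> ball a rho (seg i t w).
    by move=> aw; rewrite -ball_normE /=; exact: le_lt_trans (seg_dist _ _ t01) aw.
  have [|xi xi1 ->] := @mean_value_partials _ _ a rho h (seg i t v) (seg i t u) _ (bs _ av) (bs _ aurho).
    move=> x k; rewrite -ball_normE /= => ax; apply: Ck_derivable h1 _.
    by rewrite -ball_normE /=; exact: lt_trans rr.
  apply: (le_trans (ler_norm_sum _ _ _)).
  apply: (@le_trans _ _ (\sum_(k < m) K * `|u - v|)); last first.
    by rewrite sumr_const card_ord -[leLHS]mulr_natl mulrA.
  apply: ler_sum => k _; rewrite normrM; apply: ler_pM => //.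
    by apply: hK; have [+ _] := xi1 k; rewrite -ball_normE /= => /ltW.
  apply: le_trans (rV_coord_le _ k); rewrite !mxE.
  case: eqP => [->|//]; rewrite (_ : _ - _ = t * (u 0 i - v 0 i)); last by ring.
  rewrite normrM; case/andP: t01 => t0 t1; rewrite (ger0_norm t0).
  exact: ler_piMl (normr_ge0 _) t1.
suff : seg_integral i n h @ u --> seg_integral i n h u by [].
apply/(cvgrPdist_le (F := nbhs u) (FF := nbhs_filter u)) => e e0.
have mK : 0 <= m%:R * K by rewrite mulr_ge0.
(* The first bound keeps [v] within distance [rho] of [a]; in the second, adding 1 avoids a division
   by zero when $mK=0$. *)
have d0 : 0 < Num.min (rho - `|a - u|) (e / (m%:R * K + 1)).
  by rewrite lt_min subr_gt0 aurho divr_gt0// ltr_wpDl.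
apply/nbhs_ballP; exists (Num.min (rho - `|a - u|) (e / (m%:R * K + 1))) => //.
move=> v; rewrite -ball_normE /= lt_min => /andP[uv1 uv2].
apply: (le_trans (lip v _)).
  have := ler_normD (a - u) (u - v); rewrite addrA subrK; lra.
apply: (@le_trans _ _ ((m%:R * K + 1) * `|u - v|)).
  by rewrite ler_wpM2r// lerDl.
by rewrite -ler_pdivlMl ?ltr_wpDl// mulrC ltW.
Qed.

(** Differentiation under the integral sign, dominated by a constant. The inner derivative is $t$ if
    $j=i$ and 1 otherwise, whence the shift of the exponent. *)
Lemma seg_integral_derive i n h u j : Ck 1 B h -> B u ->
  is_derive u (ei j) (seg_integral i n h)
    (seg_integral i (n + (j == i)) ('D_(ei j) h) u).
Proof.
move=> h1 Bu; have h0 := Ck_leS h1.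
have au : `|a - u| < r by move: Bu; rewrite -ball_normE.
pose rho := (`|a - u| + r) / 2.
have rr : rho < r by rewrite /rho; lra.
have aurho : `|a - u| < rho by rewrite /rho; lra.
have [K K0 hK] := bounded_on_closed_ball (Ck_derive j h1) rr.
pose d := rho - `|a - u|.
have d0 : 0 < d by rewrite subr_gt0.
pose f (s t : R) : R := t ^+ n * h (seg i t (s *: ei j + u)).
have near_u (s : R) : s \in `]-d, d[ -> `|a - (s *: ei j + u)| < rho.
  rewrite in_itv /= -ltr_norml => sd.
  rewrite [s *: _ + _]addrC opprD addrA; apply: (le_lt_trans (ler_normB _ _)).
  have : `|s *: ei j| <= `|s|.
    rewrite normrZ ler_piMr//; apply: rV_norm_le => // k; rewrite mxE eqxx /=.
    by case: (k == j); rewrite ?normr1 ?normr0.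
  by move: sd; rewrite /d; lra.
have near_B s : s \in `]-d, d[ -> B (s *: ei j + u).
  by move=> /near_u H; rewrite -ball_normE /=; exact: lt_trans rr.
have df (s t : R) : s \in `]-d, d[ -> 0 <= t <= 1 -> is_derive s 1 (f ^~ t)
    (t ^+ (n + (j == i)) * 'D_(ei j) h (seg i t (s *: ei j + u))).
  move=> sd t01; pose c : R := if j == i then t else 1.
  have hl : is_derive (s * c) 1 (fun y : R => h (seg i t u + y *: ei j))
      ('D_(ei j) h (seg i t u + (s * c) *: ei j)).
    apply: is_derive_line; rewrite -seg_add.
    by apply: Ck_derivable h1 _; apply: seg_ball => //; exact: near_B.
  have hc : is_derive s 1 (fun s : R => s * c) c.
    have := is_deriveZ c (is_derive_id s 1); rewrite [c *: 1]mulr1.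
    by rewrite (_ : c \*: id = (fun s => s * c))//; apply/funext => y /=; rewrite mulrC.
  have := is_deriveZ (t ^+ n) (is_derive1_comp (g := fun s : R => s * c) (x := s) hl hc).
  rewrite (_ : _ \*: _ = f ^~ t); last first.
    by apply/funext => y; rewrite /f seg_add.
  rewrite -seg_add /c exprD; case: (j == i); rewrite /= ?expr1 ?expr0.
    by move=> ?; rewrite -mulrA [t * _]mulrC.
  by rewrite !mulr1.
have := @cvg_differentiation_under_integral R _ _ mu f `[0%R, 1%R] _ 0 (- d) d _ _ _ (fun=> K) _ _ _.
move=> H.
have gr : (fun y => y^-1 *: ((seg_integral i n h \o shift u) (y *: ei j) - seg_integral i n h u))
    @ 0^' --> seg_integral i (n + (j == i)) ('D_(ei j) h) u.
  rewrite (_ : seg_integral i (n + _) _ u = \int[mu]_(t in `[0%R, 1%R]) partial1of2 f 0 t).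
    have -> : (fun y => y^-1 *: ((seg_integral i n h \o shift u) (y *: ei j) - seg_integral i n h u)) = 
      (fun y : R => y^-1 *: (\int[mu]_(t in `[0%R, 1%R]) f (y + 0) t - \int[mu]_(t in `[0%R, 1%R]) f 0 t)).
      apply/funext => y; rewrite /seg_integral /f /= addr0 scale0r add0r.
      by [].
    apply: H => //.
    - by rewrite /= in_itv /= oppr_lt0 d0.
    - by move=> s sd; apply: seg_integrable => //; exact: near_B.
    - by move=> s t sd t01; have [] := df s t sd t01.
    - exact: cst_integrable.
    - move=> s t sd t01; rewrite partial1of2E; have [_ ->] := df s t sd t01.
      have /andP[p0 p1] := expr01 (n + (j == i)) t01.
      rewrite normrM (ger0_norm p0); apply: le_trans (ler_piMl _ p1) _ => //.
      by apply: hK; apply: le_trans (seg_dist _ _ t01) (ltW (near_u _ sd)).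
  apply: eq_Rintegral => t; rewrite inE /= in_itv /= => t01.
  have s0 : 0 \in `]-d, d[ by rewrite in_itv /= oppr_lt0 d0.
  rewrite partial1of2E; have [_ ->] := df 0 t s0 t01.
  by rewrite scale0r add0r.
split; last exact: cvg_lim gr.
by apply/cvg_ex; eexists; exact: gr.
Qed.

Lemma Cinf_derive h (A : set 'rV[R]_m) j : Cinf A h -> Cinf A ('D_(ei j) h).
Proof. by move=> hA k; exact: Ck_derive (hA k.+1). Qed.

Lemma seg_integral_Cinf i n h : Cinf B h -> Cinf B (seg_integral i n h).
Proof.
move=> hB k; elim: k n h hB => [|k IHk] n h hB.
  by split => // u Bu; exact: seg_integral_continuous (hB 1%N) Bu.
split=> [u Bu|j]; first exact: seg_integral_continuous (hB 1%N) Bu.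
have dh u (Bu : B u) := seg_integral_derive i n j (hB 1%N) Bu.
split=> [u /dh[]//|].
apply: (@Ck_ext _ _ _ _ (seg_integral i (n + (j == i)) ('D_(ei j) h))).
- exact: rV_ball_open.
- by move=> u; rewrite inE => /dh[_ ->].
- exact: IHk (Cinf_derive j hB).
Qed.

(** The fundamental theorem of calculus along [seg], whose end at $t=1$ is [u]. *)
Lemma seg_integral_FTC i h u : Cinf B h -> B u ->
  h u = h (seg i 0 u) + (u 0 i - a 0 i) * seg_integral i 0 ('D_(ei i) h) u.
Proof.
move=> hB Bu; pose F (t : R) := h (seg i t u).
pose f (t : R) := (u 0 i - a 0 i) * (t ^+ 0 * 'D_(ei i) h (seg i t u)).
have segE (t : R) : seg i t u = seg i 0 u + (t * (u 0 i - a 0 i)) *: ei i.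
  by rewrite seg_lineE scalerA.
have dF (t : R) : 0 <= t <= 1 -> is_derive t 1 F (f t).
  move=> t01; pose c := u 0 i - a 0 i.
  have hl : is_derive (t * c) 1 (fun y : R => h (seg i 0 u + y *: ei i))
      ('D_(ei i) h (seg i 0 u + (t * c) *: ei i)).
    apply: is_derive_line; rewrite -segE.
    by apply: Ck_derivable (hB 1%N) _; exact: seg_ball.
  have hc : is_derive t 1 (fun s : R => s * c) c.
    have := is_deriveZ c (is_derive_id t 1); rewrite [c *: 1]mulr1.
    by rewrite (_ : c \*: id = (fun s => s * c))//; apply/funext => y /=; rewrite mulrC.
  have := is_derive1_comp (g := fun s : R => s * c) (x := t) hl hc.
  rewrite (_ : _ \o _ = F); last by apply/funext => s; rewrite /F /= -segE.
  by rewrite -segE /f expr0 mul1r mulrC.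
have cF (t : R) : 0 <= t <= 1 -> F @ t --> F t.
  move=> /dF[+ _] => /derivable1_diffP; exact: differentiable_continuous.
have cDh : Ck 0 B ('D_(ei i) h) by exact: Ck_derive (hB 1%N).
have cft (t : R) : 0 <= t <= 1 -> {for t, continuous f}.
  move=> t01; apply: continuousM; first exact: cst_continuous.
  exact: (seg_continuous (i := i) (n := 0) cDh t01 Bu).
have cf : {within `[0, 1], continuous f}.
  apply: continuous_in_subspaceT => t; rewrite inE /= in_itv /= => t01.
  exact: cft.
have F01 : derivable_oo_LRcontinuous F 0 1.
  split=> [t|/=|/=].
  - rewrite in_itv /= => /andP[t0 t1].
    have t01 : 0 <= t <= 1 by rewrite (ltW t0) (ltW t1).
    by have [] := dF t t01.
  - have c0 : F @ (0 : R) --> F 0 by apply: cF; rewrite lexx ler01.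
    exact: cvg_at_right_filter.
  - have c1 : F @ (1 : R) --> F 1 by apply: cF; rewrite lexx ler01.
    exact: cvg_at_left_filter.
have F'f : {in `]0, 1[, derive1 F =1 f}.
  move=> t; rewrite in_itv /= => /andP[t0 t1]; rewrite derive1E.
  have t01 : 0 <= t <= 1 by rewrite (ltW t0) (ltW t1).
  by have [_ ->] := dF t t01.
have Ff : \int[mu]_(t in `[0%R, 1%R]) f t = F 1 - F 0.
  by rewrite /Rintegral (continuous_FTC2 ltr01 cf F01 F'f).
rewrite /f RintegralZl// in Ff; last exact: (seg_integrable i 0 cDh Bu).
have -> : h u = F 1.
  by congr h; apply/rowP => j; rewrite mxE mul1r addrC subrK; case: eqP => [->|].
by rewrite /seg_integral Ff addrC subrK.
Qed.

End Hadamard.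

Section HadamardMulti.
Context {R : realType} {m : nat}.
Implicit Types (a u : 'rV[R]_m) (h : 'rV[R]_m -> R).

Definition reset_coords (k : nat) a u : 'rV[R]_m :=
  \row_j (if (j < k)%N then a 0 j else u 0 j).

Lemma reset_ball k a u r : ball a r u -> ball a r (reset_coords k a u).
Proof.
move=> au; have r0 := rV_ball_gt0 au; apply/rV_ballP => // j; rewrite mxE.
case: ifP => _; first by rewrite subrr normr0.
by move/rV_ballP : au; apply.
Qed.

Lemma Cinf_reset k a r h : Cinf (ball a r) h ->
  Cinf (ball a r) (fun u => h (reset_coords k a u)).
Proof.
move=> hB; apply: (Cinf_comp (B := ball a r)) hB; try exact: rV_ball_open.
  by move=> u; exact: reset_ball.
move=> j n; apply: (@Ck_ext _ _ _ _ (fun u => if (j < k)%N then a 0 j else u 0 j)).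
- exact: rV_ball_open.
- by move=> u _; rewrite mxE.
- by case: (j < k)%N; [exact: Ck_cst|exact: Ck_coord].
Qed.

(** Induction on [k], resetting one more coordinate by the formula for a single direction. With
    $k=m$ it treats functions vanishing at a point, with general [k] those vanishing on a coordinate
    subspace, such as the fibre in adapted coordinates. *)
Theorem hadamard k a r h : (k <= m)%N -> Cinf (ball a r) h ->
  exists2 g : 'I_m -> 'rV[R]_m -> R, forall j, Cinf (ball a r) (g j)
    & forall u, ball a r u -> h u = h (reset_coords k a u) +
        \sum_(j < m | (j < k)%N) (u 0 j - a 0 j) * g j u.
Proof.
move=> km hB; elim: k km => [|k IHk] km.
  exists (fun _ _ => 0) => [j n|u _]; first exact: Ck_cst.
  rewrite big1 ?addr0//.
  by congr h; apply/rowP => j; rewrite mxE.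
have [g gB gE] := IHk (ltnW km).
pose i := Ordinal km; pose h' u := h (reset_coords k a u).
have h'B : Cinf (ball a r) h' by exact: Cinf_reset.
exists (fun j => if j == i then seg_integral a i 0 ('D_(delta_mx 0 i) h') else g j).
  by move=> j; case: ifP => _ //; apply: seg_integral_Cinf; exact: Cinf_derive.
move=> u Bu; rewrite (bigD1 i)//= eqxx addrA.
have -> : h (reset_coords k.+1 a u) = h' (seg a i 0 u).
  congr h; apply/rowP => j; rewrite !mxE mul0r addr0 ltnS leq_eqVlt.
  rewrite -[nat_of_ord j == k]/(j == i).
  by have [->|ji] := eqVneq j i; rewrite //= ltnn.
rewrite -(seg_integral_FTC i h'B Bu) gE//; congr (_ + _).
apply: eq_big => j.
  rewrite [(j < k.+1)%N]ltnS [(j <= k)%N]leq_eqVlt -[nat_of_ord j == k]/(j == i).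
  by have [->|ji] := eqVneq j i; rewrite /= ?ltnn ?andbF ?andbT.
by have [->|//] := eqVneq j i; rewrite ltnn.
Qed.

End HadamardMulti.

(** * Smooth functions on manifolds *)

Section OpenSets.
Context {X : topologicalType}.

Definition opensI (U V : opens X) : opens X :=
  Opens (openI (open_oset U) (open_oset V)).

Lemma opensIl (U V : opens X) : opensI U V `<=` U.
Proof. by move=> x []. Qed.

Lemma opensIr (U V : opens X) : opensI U V `<=` V.
Proof. by move=> x []. Qed.

End OpenSets.

Section SmoothVia.
Context {R : realType} {X : topologicalType} {m : nat}.
Implicit Types (A B : set X) (phi : X -> 'rV[R]_m) (f g : X -> R).

(* [f] transported along [phi]; the values outside [phi @` A] are junk. *)
Definition push phi A f (y : 'rV[R]_m) : R :=
  if pselect (exists x, A x /\ phi x = y) is left h then f (projT1 (cid h)) else 0.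

Lemma pushE phi A f x : (forall x y, A x -> A y -> phi x = phi y -> x = y) ->
  A x -> push phi A f (phi x) = f x.
Proof.
move=> inj Ax; rewrite /push; case: pselect => [h|[]]; last by exists x.
by case: (cid h) => z /= [Az /inj ->].
Qed.

Lemma smooth_via_sub phi A B f : B `<=` A -> smooth_via phi A f -> smooth_via phi B f.
Proof.
move=> BA [g gA gE]; exists g; last by move=> x /BA; exact: gE.
by apply: Cinf_sub gA => _ [x Bx <-]; exists x => //; exact: BA.
Qed.

Lemma smooth_via_ext phi A f g : (forall x, A x -> f x = g x) ->
  smooth_via phi A f -> smooth_via phi A g.
Proof. by move=> fg [h hA hE]; exists h => // x Ax; rewrite -fg// hE. Qed.

(** The representatives of [f] on the pieces are unrelated outside the images of these pieces. The
    single function [push] replaces them all and agrees near each point with one of them. *)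
Lemma smooth_via_local phi A f :
  (forall x y, A x -> A y -> phi x = phi y -> x = y) ->
  (forall x, A x -> exists B, [/\ B x, B `<=` A, open (phi @` B) & smooth_via phi B f]) ->
  smooth_via phi A f.
Proof.
move=> inj H; exists (push phi A f); last by move=> x Ax; rewrite pushE.
apply: Cinf_local => _ [x Ax <-]; have [B [Bx BA oB [g gB gE]]] := H x Ax.
exists (phi @` B); split; [by []|by exists x|].
exists g => // y; rewrite inE => -[z Bz <-].
by rewrite pushE//; [exact: gE|exact: BA].
Qed.

Lemma smooth_via_cst phi A a : smooth_via phi A (fun=> a).
Proof. by exists (fun=> a) => // k; exact: Ck_cst. Qed.

Lemma smooth_viaD phi A f g : open (phi @` A) ->
  smooth_via phi A f -> smooth_via phi A g -> smooth_via phi A (fun x => f x + g x).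
Proof.
move=> oA [f' fA fE] [g' gA gE]; exists (fun y => f' y + g' y).
  by move=> k; apply: Ck_add.
by move=> x Ax; rewrite fE// gE.
Qed.

Lemma smooth_viaM phi A f g : open (phi @` A) ->
  smooth_via phi A f -> smooth_via phi A g -> smooth_via phi A (fun x => f x * g x).
Proof.
move=> oA [f' fA fE] [g' gA gE]; exists (fun y => f' y * g' y).
  by move=> k; apply: Ck_mul.
by move=> x Ax; rewrite fE// gE.
Qed.

Lemma smooth_viaV phi A f : open (phi @` A) -> (forall x, A x -> f x != 0) ->
  smooth_via phi A f -> smooth_via phi A (fun x => (f x)^-1).
Proof.
move=> oA f0 [f' fA fE]; exists (fun y => (f' y)^-1); last by move=> x Ax; rewrite fE.
move=> k; apply: Ck_inv => // _ [x Ax <-].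
by rewrite -fE// f0.
Qed.

Lemma smooth_via_comp n (phi' : X -> 'rV[R]_n) phi A f :
  open (phi @` A) -> open (phi' @` A) -> smooth_via phi' A f ->
  (forall j, smooth_via phi A (fun x => phi' x 0 j)) -> smooth_via phi A f.
Proof.
move=> oA oA' [g gA gE] H.
have [T TP] := choice (fun j => let: ex_intro2 t p q := H j in
  ex_intro (fun t => Cinf (phi @` A) t /\ forall x, A x -> phi' x 0 j = t (phi x)) t (conj p q)).
pose F y := \row_j T j y.
have FE x : A x -> F (phi x) = phi' x.
  by move=> Ax; apply/rowP => j; rewrite mxE; have [_ ->] := TP j.
exists (fun y => g (F y)); last by move=> x Ax; rewrite FE// gE.
apply: (Cinf_comp (B := phi' @` A)) => //.
  by move=> _ [x Ax <-]; exists x => //; rewrite FE.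
move=> j k; apply: (@Ck_ext _ _ _ _ (T j)) => //; last by have [+ _] := TP j; apply.
by move=> y _; rewrite mxE.
Qed.

Lemma open_embedding_sub (U V : opens X) phi :
  V `<=` U -> open_embedding U phi -> open_embedding V phi.
Proof.
move=> VU [c i o]; split => [x /VU /c //|x y /VU Ux /VU Uy|W WV]; first exact: i.
by apply: o; exact: subset_trans VU.
Qed.

Lemma open_embedding_open (U V : opens X) phi :
  open_embedding U phi -> V `<=` U -> open (phi @` V).
Proof. by case=> _ _; apply. Qed.

End SmoothVia.

Section SmoothFun.
Context {R : realType} {m : nat} (M : manifold R m).
Implicit Types (U V : opens M) (f g : M -> R) (phi : M -> 'rV[R]_m)
  (c : opens M * (M -> 'rV[R]_m)).

Lemma atlas_image_open c U : atlas c -> open (c.2 @` (c.1 `&` U)).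
Proof.
by move=> /atlas_open_embedding H; exact: (open_embedding_open H (@opensIl _ c.1 U)).
Qed.

Lemma atlas_inj c U : atlas c ->
  forall x y, (c.1 `&` U) x -> (c.1 `&` U) y -> c.2 x = c.2 y -> x = y.
Proof. by move=> /atlas_open_embedding[_ i _] x y [cx _] [cy _]; exact: i. Qed.

Lemma smooth_fun_sub U V f : V `<=` U -> smooth_fun U f -> smooth_fun V f.
Proof. by move=> VU fU c /fU; apply: smooth_via_sub => x [cx /VU]. Qed.

Lemma smooth_fun_ext U f g : (forall x, U x -> f x = g x) ->
  smooth_fun U f -> smooth_fun U g.
Proof. by move=> fg fU c /fU; apply: smooth_via_ext => x [_ /fg]. Qed.

Lemma smooth_fun_local U f : (forall x, U x -> exists2 V : opens M, V x & smooth_fun V f) ->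
  smooth_fun U f.
Proof.
move=> H c ac; apply: smooth_via_local; first exact: atlas_inj.
move=> x [cx Ux]; have [V Vx fV] := H x Ux.
exists (c.1 `&` opensI U V); split=> //.
- by move=> y [? []].
- exact: atlas_image_open.
- by apply: smooth_via_sub (fV c ac) => y [? []].
Qed.

Lemma smooth_fun_cst U a : smooth_fun U (fun=> a).
Proof. by move=> c _; exact: smooth_via_cst. Qed.

Lemma smooth_funD U f g : smooth_fun U f -> smooth_fun U g ->
  smooth_fun U (fun x => f x + g x).
Proof.
by move=> fU gU c ac; apply: smooth_viaD; [exact: atlas_image_open|exact: fU|exact: gU].
Qed.

Lemma smooth_funM U f g : smooth_fun U f -> smooth_fun U g ->
  smooth_fun U (fun x => f x * g x).
Proof.
by move=> fU gU c ac; apply: smooth_viaM; [exact: atlas_image_open|exact: fU|exact: gU].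
Qed.

Lemma smooth_funV U f : (forall x, U x -> f x != 0) -> smooth_fun U f ->
  smooth_fun U (fun x => (f x)^-1).
Proof.
move=> f0 fU c ac; apply: smooth_viaV; [exact: atlas_image_open| |exact: fU].
by move=> x [_ /f0].
Qed.

Lemma smooth_fun_sum U (I : Type) (r : seq I) (P : pred I) (F : I -> M -> R) :
  (forall i, P i -> smooth_fun U (F i)) -> smooth_fun U (fun x => \sum_(i <- r | P i) F i x).
Proof.
move=> FU; elim: r => [|i r IHr].
  by apply: smooth_fun_ext (smooth_fun_cst _ 0) => x _; rewrite big_nil.
case Pi: (P i); last by apply: smooth_fun_ext IHr => x _; rewrite big_cons Pi.
apply: smooth_fun_ext (smooth_funD (FU i Pi) IHr) => x _.
by rewrite big_cons Pi.
Qed.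

Lemma smooth_fun_prod U (I : Type) (r : seq I) (P : pred I) (F : I -> M -> R) :
  (forall i, P i -> smooth_fun U (F i)) -> smooth_fun U (fun x => \prod_(i <- r | P i) F i x).
Proof.
move=> FU; elim: r => [|i r IHr].
  by apply: smooth_fun_ext (smooth_fun_cst _ 1) => x _; rewrite big_nil.
case Pi: (P i); last by apply: smooth_fun_ext IHr => x _; rewrite big_cons Pi.
apply: smooth_fun_ext (smooth_funM (FU i Pi) IHr) => x _.
by rewrite big_cons Pi.
Qed.

Lemma smooth_fun_continuous U f x : smooth_fun U f -> U x -> {for x, continuous f}.
Proof.
move=> fU Ux; have [c ac cx] := atlas_cover x.
have [g gA gE] := fU c ac.
have [cc _ _] := atlas_open_embedding ac.
have cg : {for c.2 x, continuous g}.
  by apply: Ck_continuous (gA 0%N) _; exists x.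
have cgc : (g \o c.2) @ x --> g (c.2 x) by exact: (continuous_comp (cc _ cx) cg).
suff : f @ x --> f x by [].
rewrite gE//; apply: near_eq_cvg_to cgc.
have : \forall y \near x, opensI c.1 U y by apply: open_nbhs_nbhs; split; [exact: open_oset|].
by apply: filterS => y /gE.
Qed.

Lemma smooth_fun_nonzero U f x : smooth_fun U f -> U x -> f x != 0 ->
  exists V : opens M, [/\ V `<=` U, V x & forall y, V y -> f y != 0].
Proof.
move=> fU Ux fx.
have oV : open [set y | U y /\ f y != 0].
  rewrite openE => y [Uy fy].
  have : \forall z \near y, U z by apply: open_nbhs_nbhs; split => //; exact: open_oset.
  have e0 : 0 < `|f y| by rewrite normr_gt0.
  have cf : f @ y --> f y by exact: (smooth_fun_continuous fU Uy).
  have /cvgrPdist_lt/(_ _ e0) := cf.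
  apply: filterS2 => z fz Uz; split => //.
  by apply: contraTneq fz => ->; rewrite subr0 ltxx.
by exists (Opens oV); split => // y [].
Qed.

Lemma atlas_is_chart c : atlas c -> is_chart c.1 c.2.
Proof.
move=> ac; split; first exact: atlas_open_embedding.
by move=> d ad; rewrite -surjective_pairing; split; exact: atlas_transition.
Qed.

Lemma is_chart_sub U V phi : V `<=` U -> is_chart U phi -> is_chart V phi.
Proof.
move=> VU [oe H]; split; first exact: open_embedding_sub oe.
move=> c /H[t1 t2]; split=> j.
  by apply: smooth_via_sub (t1 j) => x [cx /VU].
by apply: smooth_via_sub (t2 j) => x [/VU].
Qed.

Lemma chart_smooth_fun U V phi (g : 'rV[R]_m -> R) : is_chart U phi -> V `<=` U ->
  Cinf (phi @` V) g -> smooth_fun V (fun x => g (phi x)).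
Proof.
move=> [oe H] VU gV c ac; apply: (smooth_via_comp (phi' := phi)).
- exact: atlas_image_open.
- by apply: (open_embedding_open (V := opensI c.1 V) oe) => x [_ /VU].
- by exists g => //; apply: Cinf_sub gV => _ [x [_ Vx] <-]; exists x.
- move=> j; have [t1 _] := H c ac.
  by apply: smooth_via_sub (t1 j) => x [cx /VU].
Qed.

Lemma chart_smooth_via U V phi f : is_chart U phi -> V `<=` U ->
  smooth_fun V f -> smooth_via phi V f.
Proof.
move=> [oe H] VU fV; apply: smooth_via_local.
  by have [_ i _] := oe => x y /VU Ux /VU Uy; exact: i.
move=> x Vx; have [c ac cx] := atlas_cover x.
have oB : open (phi @` (c.1 `&` V)).
  by apply: (open_embedding_open (V := opensI c.1 V) oe) => y [_ /VU].
exists (c.1 `&` V); split => //.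
apply: (smooth_via_comp (phi' := c.2) oB).
- exact: atlas_image_open.
- exact: fV.
- move=> j; have [_ t2] := H c ac.
  by apply: smooth_via_sub (t2 j) => y [cy /VU].
Qed.

Lemma chart_coord_smooth U phi j : is_chart U phi -> smooth_fun U (fun x => phi x 0 j).
Proof.
move=> ch; apply: (chart_smooth_fun (g := fun y => y 0 j) ch) => // k.
exact: Ck_coord.
Qed.

End SmoothFun.

(** * Sections of graded sheaves *)

Section GradedSheaf.
Context {R : realType} {X : topologicalType} (C : graded_sheaf R X).
Implicit Types (U V : opens X).

Lemma homogeneous_gr k U (f : sec C U) : homogeneous k (gr C k U f).
Proof. by rewrite /homogeneous gr_gr eqxx. Qed.

Lemma gr_homogeneous j k U (f : sec C U) : homogeneous k f ->
  gr C j U f = if j == k then f else 0.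
Proof. by move=> fk; rewrite -{1}fk gr_gr fk. Qed.

Lemma homogeneous_res k U V (h : V `<=` U) (f : sec C U) :
  homogeneous k f -> homogeneous k (res C h f).
Proof. by move=> fk; rewrite /homogeneous -res_gr fk. Qed.

Lemma homogeneous0 k U : homogeneous k (0 : sec C U).
Proof. by rewrite /homogeneous raddf0. Qed.

Lemma homogeneousD k U (f g : sec C U) : homogeneous k f -> homogeneous k g ->
  homogeneous k (f + g).
Proof. by move=> fk gk; rewrite /homogeneous raddfD fk gk. Qed.

Lemma homogeneousN k U (f : sec C U) : homogeneous k f -> homogeneous k (- f).
Proof. by move=> fk; rewrite /homogeneous raddfN fk. Qed.

Lemma homogeneousM j k U (f g : sec C U) : homogeneous j f -> homogeneous k g ->
  homogeneous (j + k) (f * g).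
Proof. by move=> fj gk; exact: gr_mul. Qed.

Lemma homogeneous_cst U a : homogeneous 0 (Defs.cst C U a).
Proof. exact: gr_cst. Qed.

Lemma homogeneous1 U : homogeneous 0 (1 : sec C U).
Proof. by rewrite -(rmorph1 (Defs.cst C U)); exact: homogeneous_cst. Qed.

Lemma homogeneous_sum k U I (r : seq I) (P : pred I) (F : I -> sec C U) :
  (forall i, P i -> homogeneous k (F i)) -> homogeneous k (\sum_(i <- r | P i) F i).
Proof.
move=> Fk; elim/big_ind: _ => //; first exact: homogeneous0.
by move=> f g; exact: homogeneousD.
Qed.

(** The covering family consists of all open sets over which [f] and [g] agree, so no cover has to
    be chosen. *)
Lemma sec_local U (f g : sec C U) :
  (forall x, U x -> exists (V : opens X) (h : V `<=` U), V x /\ res C h f = res C h g) ->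
  f = g.
Proof.
move=> H.
pose I := {V : opens X | exists h : V `<=` U, res C h f = res C h g}.
have hI (i : I) : sval i `<=` U by case: i => V [h].
apply: (@sheaf_separated _ _ C I U sval hI).
  move=> x /H[V [h [Vx e]]]; have i : exists h : V `<=` U, res C h f = res C h g by exists h.
  by exists (exist _ V i).
by move=> i; case: (svalP i) => h; rewrite (Prop_irrelevance (hI i) h).
Qed.

Lemma homogeneous_local k U (f : sec C U) :
  (forall x, U x -> exists (V : opens X) (h : V `<=` U), V x /\ homogeneous k (res C h f)) ->
  homogeneous k f.
Proof.
move=> H; apply: sec_local => x /H[V [h [Vx fk]]]; exists V, h; split => //.
by rewrite res_gr.
Qed.

End GradedSheaf.

(** * Values of sections at points, and trivializations *)

Section Body.
Context {R : realType} {m0 m1 m2 : nat} (M : Nmanifold R m0 m1 m2).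
Local Notation C := (sheaf M).
Implicit Types (U V : opens M) (x y : M).

Lemma fn0 V y : V y -> fn (0 : sec C V) y = 0.
Proof. by move=> Vy; rewrite -(raddf0 (Defs.cst C V)) fn_cst. Qed.

Lemma fn1 V y : V y -> fn (1 : sec C V) y = 1.
Proof. by move=> Vy; rewrite -(rmorph1 (Defs.cst C V)) fn_cst. Qed.

Lemma fnN V (f : sec C V) y : V y -> fn (- f) y = - fn f y.
Proof. by move=> Vy; apply: (addrI (fn f y)); rewrite -fn_add// !subrr fn0. Qed.

Lemma fn_sum V I (r : seq I) (P : pred I) (F : I -> sec C V) y : V y ->
  fn (\sum_(i <- r | P i) F i) y = \sum_(i <- r | P i) fn (F i) y.
Proof.
move=> Vy; elim/big_rec2: _ => [|i a b _ <-]; first exact: fn0.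
by rewrite fn_add.
Qed.

Lemma fn_homogeneous k V (f : sec C V) y : homogeneous k f -> k <> 0%N -> V y -> fn f y = 0.
Proof.
move=> fk k0 Vy; rewrite -fn_gr0// (gr_homogeneous 0 fk).
by case: eqP => [/esym|_]; last exact: fn0.
Qed.

(** The reciprocal of a nonvanishing smooth function is smooth, and [fn] identifies sections of
    degree 0 with smooth functions. *)
Lemma local_inverse V (f : sec C V) x : homogeneous 0 f -> V x -> fn f x != 0 ->
  exists (V' : opens M) (h : V' `<=` V) (g : sec C V'), V' x /\ res C h f * g = 1.
Proof.
move=> f0 Vx fx; have [V' [V'V V'x nz]] := smooth_fun_nonzero (fn_smooth f) Vx fx.
have [g g0 gE] := fn_surj (smooth_funV nz (smooth_fun_sub V'V (fn_smooth f))).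
exists V', V'V, g; split => //; apply: fn_inj.
- exact: (homogeneousM (homogeneous_res _ f0) g0).
- exact: homogeneous1.
- move=> y V'y; rewrite fn_mul// fn_res// gE// fn1// mulfV//.
  exact: nz.
Qed.

Section Triv.
Variables (U : opens M) (tau : forall V : opens M, sec C V -> M -> walg R m1 m2).
Hypothesis T : trivialization U tau.

Lemma tau_add V (f g : sec C V) y : V `<=` U -> V y -> tau (f + g) y = tau f y + tau g y.
Proof. exact: triv_add. Qed.

Lemma tau_mul V (f g : sec C V) y : V `<=` U -> V y -> tau (f * g) y = tau f y * tau g y.
Proof. exact: triv_mul. Qed.

Lemma tau_cst V a y : V `<=` U -> V y -> tau (Defs.cst C V a) y = wC a.
Proof. exact: triv_cst. Qed.

Lemma tau0 V y : V `<=` U -> V y -> tau (0 : sec C V) y = 0.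
Proof. by move=> VU Vy; rewrite -(raddf0 (Defs.cst C V)) tau_cst// raddf0. Qed.

Lemma tau1 V y : V `<=` U -> V y -> tau (1 : sec C V) y = 1.
Proof. by move=> VU Vy; rewrite -(rmorph1 (Defs.cst C V)) tau_cst// rmorph1. Qed.

Lemma tau_opp V (f : sec C V) y : V `<=` U -> V y -> tau (- f) y = - tau f y.
Proof. by move=> VU Vy; apply: (addrI (tau f y)); rewrite -tau_add// !subrr tau0. Qed.

Lemma tau_sum V I (r : seq I) (P : pred I) (F : I -> sec C V) y : V `<=` U -> V y ->
  tau (\sum_(i <- r | P i) F i) y = \sum_(i <- r | P i) tau (F i) y.
Proof.
move=> VU Vy; elim/big_rec2: _ => [|i a b _ <-]; first exact: tau0.
by rewrite tau_add.
Qed.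

Lemma tau_prod V I (r : seq I) (P : pred I) (F : I -> sec C V) y : V `<=` U -> V y ->
  tau (\prod_(i <- r | P i) F i) y = \prod_(i <- r | P i) tau (F i) y.
Proof.
move=> VU Vy; elim/big_rec2: _ => [|i a b _ <-]; first exact: tau1.
by rewrite tau_mul.
Qed.

Lemma wbody_tau_sum V (f : sec C V) y d : V `<=` U -> V y ->
  f = \sum_(k < d) gr C k V f -> wbody (tau f y) = wbody (tau (gr C 0 V f) y).
Proof.
move=> VU Vy fE.
have H (k : nat) : wbody (tau (gr C k V f) y) = if k == 0 then wbody (tau (gr C 0 V f) y) else 0.
  case: (k =P 0%N) => [->//|k0].
  by apply: wbody_homogeneous k0; apply: (triv_homogeneous T) => //; exact: homogeneous_gr.
rewrite {1}fE tau_sum// raddf_sum /=; under eq_bigr do rewrite H.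
case: d fE => [|d] fE; last first.
  rewrite (bigD1 ord0)//= big1 ?addr0// => i /negbTE i0.
  by rewrite -[_ == 0]/(i == ord0) i0.
by rewrite big_ord0 fE big_ord0 raddf0 tau0// raddf0.
Qed.

(* A section of degree [0] that is nonzero at a point is invertible near it, so
   both sides are the only [t] for which [f - t] is not invertible. *)
Lemma wbody_tau V (f : sec C V) y : V `<=` U -> V y -> wbody (tau f y) = fn f y.
Proof.
move=> VU Vy.
have [V1 [h1 [d [V1y fE]]]] := gr_sum f Vy.
have V1U : V1 `<=` U by exact: subset_trans VU.
rewrite -(triv_res T h1)// (wbody_tau_sum _ V1y fE)// -(fn_res h1)// -fn_gr0//.
move: (gr C 0 V1 _) (homogeneous_gr 0 (res C h1 f)) => {fE h1 VU Vy f} g g0.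
pose h := g - Defs.cst C V1 (fn g y).
have h0 : homogeneous 0 h by apply: homogeneousD => //; apply: homogeneousN; exact: homogeneous_cst.
have fnh : fn h y = 0 by rewrite fn_add// fnN// fn_cst// subrr.
have tauh z : V1 z -> tau h z = tau g z - wC (fn g y).
  by move=> V1z; rewrite tau_add// tau_opp// tau_cst.
apply/eqP; rewrite -subr_eq0; apply/negP => /negP nz.
have wbC a : wbody (wC a : walg R m1 m2) = a.
  by rewrite /wbody wCE wcf_wb eqxx mpoly.mcoeffC eqxx mulr1.
have {}nz : wbody (tau h y) != 0 by rewrite tauh// raddfB /= wbC.
have sm : smooth_fun V1 (fun z => wbody (tau h z)).
  by have [+ _] := triv_section T h V1U; apply.
have [V2 [V2V1 V2y nzV]] := smooth_fun_nonzero sm V1y nz.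
have V2U : V2 `<=` U by exact: subset_trans V1U.
pose s z : walg R m1 m2 := wC (wbody (tau h z))^-1.
have sE A a z : mpoly.mcoeff a (s z A) =
    if (A == finset.set0) && (a == @mpoly.mnm0 m2) then (wbody (tau h z))^-1 else 0.
  rewrite -[LHS]/(wcf A a (s z)) /s wCE wcf_wb; case: eqP => //= _.
  by rewrite mpoly.mcoeffC; case: eqP; rewrite ?mulr1 ?mulr0.
have [k kE] : exists k : sec C V2, forall z, V2 z -> tau k z = s z.
  apply: (triv_surj T) => //; split=> [A a|z V2z].
    have [aA|aA] := boolP ((A == finset.set0) && (a == @mpoly.mnm0 m2)).
      apply: smooth_fun_ext (smooth_funV nzV (smooth_fun_sub V2V1 sm)) => z _.
      by rewrite sE aA.
    by apply: smooth_fun_ext (smooth_fun_cst _ 0) => z _; rewrite sE (negbTE aA).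
  exists V2, 0%N; split => // u _ _ A a a0; rewrite sE andbC.
  by case: eqP a0 => // ->; rewrite mpoly.mdeg0.
have : res C V2V1 h * k = 1.
  apply: (triv_inj T) => // z V2z; have V1z := V2V1 _ V2z.
  rewrite tau_mul// (triv_res T)// tau1// kE// /s.
  have /wdecomp0 -> : whomogeneous 0 (tau h z) by exact: (triv_homogeneous T).
  by rewrite wbC -rmorphM mulfV ?rmorph1//; exact: nzV.
move=> /(congr1 (fun u => fn u y)); rewrite fn_mul// fn_res// fnh mul0r fn1//.
by move/esym/eqP; rewrite oner_eq0.
Qed.

Lemma tau_homogeneous0 V (f : sec C V) y : V `<=` U -> V y -> homogeneous 0 f ->
  tau f y = wC (fn f y).
Proof.
by move=> VU Vy f0; rewrite -wbody_tau// -wdecomp0//; exact: (triv_homogeneous T).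
Qed.

(** A converse to [triv_homogeneous]. Locally [f] is a finite sum of homogeneous parts, and those of
    degree other than [k] contribute nothing to the coefficients of degree [k]; hence [f] and its
    part of degree [k] have the same image. *)
Lemma homogeneous_tau k V (f : sec C V) : V `<=` U ->
  (forall y, V y -> whomogeneous k (tau f y)) -> homogeneous k f.
Proof.
move=> VU fk; apply: homogeneous_local => x Vx.
have [V1 [h1 [d [V1x fE]]]] := gr_sum f Vx; exists V1, h1; split => //.
have V1U : V1 `<=` U by exact: subset_trans VU.
have {}fk y : V1 y -> whomogeneous k (tau (res C h1 f) y).
  by move=> V1y; rewrite (triv_res T)//; apply: fk; exact: (h1 y).
move: (res C h1 f) fE fk => g gE gk; apply: (triv_inj T) => // y V1y.
have gj j : whomogeneous j (tau (gr C j V1 g) y).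
  by apply: (triv_homogeneous T) => //; exact: homogeneous_gr.
apply: homogeneous_ext (gj k) (gk y V1y) _ => A m Am.
have wj (j : nat) : j <> k -> wcf A m (tau (gr C j V1 g) y) = 0.
  by move=> jk; apply: (whomogeneous_wcf (gj j)); rewrite Am; exact/nesym.
have gkE : gr C k V1 g = \sum_(j < d) gr C k V1 (gr C j V1 g) by rewrite {1}gE raddf_sum.
rewrite gkE {2}gE !tau_sum// !raddf_sum; apply: eq_bigr => j _ /=.
by rewrite gr_gr; case: eqP => [<-//|kj]; rewrite wj ?tau0 ?raddf0//; exact/nesym.
Qed.

End Triv.
End Body.

(** * Compatibility of the pullback with the map of bodies *)

Section Morphism.
Context {R : realType} {m0 m1 m2 n0 n1 n2 : nat}
  (M : Nmanifold R m0 m1 m2) (N : Nmanifold R n0 n1 n2) (Psi : Nmorphism M N).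

Lemma bmap_pre_sub (V V' : opens N) : V' `<=` V -> bmap_pre Psi V' `<=` bmap_pre Psi V.
Proof. by move=> h x; exact: h. Qed.

(** Let $g$ have degree 0 and let $t$ be the value of $\psi^\sharp g$ at $y$. If $g$ took another
    value at $\psi(y)$, then $g-t$ would be invertible near $\psi(y)$, and so would its pullback
    near $y$, where it vanishes. *)
Lemma fn_sharp (V : opens N) (f : sec (sheaf N) V) y : V (Psi y) ->
  fn (sharp Psi V f) y = fn f (Psi y).
Proof.
move=> Vy; have [V1 [h1 [d [V1y fE]]]] := gr_sum f Vy.
have py : bmap_pre Psi V y by [].
have p1y : bmap_pre Psi V1 y by [].
have h1' := bmap_pre_sub h1.
rewrite -(fn_res h1')// -(sharp_res (n := Psi) h1 h1') -[RHS](fn_res h1)//.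
move: (res _ h1 f) fE => g gE.
have -> : fn (sharp Psi V1 g) y = fn (sharp Psi V1 (gr (sheaf N) 0 V1 g)) y.
  have H (k : nat) : fn (sharp Psi V1 (gr (sheaf N) k V1 g)) y =
      if k == 0 then fn (sharp Psi V1 (gr (sheaf N) 0 V1 g)) y else 0.
    case: (k =P 0%N) => [->//|k0].
    by apply: fn_homogeneous k0 _ => //; apply: sharp_homogeneous; exact: homogeneous_gr.
  rewrite {1}gE raddf_sum fn_sum//=; under eq_bigr do rewrite H.
  case: d gE => [|d] gE; last first.
    rewrite (bigD1 ord0)//= big1 ?addr0// => i /negbTE i0.
    by rewrite -[_ == 0]/(i == ord0) i0.
  by rewrite big_ord0 gE big_ord0 !raddf0 fn0.
rewrite -[RHS]fn_gr0//.
move: (gr _ 0 V1 g) (homogeneous_gr 0 g) => {}g g0 {gE}.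
pose t := fn (sharp Psi V1 g) y.
pose h := g - Defs.cst (sheaf N) V1 t.
have h0 : homogeneous 0 h by apply: homogeneousD => //; apply: homogeneousN; exact: homogeneous_cst.
have fnh : fn h (Psi y) = fn g (Psi y) - t by rewrite fn_add// fnN// fn_cst.
have fsh : fn (sharp Psi V1 h) y = 0.
  by rewrite raddfB fn_add// fnN//= sharp_cst fn_cst// subrr.
apply/eqP; rewrite eq_sym -subr_eq0 -fnh; apply/negP => /negP nz.
have [V2 [h2 [k [V2y hk]]]] := local_inverse h0 V1y nz.
have := congr1 (fun u => fn (sharp Psi V2 u) y) hk.
rewrite rmorphM rmorph1 fn_mul//= fn1//.
rewrite (sharp_res (n := Psi) h2 (bmap_pre_sub h2)) fn_res// fsh mul0r.
by move/esym/eqP; rewrite oner_eq0.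
Qed.

End Morphism.

(** * Tangent vectors *)

Section TangentVectors.
Context {R : realType} {m0 m1 m2 : nat} (M : Nmanifold R m0 m1 m2).
Local Notation C := (sheaf M).
Implicit Types (U V : opens M) (x y : M) (X : stalk_map M).

Lemma tangent_res x X U V (h : V `<=` U) (f : sec C U) : tangent x X -> V x ->
  X V (res C h f) = X U f.
Proof.
move=> [r [k [Y [YT XE]]]] Vx; rewrite !XE//; last exact: h.
by apply: eq_bigr => i _; have [[+ _] _ _] := YT i; apply.
Qed.

Lemma tangent_cstMD x X U a (f g : sec C U) : tangent x X -> U x ->
  X U (Defs.cst C U a * f + g) = a * X U f + X U g.
Proof.
move=> [r [k [Y [YT XE]]]] Ux; rewrite !XE// mulr_sumr -big_split.
by apply: eq_bigr => i _; have [[_ +] _ _] := YT i; apply.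
Qed.

Lemma tangentD x X U (f g : sec C U) : tangent x X -> U x ->
  X U (f + g) = X U f + X U g.
Proof. by move=> XT Ux; have := tangent_cstMD 1 f g XT Ux; rewrite rmorph1 !mul1r. Qed.

Lemma tangent0 x X U : tangent x X -> U x -> X U (0 : sec C U) = 0.
Proof. by move=> XT Ux; apply: (addrI (X U 0)); rewrite -(tangentD _ _ XT)// !addr0. Qed.

Lemma tangentZ x X U a (f : sec C U) : tangent x X -> U x ->
  X U (Defs.cst C U a * f) = a * X U f.
Proof. by move=> XT Ux; rewrite -[_ * f]addr0 (tangent_cstMD _ _ _ XT)// (tangent0 XT)// addr0. Qed.

Lemma tangentN x X U (f : sec C U) : tangent x X -> U x -> X U (- f) = - X U f.
Proof. by move=> XT Ux; apply: (addrI (X U f)); rewrite -(tangentD _ _ XT)// !subrr (tangent0 XT). Qed.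

Lemma tangent_sum x X U I (r : seq I) (P : pred I) (F : I -> sec C U) :
  tangent x X -> U x -> X U (\sum_(i <- r | P i) F i) = \sum_(i <- r | P i) X U (F i).
Proof.
move=> XT Ux; elim/big_rec2: _ => [|i a b _ <-]; first exact: tangent0 XT Ux.
by rewrite (tangentD _ _ XT).
Qed.

(* Unless [f] has degree [0], [fn f x = 0] and the sign of the Leibniz rule is
   irrelevant. *)
Lemma tangent_leibniz x X U d (f g : sec C U) : tangent x X -> U x -> homogeneous d f ->
  X U (f * g) = X U f * fn g x + fn f x * X U g.
Proof.
move=> [r [k [Y [YT XE]]]] Ux fd; rewrite !XE// mulr_sumr mulr_suml -big_split.
apply: eq_bigr => i _; have [_ _ H] := YT i; rewrite (H _ _ _ _ Ux fd).
congr (_ + _); have [d0|d0] := eqVneq d 0%N; first by rewrite d0 muln0 expr0 mul1r.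
by rewrite (fn_homogeneous fd)//; [rewrite mulr0|exact/eqP].
Qed.

Lemma tangent_cst x X U a : tangent x X -> U x -> X U (Defs.cst C U a) = 0.
Proof.
move=> XT Ux; rewrite -[Defs.cst C U a]mulr1 (tangentZ _ _ XT)//.
have := tangent_leibniz 1 XT Ux (homogeneous1 C U).
rewrite mulr1 fn1// mulr1 mul1r => H.
have -> : X U 1 = 0 by apply: (addrI (X U 1)); rewrite -H addr0.
by rewrite mulr0.
Qed.

Lemma chart_ball_open (U0 : opens M) (phi : M -> 'rV[R]_m0) (A : opens M) a r :
  open_embedding U0 phi -> A `<=` U0 -> open [set z | A z /\ ball a r (phi z)].
Proof.
move=> [cphi _ _] AU; rewrite openE => z [Az bz].
have nA : \forall y \near z, A y by apply: open_nbhs_nbhs; split => //; exact: open_oset.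
have nB : \forall y \near z, ball a r (phi y).
  have H : phi @ z --> phi z by exact: cphi (AU _ Az).
  exact: (H _ (open_near (@rV_ball_open _ _ a r) bz)).
by apply: filterS2 nA nB.
Qed.

Lemma hadamard_chart (U0 U : opens M) (phi : M -> 'rV[R]_m0) f x k :
  is_chart U0 phi -> U `<=` U0 -> smooth_fun U f -> U x -> (k <= m0)%N ->
  exists (V : opens M) (g : 'I_m0 -> 'rV[R]_m0 -> R),
    [/\ V `<=` U, V x, forall l, Cinf (phi @` V) (g l)
      & forall z, V z -> exists2 z', U z' /\ phi z' = reset_coords k (phi x) (phi z)
          & f z = f z' + \sum_(l < m0 | (l < k)%N) (phi z 0 l - phi x 0 l) * g l (phi z)].
Proof.
move=> ch UU0 fU Ux km; have [oe _] := ch; have [_ inj _] := oe.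
have [G GU GE] := chart_smooth_via ch UU0 fU.
have oU : open (phi @` U) := open_embedding_open oe UU0.
have [r r0 rU] : exists2 r : R, 0 < r & ball (phi x) r `<=` phi @` U.
  have /nbhs_ballP[r r0 rU] : \forall y \near phi x, (phi @` U) y.
    by apply: open_near => //; exists x.
  by exists r.
have [g gB gE] := hadamard km (Cinf_sub rU GU).
exists (Opens (chart_ball_open (phi x) r oe UU0)), g; split=> [z []//|||z [/= Uz bz]].
- by split => //; exact: ballxx.
- by move=> l; apply: Cinf_sub (gB l) => _ [z [_ bz] <-].
- have [z' Uz' ez] := rU _ (reset_ball k bz).
  by exists z' => //; rewrite !GE// ez gE.
Qed.

(** Hadamard's lemma expands $f$ near [x] as $f(x)+\sum_l(x^l-x^l(x))\,g_l$. A derivation at [x]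
    kills the constant and turns each product into $g_l(x)X(x^l)$. *)
Lemma tangent_chain x X (U0 U : opens M) (phi : M -> 'rV[R]_m0) (xs : 'I_m0 -> sec C U)
    (f : sec C U) G : tangent x X -> is_chart U0 phi -> U `<=` U0 -> U x ->
  (forall l, homogeneous 0 (xs l) /\ forall y, U y -> fn (xs l) y = phi y 0 l) ->
  homogeneous 0 f -> Cinf (phi @` U) G -> (forall z, U z -> fn f z = G (phi z)) ->
  X U f = \sum_l 'D_(delta_mx 0 l) G (phi x) * X U (xs l).
Proof.
move=> XT ch UU0 Ux xsE f0 GU GE; have [oe _] := ch; have [_ inj _] := oe.
have [V [g [VU Vx gV gE]]] := hadamard_chart ch UU0 (fn_smooth f) Ux (leqnn m0).
have VU0 : V `<=` U0 by exact: subset_trans UU0.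
have oV : open (phi @` V) := open_embedding_open oe VU0.
have fE z : V z -> fn f z = fn f x + \sum_l (phi z 0 l - phi x 0 l) * g l (phi z).
  move=> Vz; have [z' [Uz' ez] ->] := gE z Vz; congr (_ + _).
    congr (fn f _); apply: inj; [exact: UU0|exact: UU0|].
    by rewrite ez; apply/rowP => j; rewrite mxE ltn_ord.
  by apply: eq_bigl => l; rewrite ltn_ord.
(* The derivative of the expansion at [phi x] leaves only [g l], since the first factor of each
   product vanishes there. *)
have dG l : 'D_(delta_mx 0 l) G (phi x) = g l (phi x).
  have oVx : (phi @` V) (phi x) by exists x.
  pose H := (fun _ : 'rV[R]_m0 => fn f x) +
    (\sum_k (fun u : 'rV[R]_m0 => u 0 k - phi x 0 k) * g k).
  have nH : \forall u \near phi x, G u = H u.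
    have : \forall u \near phi x, (phi @` V) u by exact: open_near.
    apply: filterS => _ [z Vz <-]; rewrite -GE; last exact: VU.
    rewrite fE// /H fctE; congr (_ + _); rewrite fct_sumE.
    by apply: eq_bigr.
  rewrite (near_eq_derive _ nH).
  have dk k : is_derive (phi x) (delta_mx 0 l : 'rV[R]_m0)
      ((fun u : 'rV[R]_m0 => u 0 k - phi x 0 k) * g k)
      ((k == l)%:R * g k (phi x)).
    have h1 : is_derive (phi x) (delta_mx 0 l : 'rV[R]_m0)
        (fun u : 'rV[R]_m0 => u 0 k - phi x 0 k) (k == l)%:R.
      have := is_deriveB (is_derive_coord (phi x) (delta_mx 0 l) k)
        (is_derive_cst (phi x 0 k) (phi x) (delta_mx 0 l : 'rV[R]_m0)).
      by rewrite subr0 mxE eqxx.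
    have h2 : derivable (g k) (phi x) (delta_mx 0 l : 'rV[R]_m0).
      exact: Ck_derivable (gV k 1%N) oVx.
    have := is_deriveM h1 (derivableP h2).
    rewrite subrr scale0r add0r => H1.
    by rewrite [X in is_derive _ _ _ X]mulrC.
  have := is_deriveD (is_derive_cst (fn f x) (phi x) (delta_mx 0 l : 'rV[R]_m0)) (is_derive_sum dk).
  move=> [_ ->]; rewrite add0r (bigD1 l)//= eqxx mul1r big1 ?addr0// => k /negbTE ->.
  by rewrite mul0r.
have [gs gsP] := choice (fun l => let: ex_intro2 s p q :=
    fn_surj (chart_smooth_fun ch VU0 (gV l)) in
  ex_intro (fun s : sec C V => homogeneous 0 s /\ forall z, V z -> fn s z = g l (phi z)) s (conj p q)).
pose dx l := res C VU (xs l) - Defs.cst C V (phi x 0 l).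
have dx0 l : homogeneous 0 (dx l).
  apply: homogeneousD; first by apply: homogeneous_res; have [] := xsE l.
  by apply: homogeneousN; exact: homogeneous_cst.
have fn_dx l z : V z -> fn (dx l) z = phi z 0 l - phi x 0 l.
  move=> Vz; rewrite fn_add// fnN// fn_cst// fn_res//.
  by have [_ ->//] := xsE l; exact: (VU z).
have fs : res C VU f = Defs.cst C V (fn f x) + \sum_l dx l * gs l.
  apply: fn_inj; first exact: homogeneous_res.
    apply: homogeneousD; first exact: homogeneous_cst.
    apply: homogeneous_sum => l _; apply: (homogeneousM (dx0 l)).
    by have [] := gsP l.
  move=> z Vz; rewrite fn_res// fE// fn_add// fn_cst// fn_sum//; congr (_ + _).
  apply: eq_bigr => l _; rewrite fn_mul// fn_dx//.
  by have [_ ->] := gsP l.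
rewrite -(tangent_res VU f XT Vx) fs (tangentD _ _ XT)// (tangent_cst _ XT)// add0r.
rewrite (tangent_sum _ _ _ XT)//; apply: eq_bigr => l _.
rewrite (tangent_leibniz _ XT Vx (dx0 l)) fn_dx// subrr mul0r addr0 dG mulrC.
have [_ ->//] := gsP l; congr (_ * _).
rewrite /dx (tangentD _ _ XT)// (tangentN _ XT)// (tangent_cst _ XT)// subr0.
exact: (tangent_res _ _ XT).
Qed.

End TangentVectors.

(** * The coordinate vectors of degrees 0, -1 and -2 *)

Section CoordinateVectors.
Context {R : realType} {m0 m1 m2 : nat} (M : Nmanifold R m0 m1 m2).
Local Notation C := (sheaf M).
Implicit Types (U V : opens M) (x y : M).

Lemma tangent_of_homogeneous x k (Y : stalk_map M) : homogeneous_tangent x k Y -> tangent x Y.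
Proof.
move=> YT; exists 1%N, (fun=> k), (fun=> Y); split => // U f Ux.
by rewrite big_ord_recl big_ord0 addr0.
Qed.

Section Base.
Variables (U0 : opens M) (phi : M -> 'rV[R]_m0) (x : M) (j : 'I_m0).
Hypotheses (ch : is_chart U0 phi) (U0x : U0 x).

(** Going through [push] defines the derivative on every section without a choice of representative;
    by [ddxE] any local representative gives the same value. *)
Definition ddx : stalk_map M := fun U f =>
  'D_(delta_mx 0 j) (push phi (opensI U U0) (fn f)) (phi x).

Lemma ddxE U (f : sec C U) G (W : opens M) : W `<=` opensI U U0 -> W x ->
  (forall z, W z -> fn f z = G (phi z)) -> ddx f = 'D_(delta_mx 0 j) G (phi x).
Proof.
move=> WU Wx fE; have [oe _] := ch; have [_ inj _] := oe.
apply: near_eq_derive.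
have oW : open (phi @` W) by apply: (open_embedding_open oe) => z /WU[].
have : \forall u \near phi x, (phi @` W) u by apply: open_near => //; exists x.
apply: filterS => _ [z Wz <-]; rewrite pushE; first exact: fE.
  by move=> y y' [_ ?] [_ ?]; exact: inj.
exact: WU.
Qed.

Lemma ddx_homogeneous : homogeneous_tangent x 0 ddx.
Proof.
have [oe _] := ch.
have rep U (f : sec C U) : U x -> exists2 G, Cinf (phi @` opensI U U0) G &
    forall z, opensI U U0 z -> fn f z = G (phi z).
  move=> Ux; apply: (chart_smooth_via ch); first exact: opensIr.
  by apply: smooth_fun_sub (fn_smooth f); exact: opensIl.
have dG U G : U x -> Cinf (phi @` opensI U U0) G -> derivable G (phi x) (delta_mx 0 j : 'rV[R]_m0).
  by move=> Ux GU; apply: Ck_derivable (GU 1%N) _; exists x.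
split; first split.
- move=> U V VU f Vx; have Ux := VU _ Vx; have [G GU GE] := rep U f Ux.
  rewrite (ddxE (G := G) (W := opensI V U0) (f := f))//; last first.
  + by move=> z [/VU ? ?]; exact: GE.
  + by move=> z [/VU ? ?].
  rewrite (ddxE (G := G) (W := opensI V U0))//.
  by move=> z [Vz U0z]; rewrite fn_res// GE//; split => //; exact: VU.
- move=> U a f g Ux; have [G GU GE] := rep U f Ux; have [H HU HE] := rep U g Ux.
  rewrite (ddxE (G := G) (W := opensI U U0) (f := f))//.
  rewrite (ddxE (G := H) (W := opensI U U0) (f := g))//.
  rewrite (ddxE (G := (a \*: G) + H) (W := opensI U U0))//.
    rewrite deriveD; [|exact/derivableZ/(dG U)|exact: (dG U)].
    by rewrite deriveZ; last exact: (dG U).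
  move=> z Uz; have [Uz' _] := Uz; rewrite fn_add// fn_mul// fn_cst// GE// HE//.
- move=> U d f Ux fd; rewrite addr0 => d0.
  rewrite (ddxE (G := fun=> 0) (W := opensI U U0))//; first exact: derive_cst.
  by move=> z [Uz _]; apply: (fn_homogeneous fd) => //; move=> d00; rewrite d00 in d0.
- move=> U d f g Ux fd; rewrite /= mul0n expr0 mul1r.
  have [G GU GE] := rep U f Ux; have [H HU HE] := rep U g Ux.
  rewrite (ddxE (G := G) (W := opensI U U0) (f := f))//.
  rewrite (ddxE (G := H) (W := opensI U U0) (f := g))//.
  rewrite (ddxE (G := G * H) (W := opensI U U0))//.
    rewrite deriveM; [|exact: (dG U)|exact: (dG U)].
    by rewrite GE// HE// addrC mulrC.
  by move=> z Uz; have [Uz' _] := Uz; rewrite fn_mul// GE// HE.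
Qed.

End Base.

Section Fibre.
Variables (U0 : opens M) (tau : forall V : opens M, sec C V -> M -> walg R m1 m2) (x : M).
Hypotheses (T : trivialization U0 tau) (U0x : U0 x).
Variables (l : {additive walg R m1 m2 -> R}) (k : nat).
Hypotheses (lC : forall a v, l (wC a * v) = a * l v)
  (lM : forall u v, l (u * v) = l u * wbody v + wbody u * l v)
  (lk : forall d v, whomogeneous d v -> d <> k -> l v = 0).

(** One construction for $\partial/\partial e^\mu$ and $\partial/\partial p^I$: a linear functional
    [l] on the model that is a derivation over [wbody] and lives in degree [k] gives a tangent
    vector of degree $-k$. *)
Definition ddfibre : stalk_map M := fun U f =>
  l (tau (res C (@opensIl _ U U0) f) x).

Lemma ddfibreE U V (h : V `<=` U) (f : sec C U) : V `<=` U0 -> V x ->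
  ddfibre f = l (tau (res C h f) x).
Proof.
move=> VU0 Vx; have hI : V `<=` opensI U U0 by move=> z Vz; split; [exact: h|exact: VU0].
congr (l _); rewrite -(triv_res T hI)//; last exact: opensIr.
by rewrite (res_res (@opensIl _ U U0) hI h).
Qed.

Lemma ddfibre_homogeneous : homogeneous_tangent x (- k%:Z) ddfibre.
Proof.
have IU U : opensI U U0 `<=` U0 by exact: opensIr.
have wbE U (f : sec C U) : U x -> wbody (tau (res C (@opensIl _ U U0) f) x) = fn f x.
  by move=> Ux; rewrite (wbody_tau T)// fn_res.
split; first split.
- move=> U V VU f Vx; have Ux := VU _ Vx.
  have h : opensI V U0 `<=` U by move=> z [/VU].
  rewrite (ddfibreE h f)// {1}/ddfibre.
  by rewrite (res_res VU (@opensIl _ V U0) h).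
- move=> U a f g Ux; rewrite /ddfibre rmorphD rmorphM /= res_cst.
  by rewrite (tau_add T)// (tau_mul T)// (tau_cst T)// raddfD /= lC.
- move=> U d f Ux fd dk; apply: (lk (d := d)).
    by apply: (triv_homogeneous T) => //; exact: homogeneous_res.
  by move=> dk'; move: dk; rewrite dk' subrr eqxx.
- move=> U d f g Ux fd; rewrite /ddfibre rmorphM /= (tau_mul T)// lM !wbE//.
  congr (_ + _); have [d0|d0] := eqVneq d 0%N; first by rewrite d0 muln0 expr0 mul1r.
  by rewrite (fn_homogeneous fd)//; [rewrite mulr0|exact/eqP].
Qed.

End Fibre.
End CoordinateVectors.

Section ModelSections.
Context {R : realType} {m0 m1 m2 : nat} (M : Nmanifold R m0 m1 m2).
Local Notation W := (walg R m1 m2).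
Implicit Types (U V : opens M).

Lemma model_section_ext V (s t : M -> W) : (forall y, V y -> s y = t y) ->
  model_section V s -> model_section V t.
Proof.
move=> st [s1 s2]; split=> [A a|x Vx].
  by apply: smooth_fun_ext (s1 A a) => y Vy; rewrite st.
have [V' [d [V'x H]]] := s2 x Vx; exists V', d; split => // y V'y Vy A a da.
by rewrite -st//; exact: H da.
Qed.

Lemma model_section_const V (v : W) : model_section V (fun=> v).
Proof.
split=> [A a|x Vx]; first exact: smooth_fun_cst.
exists V, (\max_(A : {set 'I_m1}) mpoly.msize (v A))%N; split => // y _ _ A a da.
apply/eqP; rewrite mpoly.mcoeff_eq0; apply/negP => /mpoly.msize_mdeg_lt.
by rewrite ltnNge (leq_trans _ (ltnW da))//; exact: (leq_bigmax A).
Qed.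

Lemma model_section_sub U V (s : M -> W) : V `<=` U -> model_section U s -> model_section V s.
Proof.
move=> VU [s1 s2]; split=> [A a|x Vx]; first exact: smooth_fun_sub (s1 A a).
have [V' [d [V'x H]]] := s2 x (VU _ Vx); exists V', d; split => // y V'y Vy A a da.
by apply: H da => //; exact: VU.
Qed.

End ModelSections.

(** * Right inverses of the Jacobian matrices at a regular point *)

Section RegularPoint.
Context {R : realType} {m0 m1 m2 n0 n1 n2 : nat}
  (M : Nmanifold R m0 m1 m2) (N : Nmanifold R n0 n1 n2) (Psi : Nmorphism M N).
Variable x : M.
Hypothesis reg : forall Y : stalk_map N, tangent (Psi x) Y ->
  exists2 X : stalk_map M, tangent x X &
    forall (V : opens N) (f : sec (sheaf N) V), V (Psi x) -> tangent_map Psi X f = Y V f.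
Variables (U : opens M) (V0 : opens N) (hU : U `<=` bmap_pre Psi V0) (Ux : U x).

Definition pullsec (f : sec (sheaf N) V0) : sec (sheaf M) U := res (sheaf M) hU (sharp Psi V0 f).

Lemma fn_pullsec f z : U z -> fn (pullsec f) z = fn f (Psi z).
Proof. by move=> Uz; rewrite fn_res// fn_sharp//; exact: hU. Qed.

Lemma homogeneous_pullsec k f : homogeneous k f -> homogeneous k (pullsec f).
Proof. by move=> fk; apply: homogeneous_res; exact: sharp_homogeneous. Qed.

Lemma regular_vector Y : tangent (Psi x) Y -> exists2 X : stalk_map M, tangent x X &
  forall f, X U (pullsec f) = Y V0 f.
Proof.
move=> /reg[X XT XE]; exists X => // f; rewrite (tangent_res _ _ XT)// -XE//.
exact: hU.
Qed.

(** Let $X_j$ be mapped to $\partial/\partial y^j$. Then $\delta_{ij}=X_j(\psi^\sharp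
    y^i)=\sum_l\partial_lF_i\,X_j(x^l)$, so the numbers $X_j(x^l)$ form a right inverse. The
    translation [b] admits coordinates centred at [c]. *)
Lemma regular_body (phiN : N -> 'rV[R]_n0) (U0 : opens M) (phi : M -> 'rV[R]_m0)
    (ys : 'I_n0 -> sec (sheaf N) V0) (F : 'I_n0 -> 'rV[R]_m0 -> R) :
  is_chart V0 phiN -> is_chart U0 phi -> U `<=` U0 ->
  (forall i, homogeneous 0 (ys i)) ->
  (exists b : 'rV[R]_n0, forall i y, V0 y -> fn (ys i) y = phiN y 0 i + b 0 i) ->
  (forall i, Cinf (phi @` U) (F i)) ->
  (forall i z, U z -> fn (ys i) (Psi z) = F i (phi z)) ->
  exists a : 'M[R]_(m0, n0),
    (\matrix_(i, l) 'D_(delta_mx 0 l) (F i) (phi x)) *m a = 1%:M.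
Proof.
move=> chN chM UU0 ys0 [b ysE] FU FE.
have V0x : V0 (Psi x) by exact: hU.
have Yd (j : 'I_n0) := tangent_of_homogeneous (ddx_homogeneous j chN V0x).
have [X XP] := choice (fun j => let: ex_intro2 s p q := regular_vector (Yd j) in
  ex_intro (fun X => tangent x X /\ forall f, X U (pullsec f) = ddx V0 phiN (Psi x) j f) s (conj p q)).
have [xs xsP] := choice (fun l => let: ex_intro2 s p q :=
    fn_surj (smooth_fun_sub UU0 (chart_coord_smooth l chM)) in
  ex_intro (fun s : sec (sheaf M) U => homogeneous 0 s /\ forall z, U z -> fn s z = phi z 0 l) s (conj p q)).
exists (\matrix_(l, j) X j U (xs l)); apply/matrixP => i j.
have [XT XE] := XP j.
have fE z : U z -> fn (pullsec (ys i)) z = F i (phi z) by move=> Uz; rewrite fn_pullsec// FE.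
have := tangent_chain XT chM UU0 Ux xsP (homogeneous_pullsec (ys0 i)) (FU i) fE.
rewrite XE (ddxE (G := fun u => u 0 i + b 0 i) j chN (W := V0))//; last first.
  by move=> z V0z; exact: ysE.
have [_ ->] := is_deriveD (is_derive_coord (phiN (Psi x)) (delta_mx 0 j) i)
  (is_derive_cst (b 0 i) (phiN (Psi x)) (delta_mx 0 j : 'rV[R]_n0)).
rewrite addr0 !mxE eqxx /= => ->; apply: eq_bigr => l _.
by rewrite !mxE.
Qed.

Section FibreDirections.
Variables (tauN : forall V : opens N, sec (sheaf N) V -> N -> walg R n1 n2)
  (U0 : opens M) (tau : forall V : opens M, sec (sheaf M) V -> M -> walg R m1 m2).
Hypotheses (TN : trivialization V0 tauN) (TM : trivialization U0 tau) (UU0 : U `<=` U0).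

Let V0x : V0 (Psi x). Proof. exact: hU. Qed.

Lemma section_of_tau v : exists f : sec (sheaf M) U, forall y, U y -> tau f y = v.
Proof. by apply: (triv_surj TM UU0); exact: model_section_const. Qed.

Lemma section_of_coef (f : sec (sheaf M) U) A a : exists g : sec (sheaf M) U,
  homogeneous 0 g /\ forall y, U y -> fn g y = wcf A a (tau f y).
Proof.
have [sm _] := triv_section TM f UU0.
by have [g g0 gE] := fn_surj (sm A a); exists g.
Qed.

(** A section of degree 1 is $\sum_l g_le^l$ with functions $g_l$. As $e^l$ has value 0 at [x], a
    tangent vector takes the value $g_l(x)X(e^l)$ on each term, and the numbers $X_j(e^l)$ form the
    right inverse. *)
Lemma regular_odd (es : 'I_n1 -> sec (sheaf N) V0) :
  (forall nu, homogeneous 1 (es nu)) ->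
  (forall nu y, V0 y -> tauN (es nu) y = wgen1 nu) ->
  exists a : 'M[R]_(m1, n1),
    (\matrix_(nu, l) wcf (finset.set1 l) mpoly.mnm0 (tau (pullsec (es nu)) x)) *m a = 1%:M.
Proof.
move=> es1 esE.
have Yd (mu : 'I_n1) : tangent (Psi x) (ddfibre V0 tauN (Psi x) (wcf (finset.set1 mu) mpoly.mnm0)).
  apply: tangent_of_homogeneous; apply: (ddfibre_homogeneous TN V0x (k := 1)).
  - by move=> a v; exact: wcfC.
  - by move=> u v; exact: wcf_set1M.
  - move=> d v vd d1; apply: (whomogeneous_wcf vd).
    by rewrite cards1 mpoly.mdeg0; exact/nesym.
have [X XP] := choice (fun j => let: ex_intro2 s p q := regular_vector (Yd j) in
  ex_intro (fun X => tangent x X /\ forall f, X U (pullsec f) =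
    ddfibre V0 tauN (Psi x) (wcf (finset.set1 j) mpoly.mnm0) f) s (conj p q)).
have [e eE] := choice (fun l : 'I_m1 => section_of_tau (wgen1 l)).
exists (\matrix_(l, j) X j U (e l)); apply/matrixP => i j.
have [XT XE] := XP j.
have [g gP] := choice (fun l => section_of_coef (pullsec (es i)) (finset.set1 l) mpoly.mnm0).
have fE : pullsec (es i) = \sum_l g l * e l.
  apply: (triv_inj TM UU0) => y Uy.
  have h1 : whomogeneous 1 (tau (pullsec (es i)) y).
    by apply: (triv_homogeneous TM UU0 Uy); exact: homogeneous_pullsec.
  rewrite [LHS](wdecomp1 h1) (tau_sum TM)//; apply: eq_bigr => l _.
  have [gl0 glE] := gP l.
  by rewrite (tau_mul TM)// (tau_homogeneous0 TM UU0 Uy gl0) glE// eE.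
have := XE (es i); rewrite fE (tangent_sum _ _ _ XT)//.
rewrite (ddfibreE TN _ (@subset_refl _ V0))// res_id esE//= wcf_gen1 eqxx andbT => H.
rewrite !mxE -(_ : (finset.set1 j == finset.set1 i)%:R = (i == j)%:R); last first.
  congr (nat_of_bool _)%:R; apply/eqP/eqP => [/finset.set1_inj->//|->//].
rewrite -H; apply: eq_bigr => l _; have [gl0 glE] := gP l.
rewrite !mxE (tangent_leibniz _ XT Ux gl0) glE//.
by rewrite -[fn (e l) x](wbody_tau TM)// eE// (wbody_homogeneous (k := 1)) ?mulr0 ?add0r//;
  exact: whomogeneous_wgen1.
Qed.

Lemma regular_even (ps : 'I_n2 -> sec (sheaf N) V0) :
  (forall i, homogeneous 2 (ps i)) ->
  (forall i y, V0 y -> tauN (ps i) y = wgen2 i) ->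
  exists a : 'M[R]_(m2, n2),
    (\matrix_(i, l) wcf finset.set0 (mpoly.mnm1 l) (tau (pullsec (ps i)) x)) *m a = 1%:M.
Proof.
move=> ps2 psE.
have Yd (j : 'I_n2) : tangent (Psi x) (ddfibre V0 tauN (Psi x) (wcf finset.set0 (mpoly.mnm1 j))).
  apply: tangent_of_homogeneous; apply: (ddfibre_homogeneous TN V0x (k := 2)).
  - by move=> a v; exact: wcfC.
  - by move=> u v; exact: wcf_mnm1M.
  - move=> d v vd d1; apply: (whomogeneous_wcf vd).
    by rewrite cards0 mpoly.mdeg1; exact/nesym.
have [X XP] := choice (fun j => let: ex_intro2 s p q := regular_vector (Yd j) in
  ex_intro (fun X => tangent x X /\ forall f, X U (pullsec f) =
    ddfibre V0 tauN (Psi x) (wcf finset.set0 (mpoly.mnm1 j)) f) s (conj p q)).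
have [p pE] := choice (fun l : 'I_m2 => section_of_tau (wgen2 l)).
have [e eE] := choice (fun l : 'I_m1 => section_of_tau (wgen1 l)).
have e1 l : homogeneous 1 (e l).
  by apply: (homogeneous_tau TM UU0) => y Uy; rewrite eE//; exact: whomogeneous_wgen1.
have [b bE] := choice (fun A : {set 'I_m1} => section_of_tau (wb A 1)).
exists (\matrix_(l, j) X j U (p l)); apply/matrixP => i j.
have [XT XE] := XP j.
have [g gP] := choice (fun l => section_of_coef (pullsec (ps i)) finset.set0 (mpoly.mnm1 l)).
have [h hP] := choice (fun A => section_of_coef (pullsec (ps i)) A mpoly.mnm0).
have fE : pullsec (ps i) = \sum_l g l * p l + \sum_(A : {set 'I_m1} | #|A| == 2) h A * b A.
  apply: (triv_inj TM UU0) => y Uy.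
  have h1 : whomogeneous 2 (tau (pullsec (ps i)) y).
    by apply: (triv_homogeneous TM UU0 Uy); exact: homogeneous_pullsec.
  rewrite [LHS](wdecomp2 h1) (tau_add TM)// !(tau_sum TM)//; congr (_ + _); apply: eq_bigr => l _.
    have [gl0 glE] := gP l.
    by rewrite (tau_mul TM)// (tau_homogeneous0 TM UU0 Uy gl0) glE// pE.
  have [gl0 glE] := hP l.
  by rewrite (tau_mul TM)// (tau_homogeneous0 TM UU0 Uy gl0) glE// bE.
have fn_e l : fn (e l) x = 0 by exact: (fn_homogeneous (e1 l)).
(* Both factors of $e^se^t$ have value 0 at [x], so the Leibniz rule kills the product; of a section
   of degree 2 only the coefficients of the $p^l$ are seen. *)
have Xb (A : {set 'I_m1}) : #|A| == 2 -> X j U (b A) = 0.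
  move=> A2; have /cards2P[s [t [st AE]]] := A2.
  (* The elements [s] and [t] of [A] come in no particular order, hence the sign. *)
  have bAE : b A = Defs.cst (sheaf M) U ((-1) ^+ inversions (finset.set1 s) (finset.set1 t)) * (e s * e t).
    apply: (triv_inj TM UU0) => y Uy.
    rewrite bE// !(tau_mul TM)// (tau_cst TM)// !eE// !wgen1E wbM disjoints1 finset.inE st.
    rewrite /= !mulr1 -AE wCE wb0M; congr wb.
    rewrite (rmorph_sign (@mpoly.mpolyC m2 R)) /= -exprD addnn -signr_odd.
    by rewrite odd_double.
  rewrite bAE (tangentZ _ _ XT)// (tangent_leibniz _ XT Ux (e1 s)) !fn_e.
  by rewrite mulr0 mul0r addr0 mulr0.
have := XE (ps i); rewrite fE (tangentD _ _ XT)// !(tangent_sum _ _ _ XT)//.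
rewrite [X in _ + X]big1 ?addr0 => [|A A2]; last first.
  have [hA0 _] := hP A; rewrite (tangent_leibniz _ XT Ux hA0) Xb// mulr0 addr0.
  rewrite -[fn (b A) x](wbody_tau TM)// bE// (wbody_homogeneous (k := #|A|)) ?mulr0//.
    exact: whomogeneous_wb.
  by rewrite (eqP A2).
rewrite (ddfibreE TN _ (@subset_refl _ V0))// res_id psE//= wcf_gen2 eqxx /= => H.
rewrite !mxE -(_ : (mpoly.mnm1 j == mpoly.mnm1 i)%:R = (i == j)%:R); last first.
  by rewrite mpoly.eq_mnm1 eq_sym.
rewrite -H; apply: eq_bigr => l _; have [gl0 glE] := gP l.
rewrite !mxE (tangent_leibniz _ XT Ux gl0) glE//.
by rewrite -[fn (p l) x](wbody_tau TM)// pE// (wbody_homogeneous (k := 2)) ?mulr0 ?add0r//;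
  exact: whomogeneous_wgen2.
Qed.

End FibreDirections.
End RegularPoint.

(** * Change of local coordinates *)

Section SmoothMatrices.
Context {R : realType} {m : nat} (M : manifold R m).
Implicit Types (U : opens M).

Lemma smooth_fun_det n U (A : M -> 'M[R]_n) : (forall i j, smooth_fun U (fun y => A y i j)) ->
  smooth_fun U (fun y => \det (A y)).
Proof.
move=> sA; apply: smooth_fun_sum => s _; apply: smooth_funM; first exact: smooth_fun_cst.
by apply: smooth_fun_prod => i _.
Qed.

Lemma smooth_fun_invmx n U (A : M -> 'M[R]_n) : (forall y, U y -> A y \in unitmx) ->
  (forall i j, smooth_fun U (fun y => A y i j)) ->
  forall i j, smooth_fun U (fun y => invmx (A y) i j).
Proof.
move=> uA sA i j.
have dA y : U y -> \det (A y) != 0 by move=> /uA; rewrite unitmxE unitfE.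
have cof : smooth_fun U (fun y => cofactor (A y) j i).
  apply: smooth_funM; first exact: smooth_fun_cst.
  apply: smooth_fun_det => i' j'; apply: smooth_fun_ext (sA (lift j i') (lift i j')) => y _.
  by rewrite !mxE.
apply: smooth_fun_ext (smooth_funM (smooth_funV dA (smooth_fun_det sA)) cof) => y Uy.
by rewrite /invmx uA// !mxE.
Qed.

End SmoothMatrices.

(** * Operations on sections of the local model *)

Section ModelClosure.
Context {R : realType} {m0 m1 m2 : nat} (M : Nmanifold R m0 m1 m2).
Local Notation W := (walg R m1 m2).
Local Notation C := (sheaf M).
Implicit Types (V : opens M) (s t : M -> W).
Variables (U : opens M) (tau : forall V : opens M, sec C V -> M -> W).
Hypothesis T : trivialization U tau.

Lemma trivialization_sub (U' : opens M) : U' `<=` U -> trivialization U' tau.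
Proof.
move=> U'U; have UU V : V `<=` U' -> V `<=` U by move=> h; exact: subset_trans U'U.
split.
- by move=> V f /UU; exact: triv_section.
- by move=> V V' h f x /UU; exact: triv_res.
- by move=> V a x /UU; exact: (triv_cst T).
- by move=> V f g x /UU; exact: triv_add.
- by move=> V f g x /UU; exact: triv_mul.
- by move=> k V f x /UU; exact: triv_homogeneous.
- by move=> V f g /UU; exact: triv_inj.
- by move=> V s /UU; exact: (triv_surj T).
Qed.

(** Sections of the model are the images of sections of the structure sheaf, so closure under the
    ring operations is inherited instead of being checked on coefficients. *)
Lemma model_sectionP V s : V `<=` U ->
  model_section V s <-> exists f : sec C V, forall y, V y -> tau f y = s y.
Proof.
move=> VU; split=> [/(triv_surj T VU)//|[f fE]].
exact: model_section_ext fE (triv_section T f VU).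
Qed.

Lemma model_section_local V s :
  (forall x, V x -> exists2 V' : opens M, V' x & model_section V' s) -> model_section V s.
Proof.
move=> H; split=> [A a|x Vx].
  by apply: smooth_fun_local => x /H[V' V'x [s1 _]]; exists V'.
have [V' V'x [_ s2]] := H x Vx; have [V'' [d [V''x dP]]] := s2 x V'x.
exists (opensI V' V''), d; split => // y [V'y V''y] _ A a; exact: dP.
Qed.

Lemma model_sectionD V s t : V `<=` U -> model_section V s -> model_section V t ->
  model_section V (fun y => s y + t y).
Proof.
move=> VU /(model_sectionP _ VU)[f fE] /(model_sectionP _ VU)[g gE].
by apply/model_sectionP => //; exists (f + g) => y Vy; rewrite (tau_add T)// fE// gE.
Qed.

Lemma model_sectionN V s : V `<=` U -> model_section V s -> model_section V (fun y => - s y).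
Proof.
move=> VU /(model_sectionP _ VU)[f fE].
by apply/model_sectionP => //; exists (- f) => y Vy; rewrite (tau_opp T)// fE.
Qed.

Lemma model_sectionM V s t : V `<=` U -> model_section V s -> model_section V t ->
  model_section V (fun y => s y * t y).
Proof.
move=> VU /(model_sectionP _ VU)[f fE] /(model_sectionP _ VU)[g gE].
by apply/model_sectionP => //; exists (f * g) => y Vy; rewrite (tau_mul T)// fE// gE.
Qed.

Lemma model_section_sum V I (r : seq I) (P : pred I) (F : I -> M -> W) : V `<=` U ->
  (forall i, P i -> model_section V (F i)) ->
  model_section V (fun y => \sum_(i <- r | P i) F i y).
Proof.
move=> VU FV; elim: r => [|i r IHr].
  by apply: model_section_ext (model_section_const V 0) => y _; rewrite big_nil.
case Pi: (P i); last by apply: model_section_ext IHr => y _; rewrite big_cons Pi.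
apply: model_section_ext (model_sectionD VU (FV i Pi) IHr) => y _.
by rewrite big_cons Pi.
Qed.

Lemma model_section_prod V I (r : seq I) (P : pred I) (F : I -> M -> W) : V `<=` U ->
  (forall i, P i -> model_section V (F i)) ->
  model_section V (fun y => \prod_(i <- r | P i) F i y).
Proof.
move=> VU FV; elim: r => [|i r IHr].
  by apply: model_section_ext (model_section_const V 1) => y _; rewrite big_nil.
case Pi: (P i); last by apply: model_section_ext IHr => y _; rewrite big_cons Pi.
apply: model_section_ext (model_sectionM VU (FV i Pi) IHr) => y _.
by rewrite big_cons Pi.
Qed.

Lemma model_sectionX V s n : V `<=` U -> model_section V s ->
  model_section V (fun y => s y ^+ n).
Proof.
move=> VU sV; elim: n => [|n IHn]; first exact: model_section_const.
by apply: model_section_ext (model_sectionM VU sV IHn) => y _; rewrite exprS.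
Qed.

Lemma model_section_C V (g : M -> R) : V `<=` U -> smooth_fun V g ->
  model_section V (fun y => wC (g y) : W).
Proof.
move=> VU /fn_surj[f f0 fE]; apply/model_sectionP => //; exists f => y Vy.
by rewrite (tau_homogeneous0 T)// fE.
Qed.

(** The support of [s y] varies with the point, but its degree is locally bounded. Near each point
    the substitution is therefore a sum over a fixed finite set of monomials, with smooth
    coefficients. *)
Lemma model_section_wlift V (E : M -> 'I_m1 -> W) (P : M -> 'I_m2 -> W) s : V `<=` U ->
  (forall i, model_section V (E ^~ i)) -> (forall i, model_section V (P ^~ i)) ->
  model_section V s -> model_section V (fun y => wlift (E y) (P y) (s y)).
Proof.
move=> VU EV PV sV; apply: model_section_local => x Vx.
have [s1 s2] := sV; have [V' [d [V'x dP]]] := s2 x Vx.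
exists (opensI V V') => //.
have VV' : opensI V V' `<=` V by exact: opensIl.
have IU : opensI V V' `<=` U by exact: subset_trans VU.
apply: (@model_section_ext _ _ _ _ M _ (fun y => \sum_(A : {set 'I_m1})
   (\sum_(a : mpoly.bmultinom m2 d.+1) wC (wcf A (mpoly.bmnm a) (s y)) *
      \prod_(i < m2) P y i ^+ (mpoly.bmnm a i)) * \prod_(i < m1 | i \in A) E y i)).
  move=> y [Vy V'y]; apply: eq_bigr => A _; congr (_ * _).
  rewrite (mpoly.mmapE d.+1)//.
  rewrite mpoly.msizeE; apply/bigmax_leqP_seq => a + _.
  rewrite mpoly.mcoeff_msupp ltnS leqNgt => sa; apply/negP => da.
  by move: sa; rewrite dP// eqxx.
apply: model_section_sum => // A _; apply: model_sectionM => //.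
  apply: model_section_sum => // a _; apply: model_sectionM => //.
    apply: model_section_C => //; exact: smooth_fun_sub VV' (s1 A _).
  apply: model_section_prod => // i _; apply: model_sectionX => //.
  exact: model_section_sub VV' (PV i).
by apply: model_section_prod => // i _; exact: model_section_sub VV' (EV i).
Qed.

End ModelClosure.

(** * Completing functions to a chart *)

Section NewChart.
Context {R : realType} {m : nat} (M : manifold R m).
Implicit Types (U V : opens M) (phi : M -> 'rV[R]_m).

Lemma preimage_open U phi (B : set 'rV[R]_m) : open_embedding U phi -> open B ->
  open [set z | U z /\ B (phi z)].
Proof.
move=> [cphi _ _] oB; rewrite openE => z [Uz Bz].
have nU : \forall y \near z, U y by apply: open_nbhs_nbhs; split => //; exact: open_oset.
have nB : \forall y \near z, B (phi y).
  have H : phi @ z --> phi z by exact: cphi.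
  exact: (H _ (open_near oB Bz)).
by apply: filterS2 nU nB.
Qed.

(** The matrix completing the Jacobian supplies the missing coordinates as linear functions of the
    old ones. The inverse function theorem makes the result an open embedding near [x], and its
    local inverse [G] gives the smooth transitions back to the atlas. *)
Lemma new_chart n U phi x (F : 'I_n -> 'rV[R]_m -> R) (a : 'M[R]_(m, n)) :
  is_chart U phi -> U x -> (forall i, Cinf (phi @` U) (F i)) ->
  (\matrix_(i, l) 'D_(delta_mx 0 l) (F i) (phi x)) *m a = 1%:M ->
  exists (U' : opens M) (phi' : M -> 'rV[R]_m),
    [/\ U' `<=` U, U' x, is_chart U' phi'
      & forall (i : 'I_m) (j : 'I_n), i = j :> nat -> forall z, U' z -> phi' z 0 i = F j (phi z)].
Proof.
move=> ch Ux FU Ja; have [oe trans] := ch; have [cphi inj _] := oe.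
set J := (X in X *m a) in Ja; have nm : (n <= m)%N := mulmx1_min Ja.
have [K K0 uK] := right_inverse_extension Ja.
have oU : open (phi @` U) := open_embedding_open oe (@subset_refl _ U).
have Ux' : (phi @` U) (phi x) by exists x.
(* For $j<n$ the row of [K] vanishes and [f j] is the given function of index [j]; for $j\ge n$ the
   first sum vanishes and [f j] is linear. *)
pose f (j : 'I_m) u := (\sum_(i < n) (i == j :> nat)%:R * F i u) + \sum_l K j l * u 0 l.
have fU j : Cinf (phi @` U) (f j).
  move=> k; apply: Ck_add => //; apply: Ck_sum => // i _; apply: Ck_mul => //.
  - exact: Ck_cst.
  - exact: FU.
  - exact: Ck_cst.
  - exact: Ck_coord.
pose Fh u : 'rV[R]_m := \row_j f j u.
have FhE j : (fun u => Fh u 0 j) = f j by apply/funext => u; rewrite mxE.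
have FhU j : Cinf (phi @` U) (fun u => Fh u 0 j) by rewrite FhE.
have dFh : partial_mx Fh (phi x) = ((pid_mx n : 'M_(m, n)) *m J + K)^T.
  apply/matrixP => l j; rewrite !mxE FhE.
  have d1 (i : 'I_n) : is_derive (phi x) (delta_mx 0 l : 'rV[R]_m)
      (fun u => (i == j :> nat)%:R * F i u) ((i == j :> nat)%:R * J i l).
    have dk : derivable (F i) (phi x) (delta_mx 0 l : 'rV[R]_m).
      exact: Ck_derivable (FU i 1%N) Ux'.
    by rewrite /J mxE; exact: (is_deriveZ (i == j :> nat)%:R (derivableP dk)).
  have d2 (k : 'I_m) : is_derive (phi x) (delta_mx 0 l : 'rV[R]_m)
      (fun u => K j k * u 0 k) (K j k * (k == l)%:R).
    have := is_deriveZ (K j k) (is_derive_coord (phi x) (delta_mx 0 l) k).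
    by rewrite mxE eqxx.
  have dd := is_deriveD (is_derive_sum d1) (is_derive_sum d2).
  have -> : f j = (\sum_(i < n) (fun u : 'rV[R]_m => (i == j :> nat)%:R * F i u)) +
      (\sum_(k < m) (fun u : 'rV[R]_m => K j k * u 0 k)).
    by apply/funext => u; rewrite fctE !fct_sumE.
  have [_ ->] := dd; congr (_ + _).
    apply: eq_bigr => i _; rewrite !mxE; congr (_%:R * _).
    by case: eqP => [ij|ij]; case: (_ =P _) => //=; rewrite -?ij ?ltn_ord// => ji; case: ij.
  rewrite (bigD1 l)//= eqxx mulr1 big1 ?addr0// => k /negbTE ->.
  by rewrite mulr0.
have uF : partial_mx Fh (phi x) \in unitmx by rewrite dFh unitmx_tr.
have [B [G [oB Bx BU Fopen [GF GC]]]] := inverse_function oU Ux' FhU (mulmxV uF).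
pose U' := Opens (preimage_open oe oB).
have U'U : U' `<=` U by move=> z [].
have U'B z : U' z -> B (phi z) by case.
have FhE' (z : M) j : Fh (phi z) 0 j = f j (phi z) by rewrite mxE.
have oe' : open_embedding U' (fun z => Fh (phi z)).
  split.
  - move=> z U'z.
    have cF : Fh @ phi z --> Fh (phi z).
      apply: (cvg_rV (F := nbhs (phi z))) => j.
      have : {for phi z, continuous (fun u => Fh u 0 j)}.
        by apply: Ck_continuous (FhU j 0%N) _; exists z => //; exact: U'U.
      exact.
    have cz : {for z, continuous phi} by apply: cphi; exact: U'U.
    exact: (continuous_comp cz cF).
  - move=> y z U'y U'z /(congr1 G); rewrite !GF; [|exact: U'B..].
    by apply: inj; exact: U'U.
  - move=> V VU'; rewrite -image_comp; apply: Fopen.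
      apply: (open_embedding_open oe); exact: subset_trans U'U.
    by move=> _ [z Vz <-]; apply: U'B; exact: VU'.
exists U', (fun z => Fh (phi z)); split => //; last first.
  move=> i j ij z U'z; rewrite mxE /f (bigD1 j)//= ij eqxx mul1r.
  rewrite big1 ?addr0 => [|k kj]; last first.
    by rewrite (_ : (k == j :> nat) = false) ?mul0r//; apply: negbTE.
  by rewrite big1 ?addr0// => l _; rewrite K0 ?mul0r// ij.
split => // c ac; split=> j.
  have sf : smooth_fun U' (fun z => Fh (phi z) 0 j).
    apply: (chart_smooth_fun (g := fun u => Fh u 0 j) ch) => //.
    by apply: Cinf_sub (FhU j) => _ [z U'z <-]; exists z => //; exact: U'U.
  exact: sf.
have [_ t2] := trans c ac.
apply: (smooth_via_comp (phi' := phi)).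
- by apply: (open_embedding_open (V := opensI U' c.1) oe') => z [].
- by apply: (open_embedding_open (V := opensI U' c.1) oe) => z [/U'U].
- by apply: smooth_via_sub (t2 j) => z [/U'U].
- move=> l; exists (fun y => G y 0 l).
    apply: Cinf_sub (GC l) => _ [z [U'z _] <-]; exists (phi z) => //; exact: U'B.
  by move=> z [U'z _]; rewrite GF//; exact: U'B.
Qed.

End NewChart.

(** * Completing sections of degrees 1 and 2 to generators *)

Section NewTrivialization.
Context {R : realType} {m0 m1 m2 : nat} (M : Nmanifold R m0 m1 m2).
Local Notation W := (walg R m1 m2).
Local Notation C := (sheaf M).
Variables (U : opens M) (tau : forall V : opens M, sec C V -> M -> W) (x : M).
Hypotheses (T : trivialization U tau) (Ux : U x).

Let UU : U `<=` U := @subset_refl _ U.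

(** The completing matrices are found at [x] and kept constant. The completed Jacobians vary
    smoothly with the point and stay invertible near [x]; with the quadratic parts of the [zeta j]
    they define a triangular change of generators at each point. *)
Lemma new_trivialization n1 n2 (eta : 'I_n1 -> sec C U) (zeta : 'I_n2 -> sec C U)
    (a1 : 'M[R]_(m1, n1)) (a2 : 'M[R]_(m2, n2)) :
  (forall j, homogeneous 1 (eta j)) -> (forall j, homogeneous 2 (zeta j)) ->
  (\matrix_(j, l) wcf (finset.set1 l) mpoly.mnm0 (tau (eta j) x)) *m a1 = 1%:M ->
  (\matrix_(j, l) wcf finset.set0 (mpoly.mnm1 l) (tau (zeta j) x)) *m a2 = 1%:M ->
  exists (U' : opens M) (h : U' `<=` U) (tau' : forall V : opens M, sec C V -> M -> W),
  [/\ U' x, trivialization U' tau',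
      forall (i : 'I_m1) (j : 'I_n1), i = j :> nat ->
        forall y, U' y -> tau' U' (res C h (eta j)) y = wgen1 i
    & forall (i : 'I_m2) (j : 'I_n2), i = j :> nat ->
        forall y, U' y -> tau' U' (res C h (zeta j)) y = wgen2 i].
Proof.
move=> eta1 zeta2 J1 J2.
have [K1 K10 uK1] := right_inverse_extension J1.
have [K2 K20 uK2] := right_inverse_extension J2.
pose A y : 'M[R]_m1 := (pid_mx n1 : 'M_(m1, n1)) *m
  (\matrix_(j < n1, l < m1) wcf (finset.set1 l) mpoly.mnm0 (tau (eta j) y)) + K1.
pose B y : 'M[R]_m2 := (pid_mx n2 : 'M_(m2, n2)) *m
  (\matrix_(j < n2, l < m2) wcf finset.set0 (mpoly.mnm1 l) (tau (zeta j) y)) + K2.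
(* The quadratic part of [zeta j] for the index $i=j<n_2$; it is zero for the added coordinates,
   which are linear in the old even generators. *)
pose N y (i : 'I_m2) (S : {set 'I_m1}) : R :=
  \sum_(j < n2) (i == j :> nat)%:R * wcf S mpoly.mnm0 (tau (zeta j) y).
have sm V (f : sec C V) S a : V `<=` U -> smooth_fun V (fun y => wcf S a (tau f y)).
  by move=> VU; have [+ _] := triv_section T f VU; apply.
have pid_row n m (P : 'M[R]_(n, m)) (K : 'M[R]_m) (i : 'I_m) (j : 'I_n) l :
    (forall i l : 'I_m, (i < n)%N -> K i l = 0) -> i = j :> nat ->
    ((pid_mx n : 'M_(m, n)) *m P + K) i l = P j l.
  move=> K0 ij; rewrite !mxE K0 ?ij// addr0 (bigD1 j)//= mxE ij eqxx ltn_ord mul1r.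
  rewrite big1 ?addr0// => k kj; rewrite mxE ij (_ : (j == k :> nat) = false) ?mul0r//.
  by rewrite eq_sym; apply: negbTE.
have smM n m (P : M -> 'M[R]_(n, m)) (K : 'M[R]_m) (i j : 'I_m) :
    (forall k l, smooth_fun U (fun y => P y k l)) ->
    smooth_fun U (fun y => ((pid_mx n : 'M_(m, n)) *m P y + K) i j).
  move=> sP; apply: (@smooth_fun_ext _ _ _ _ (fun y =>
    (\sum_k (pid_mx n : 'M[R]_(m, n)) i k * P y k j) + K i j)).
    by move=> y _; rewrite !mxE.
  apply: smooth_funD; last exact: smooth_fun_cst.
  by apply: smooth_fun_sum => k _; apply: smooth_funM; [exact: smooth_fun_cst|exact: sP].
have sA i j : smooth_fun U (fun y => A y i j).
  apply: smM => k l; apply: smooth_fun_ext (sm U (eta k) (finset.set1 l) mpoly.mnm0 UU) => y _.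
  by rewrite mxE.
have sB i j : smooth_fun U (fun y => B y i j).
  apply: smM => k l; apply: smooth_fun_ext (sm U (zeta k) finset.set0 (mpoly.mnm1 l) UU) => y _.
  by rewrite mxE.
have sN i S : smooth_fun U (fun y => N y i S).
  apply: smooth_fun_sum => j _; apply: smooth_funM; first exact: smooth_fun_cst.
  exact: sm.
have [UA [UAU UAx nA]] : exists V : opens M, [/\ V `<=` U, V x & forall y, V y -> \det (A y) != 0].
  by apply: (smooth_fun_nonzero (smooth_fun_det sA) Ux); rewrite -unitfE -unitmxE.
have [UB [UBU UBx nB]] : exists V : opens M, [/\ V `<=` U, V x & forall y, V y -> \det (B y) != 0].
  by apply: (smooth_fun_nonzero (smooth_fun_det sB) Ux); rewrite -unitfE -unitmxE.
pose U' := opensI UA UB.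
have U'U : U' `<=` U by move=> y [/UAU].
have uA y : U' y -> A y \in unitmx by case=> /nA; rewrite unitmxE unitfE.
have uB y : U' y -> B y \in unitmx by case=> _ /nB; rewrite unitmxE unitfE.
(* Re-expansion in the new generators: the old ones are replaced by their expressions through the
   new, with coefficients depending on the point. *)
pose tau' (V : opens M) (f : sec C V) (y : M) : W :=
  wlift (oldE (A y)) (oldP (A y) (B y) (N y)) (tau f y).
have T' := trivialization_sub T U'U.
have oE y i : whomogeneous 1 (oldE (A y) i : W) by exact: whomogeneous_oldE.
have oP y i : whomogeneous 2 (oldP (A y) (B y) (N y) i : W) by exact: whomogeneous_oldP.
have msE (V : opens M) i : V `<=` U' -> model_section V (fun y => oldE (A y) i : W).
  move=> VU'; apply: (model_section_sum T') => // l _; apply: (model_sectionM T') => //.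
    apply: (model_section_C T') => //; apply: (smooth_fun_sub VU').
    by apply: smooth_fun_invmx => // k l'; exact: smooth_fun_sub U'U (sA k l').
  exact: model_section_const.
have msF (V : opens M) i : V `<=` U' -> model_section V (fun y => free2 (N y i) : W).
  move=> VU'; apply: (model_section_sum T') => // S _; apply: (model_sectionM T') => //.
    apply: (model_section_C T') => //; apply: (smooth_fun_sub VU').
    exact: smooth_fun_sub U'U (sN i S).
  exact: model_section_const.
have msP (V : opens M) i : V `<=` U' -> model_section V (fun y => oldP (A y) (B y) (N y) i : W).
  move=> VU'; apply: (model_section_sum T') => // l _; apply: (model_sectionM T') => //.
    apply: (model_section_C T') => //; apply: (smooth_fun_sub VU').
    by apply: smooth_fun_invmx => // k l'; exact: smooth_fun_sub U'U (sB k l').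
  apply: (model_sectionD T') => //; first exact: model_section_const.
  apply: (model_sectionN T') => //; apply: (model_section_wlift T') => //.
  - by move=> k; exact: msE.
  - by move=> k; exact: model_section_const.
  - exact: msF.
have nE y i : whomogeneous 1 (newE (A y) i : W) by exact: whomogeneous_newE.
have nP y i : whomogeneous 2 (newP (B y) (N y) i : W) by exact: whomogeneous_newP.
have msE' (V : opens M) i : V `<=` U' -> model_section V (fun y => newE (A y) i : W).
  move=> VU'; apply: (model_section_sum T') => // l _; apply: (model_sectionM T') => //.
    apply: (model_section_C T') => //; apply: (smooth_fun_sub VU').
    exact: smooth_fun_sub U'U (sA i l).
  exact: model_section_const.
have msP' (V : opens M) i : V `<=` U' -> model_section V (fun y => newP (B y) (N y) i : W).
  move=> VU'; apply: (model_sectionD T') => //; last exact: msF.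
  apply: (model_section_sum T') => // l _; apply: (model_sectionM T') => //.
    apply: (model_section_C T') => //; apply: (smooth_fun_sub VU').
    exact: smooth_fun_sub U'U (sB i l).
  exact: model_section_const.
exists U', U'U, tau'; split => //.
- split.
  + move=> V f VU'; apply: (model_section_wlift T') => //.
    * by move=> i; exact: msE.
    * by move=> i; exact: msP.
    * exact: (triv_section T' f VU').
  + by move=> V V' h f y VU' V'y; rewrite /tau' (triv_res T').
  + by move=> V a y VU' Vy; rewrite /tau' (tau_cst T')// wlift_C.
  + by move=> V f g y VU' Vy; rewrite /tau' (tau_add T')// wliftD.
  + move=> V f g y VU' Vy; rewrite /tau' (tau_mul T')// wliftM//.
  + move=> k V f y VU' Vy fk; apply: wlift_homogeneous => //.
    exact: (triv_homogeneous T').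
  + move=> V f g VU' fg; apply: (triv_inj T') => // y Vy.
    have U'y := VU' _ Vy.
    have := congr1 (wlift (newE (A y)) (newP (B y) (N y))) (fg y Vy).
    by rewrite /tau' !new_oldK//; [exact: uA|exact: uB|exact: uA|exact: uB].
  + move=> V s VU' sV.
    have : model_section V (fun y => wlift (newE (A y)) (newP (B y) (N y)) (s y) : W).
      apply: (model_section_wlift T') => //; first by move=> i; exact: msE'.
      by move=> i; exact: msP'.
    move=> /(triv_surj T' VU')[f fE]; exists f => y Vy; have U'y := VU' _ Vy.
    by rewrite /tau' fE// old_newK//; [exact: uA|exact: uB].
- move=> i j ij y U'y; rewrite /tau' (triv_res T)//.
  have Uy := U'U _ U'y.
  have -> : tau (eta j) y = newE (A y) i.
    have h1 : whomogeneous 1 (tau (eta j) y) by exact: (triv_homogeneous T).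
    rewrite [LHS](wdecomp1 h1); apply: eq_bigr => l _; congr (wC _ * _).
    by rewrite /A (pid_row _ _ _ _ i j)// mxE.
  by rewrite old_newE//; exact: uA.
- move=> i j ij y U'y; rewrite /tau' (triv_res T)//.
  have Uy := U'U _ U'y.
  have -> : tau (zeta j) y = newP (B y) (N y) i.
    have h1 : whomogeneous 2 (tau (zeta j) y) by exact: (triv_homogeneous T).
    rewrite [LHS](wdecomp2 h1); congr (_ + _); apply: eq_bigr => l _; congr (wC _ * _).
      by rewrite /B (pid_row _ _ _ _ i j)// mxE.
    rewrite /N (bigD1 j)//= ij eqxx mul1r big1 ?addr0// => k kj.
    by rewrite (_ : (j == k :> nat) = false) ?mul0r//; rewrite eq_sym; apply: negbTE.
  by rewrite old_newP//; exact: uB.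
Qed.

Lemma new_coordinates n0 n1 n2 (phi : M -> 'rV[R]_m0) (F : 'I_n0 -> 'rV[R]_m0 -> R)
    (eta : 'I_n1 -> sec C U) (zeta : 'I_n2 -> sec C U)
    (a0 : 'M[R]_(m0, n0)) (a1 : 'M[R]_(m1, n1)) (a2 : 'M[R]_(m2, n2)) :
  is_chart U phi -> (forall i, Cinf (phi @` U) (F i)) ->
  (forall j, homogeneous 1 (eta j)) -> (forall j, homogeneous 2 (zeta j)) ->
  (\matrix_(i, l) 'D_(delta_mx 0 l) (F i) (phi x)) *m a0 = 1%:M ->
  (\matrix_(j, l) wcf (finset.set1 l) mpoly.mnm0 (tau (eta j) x)) *m a1 = 1%:M ->
  (\matrix_(j, l) wcf finset.set0 (mpoly.mnm1 l) (tau (zeta j) x)) *m a2 = 1%:M ->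
  exists (U' : opens M) (h : U' `<=` U) (xx : 'I_m0 -> sec C U')
    (ee : 'I_m1 -> sec C U') (pp : 'I_m2 -> sec C U'),
  [/\ U' x /\ local_coordinates xx ee pp,
      forall (i : 'I_m0) (j : 'I_n0), i = j :> nat ->
        forall z, U' z -> fn (xx i) z = F j (phi z),
      forall (i : 'I_m1) (j : 'I_n1), i = j :> nat -> ee i = res C h (eta j)
    & forall (i : 'I_m2) (j : 'I_n2), i = j :> nat -> pp i = res C h (zeta j)].
Proof.
move=> ch FU eta1 zeta2 J0 J1 J2.
have [U1 [phi' [U1U U1x ch' phiE]]] := new_chart ch Ux FU J0.
have [U2 [h2 [tau' [U2x T2 etaE zetaE]]]] := new_trivialization eta1 zeta2 J1 J2.
pose U' := opensI U1 U2.
have U'1 : U' `<=` U1 by exact: opensIl.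
have U'2 : U' `<=` U2 by exact: opensIr.
have h : U' `<=` U := subset_trans U'2 h2.
have T' := trivialization_sub T2 U'2.
have ch1 := is_chart_sub U'1 ch'.
have [xs xsP] := choice (fun l => let: ex_intro2 s p q :=
    fn_surj (chart_coord_smooth l ch1) in
  ex_intro (fun s : sec C U' => homogeneous 0 s /\ forall z, U' z -> fn s z = phi' z 0 l) s (conj p q)).
have [ee eeP] := choice (fun l : 'I_m1 =>
  triv_surj T' (@subset_refl _ U') (model_section_const U' (wgen1 l : W))).
have [pp ppP] := choice (fun l : 'I_m2 =>
  triv_surj T' (@subset_refl _ U') (model_section_const U' (wgen2 l : W))).
have resE (f : sec C U) y : U' y -> tau' U' (res C h f) y = tau' U2 (res C h2 f) y.
  by move=> U'y; rewrite -(res_res h2 U'2 h) (triv_res T2).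
exists U', h, xs, ee, pp; split.
- split => //; exists phi', tau'; split => //.
- by move=> i j ij z U'z; have [_ ->//] := xsP i; apply: phiE => //; exact: U'1.
- move=> i j ij; apply: (triv_inj T') => // y U'y.
  by rewrite eeP// resE// (etaE i j)//; exact: U'2.
- move=> i j ij; apply: (triv_inj T') => // y U'y.
  by rewrite ppP// resE// (zetaE i j)//; exact: U'2.
Qed.

End NewTrivialization.

(** * Ideals *)

Section Ideals.
Context {R : realType} {X : topologicalType} (C : graded_sheaf R X).
Implicit Types (U V : opens X) (I J G : forall V : opens X, set (sec C V)).

Lemma generated_ideal_sheaf U G : ideal_sheaf_on U (generated_on (C := C) U G).
Proof.
move=> V VU; split.
- split=> [J IJ GJ|f g If Ig J IJ GJ]; first by have [[]] := IJ V VU.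
  by have [[_ +] _ _ _] := IJ V VU; apply; [exact: If|exact: Ig].
- move=> a f If; split=> J IJ GJ; have [_ /(_ a f (If J IJ GJ)) [] //] := IJ V VU.
- move=> V' h f If J IJ GJ; have [_ _ + _] := IJ V VU; apply; exact: If.
- move=> f H J IJ GJ; have [_ _ _ +] := IJ V VU; apply => x /H[V' [h [V'x If]]].
  by exists V', h; split => //; exact: If.
Qed.

Lemma generated_on_gen U G V f : V `<=` U -> G V f -> generated_on (C := C) U G V f.
Proof. by move=> VU Gf J _ GJ; exact: GJ. Qed.

Lemma ideal_sheaf_sub U U' J : U' `<=` U -> ideal_sheaf_on U J -> ideal_sheaf_on U' J.
Proof. by move=> h JU V VU'; apply: JU; exact: (subset_trans VU' h). Qed.

(** Turns a sheaf of ideals over [U] into one over the whole space by imposing its condition inside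
    [U] only. An ideal generated globally can thus be tested against a sheaf of ideals that exists
    only over [U]. *)
Definition extend_ideal U J V : set (sec C V) :=
  [set f | forall (V' : opens X) (h : V' `<=` V), V' `<=` U -> J V' (res C h f)].

Lemma extend_ideal_sheaf U J : ideal_sheaf_on U J ->
  ideal_sheaf_on (opensT X) (extend_ideal U J).
Proof.
move=> JU V _; split.
- split=> [V' h V'U|f g If Ig V' h V'U]; have [[J0 JD] _ _ _] := JU V' V'U.
    by rewrite raddf0.
  by rewrite raddfD; apply: JD; [exact: If|exact: Ig].
- move=> a f If; split=> V' h V'U; have [_ + _ _] := JU V' V'U.
    by rewrite rmorphM => /(_ (res C h a) _ (If V' h V'U))[].
  by rewrite rmorphM => /(_ (res C h a) _ (If V' h V'U))[].
- move=> V' h f If V'' h' V''U.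
  by rewrite (res_res h h' (subset_trans h' h)); exact: If.
- move=> f H V' h V'U; have [_ _ _ +] := JU V' V'U; apply => x V'x.
  have [V1 [h1 [V1x If]]] := H x (h x V'x).
  have k1 : opensI V1 V' `<=` V1 := @opensIl _ V1 V'.
  exists (opensI V1 V'), (@opensIr _ V1 V'); split => //.
  have k2 : opensI V1 V' `<=` V := subset_trans k1 h1.
  rewrite (res_res h (@opensIr _ V1 V') k2) -(res_res h1 k1 k2); apply: If.
  by move=> z [_ /V'U].
Qed.

Lemma ideal_sheaf_unit U J V (f : sec C V) : ideal_sheaf_on U J -> V `<=` U -> J V 1 -> J V f.
Proof.
by move=> JU VU J1; have [_ /(_ f 1 J1)[+ _] _ _] := JU V VU; rewrite mulr1.
Qed.

End Ideals.

Section RingIdeal.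
Context {S : pzRingType} (K : S -> Prop).
Hypotheses (K0 : K 0) (KD : forall f g, K f -> K g -> K (f + g))
  (KM : forall a f, K f -> K (a * f) /\ K (f * a)).

Lemma ring_ideal_sum (I : Type) (r : seq I) (P : pred I) (F : I -> S) :
  (forall i, P i -> K (F i)) -> K (\sum_(i <- r | P i) F i).
Proof. by move=> KF; elim/big_ind: _. Qed.

Lemma ring_ideal_prod (I : finType) (P : pred I) (F : I -> S) i : P i -> K (F i) ->
  K (\prod_(j | P j) F j).
Proof.
move=> Pi KFi; have : i \in index_enum I by exact: mem_index_enum.
elim: (index_enum I) => // j r IHr; rewrite inE big_cons.
have [<-|ji] /= := eqVneq i j => [_|/IHr Kr]; last first.
  by case: ifP => // _; have [] := KM (F j) Kr.
by rewrite Pi; have [] := KM (\prod_(k <- r | P k) F k) KFi.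
Qed.

End RingIdeal.

(** * Generators of the ideal of a point *)

Section PointIdeal.
Context {R : realType} {n0 n1 n2 : nat} (N : Nmanifold R n0 n1 n2).
Local Notation C := (sheaf N).
Variables (V0 : opens N) (phi : N -> 'rV[R]_n0)
  (tau : forall V : opens N, sec C V -> N -> walg R n1 n2) (c : N).
Hypotheses (ch : is_chart V0 phi) (T : trivialization V0 tau) (V0c : V0 c).
Variables (ys : 'I_n0 -> sec C V0) (es : 'I_n1 -> sec C V0) (ps : 'I_n2 -> sec C V0).
Hypotheses (ys0 : forall i, homogeneous 0 (ys i))
  (ysE : forall i y, V0 y -> fn (ys i) y = phi y 0 i - phi c 0 i)
  (esE : forall i y, V0 y -> tau (es i) y = wgen1 i)
  (psE : forall i y, V0 y -> tau (ps i) y = wgen2 i).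

(** Membership is stated for every ideal [K] of the ring of sections over [V1], so that it can later
    be applied to the sections whose pullback lies in a given ideal on the source, without naming
    the coefficients of a combination. *)
Lemma point_ideal_expand (V : opens N) (f : sec C V) : V c -> fn f c = 0 ->
  exists (V1 : opens N) (h : V1 `<=` V) (h0 : V1 `<=` V0), V1 c /\
    forall K : sec C V1 -> Prop, K 0 -> (forall f g, K f -> K g -> K (f + g)) ->
      (forall a f, K f -> K (a * f) /\ K (f * a)) ->
      (forall i, K (res C h0 (ys i))) -> (forall i, K (res C h0 (es i))) ->
      (forall i, K (res C h0 (ps i))) -> K (res C h f).
Proof.
move=> Vc fc; pose VI := opensI V V0.
have VIV : VI `<=` V := @opensIl _ V V0.
have VI0 : VI `<=` V0 := @opensIr _ V V0.
have VIc : VI c by [].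
pose f1 := res C VIV f.
have [V2 [g [V2I V2c gV gE]]] :=
  hadamard_chart ch VI0 (fn_smooth f1) VIc (leqnn n0).
have [sm lf] := triv_section T f1 VI0.
have [V3 [d [V3c dP]]] := lf c VIc.
pose V1 := opensI V2 V3.
have V12 : V1 `<=` V2 := @opensIl _ V2 V3.
have h1 : V1 `<=` VI := subset_trans V12 V2I.
have h : V1 `<=` V := subset_trans h1 VIV.
have h0 : V1 `<=` V0 := subset_trans h1 VI0.
have V1c : V1 c by [].
exists V1, h, h0; split => // K K0 KD KM Ky Ke Kp.
rewrite -(res_res VIV h1 h) -/f1.
pose s := res C h1 f1.
have sE y : V1 y -> tau s y = tau f1 y by move=> V1y; rewrite (triv_res T).
pose coefP A a := fn_surj (smooth_fun_sub h1 (sm A a)).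
have [F FP] := choice (fun Aa : {set 'I_n1} * mpoly.multinom n2 =>
  let: ex_intro2 s p q := coefP Aa.1 Aa.2 in
  ex_intro (fun u : sec C V1 => homogeneous 0 u /\
    forall y, V1 y -> fn u y = mpoly.mcoeff Aa.2 (tau f1 y Aa.1)) s (conj p q)).
pose e i := res C h0 (es i); pose p i := res C h0 (ps i).
have eE i y : V1 y -> tau (e i) y = wgen1 i.
  by move=> V1y; rewrite (triv_res T)// esE//; exact: (h0 y).
have pE i y : V1 y -> tau (p i) y = wgen2 i.
  by move=> V1y; rewrite (triv_res T)// psE//; exact: (h0 y).
pose term (A : {set 'I_n1}) (a : mpoly.bmultinom n2 d.+1) : sec C V1 :=
  F (A, mpoly.bmnm a) * (\prod_(i < n2) p i ^+ (mpoly.bmnm a i)) * \prod_(i < n1 | i \in A) e i.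
have tauX (u : sec C V1) k y : V1 y -> tau (u ^+ k) y = (tau u y : walg R n1 n2) ^+ k.
  move=> V1y; elim: k => [|k IHk]; first by rewrite !expr0 (tau1 T).
  by rewrite !exprS (tau_mul T)// IHk.
have expand : s = \sum_(A : {set 'I_n1}) \sum_(a : mpoly.bmultinom n2 d.+1) term A a.
  apply: (triv_inj T) => // y V1y.
  rewrite -[LHS](wlift_id (tau s y)) (tau_sum T)//; apply: eq_bigr => A _.
  rewrite (tau_sum T)// (mpoly.mmapE d.+1); last first.
    rewrite mpoly.msizeE; apply/bigmax_leqP_seq => a + _.
    rewrite mpoly.mcoeff_msupp ltnS leqNgt => sa; apply/negP => da.
    by move: sa; rewrite sE// dP ?eqxx//; [have [] := V1y|exact: (h1 y)].
  rewrite mulr_suml; apply: eq_bigr => a _.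
  rewrite !(tau_mul T)// !(tau_prod T)//; have [F0 FE] := FP (A, mpoly.bmnm a).
  rewrite (tau_homogeneous0 T h0 V1y F0) FE// sE//=.
  have -> : mpoly.mmap1 (@wgen2 R n1 n2 : 'I_n2 -> walg R n1 n2) a =
      \prod_i tau (p i ^+ (mpoly.bmnm a i)) y.
    by apply: eq_bigr => i _; rewrite tauX// pE.
  have -> : eprod (@wgen1 R n1 n2 : 'I_n1 -> walg R n1 n2) A = \prod_(i in A) tau (e i) y.
    by apply: eq_bigr => i _; rewrite eE.
  by [].
(* A term with nonempty [A] contains an odd generator, and one with $a\ne 0$ an even generator.
   There remains the constant term, a function vanishing at [c]. *)
rewrite -/s expand; apply: ring_ideal_sum => // A _; apply: ring_ideal_sum => // a _.
rewrite /term; have [A0|[i iA]] := finset.set_0Vmem A; last first.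
  by have [] := KM (F (A, mpoly.bmnm a) * (\prod_(i < n2) p i ^+ (mpoly.bmnm a i)))
    _ (ring_ideal_prod (F := e) KM iA (Ke i)).
rewrite A0 [X in _ * X]big_pred0 ?mulr1 => [|i]; last by rewrite /= finset.in_set0.
have [/eqP a0|] := boolP (mpoly.bmnm a == mpoly.mnm0); last first.
  move=> a0; have [i ai] : exists i, mpoly.bmnm a i != 0%N.
    apply/existsP; apply: contraR a0 => /existsPn H; apply/eqP/mpoly.mnmP => i.
    by rewrite mpoly.mnm0E; apply/eqP/negPn/H.
  have Kpi : K (p i ^+ (mpoly.bmnm a i)).
    by move: ai; case: (mpoly.bmnm a i) => // k _; rewrite exprSr; have [] := KM (p i ^+ k) _ (Kp i).
  by have [] := KM (F (finset.set0, mpoly.bmnm a)) _ (ring_ideal_prod (F := fun i => p i ^+ (mpoly.bmnm a i)) KM (isT : xpredT i) Kpi).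
rewrite a0 big1 ?mulr1 => [|i _]; last by rewrite mpoly.mnm0E expr0.
have [F0 FE] := FP (finset.set0, mpoly.mnm0).
have fnF y : V1 y -> fn (F (finset.set0, mpoly.mnm0)) y = fn f1 y.
  by move=> V1y; rewrite FE//= -(wbody_tau T)//; exact: (h1 y).
have V1phi l : Cinf (phi @` V1) (g l).
  by apply: Cinf_sub (gV l) => _ [z V1z <-]; exists z => //; exact: (V12 z).
have [gs gsP] := choice (fun l => let: ex_intro2 s p q :=
    fn_surj (chart_smooth_fun ch h0 (V1phi l)) in
  ex_intro (fun s : sec C V1 => homogeneous 0 s /\ forall z, V1 z -> fn s z = g l (phi z)) s (conj p q)).
have -> : F (finset.set0, mpoly.mnm0) = \sum_l res C h0 (ys l) * gs l.
  apply: fn_inj => //.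
    apply: homogeneous_sum => l _; apply: (homogeneousM (homogeneous_res _ (ys0 l))).
    by have [] := gsP l.
  move=> y V1y; rewrite fnF//; have [z' [VIz' ez'] ->] := gE y (V12 _ V1y).
  (* All [n0] coordinates have been reset to those of [c], and the chart is injective. *)
  have -> : z' = c.
    have [[_ inj _] _] := ch; apply: inj => //; first exact: VI0.
    by rewrite ez'; apply/rowP => j; rewrite mxE ltn_ord.
  rewrite fn_res// fc add0r fn_sum//.
  apply: eq_big => [l|l _]; first by rewrite ltn_ord.
  rewrite fn_mul// fn_res// ysE; last exact: (h0 y).
  by have [_ ->] := gsP l.
by apply: ring_ideal_sum => // l _; have [] := KM (gs l) _ (Ky l).
Qed.

End PointIdeal.

(** * Coordinates adapted to the fibre *)

Section RegularCoordinates.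
Context {R : realType} {m0 m1 m2 n0 n1 n2 : nat}
  (M : Nmanifold R m0 m1 m2) (N : Nmanifold R n0 n1 n2) (Psi : Nmorphism M N) (c : N).
Local Notation C := (sheaf M).

Definition pulled_gens (U : opens M) : set (sec C U) := [set g |
  exists (V : opens N) (h : U `<=` bmap_pre Psi V) (f : sec (sheaf N) V),
    point_ideal c V f /\ g = res C h (sharp Psi V f)].

Lemma pulled_gens_res (U V : opens M) (h : V `<=` U) g :
  pulled_gens g -> pulled_gens (res C h g).
Proof.
move=> [W [k [f [fc ->]]]]; exists W, (subset_trans h k), f; split => //.
exact: res_res.
Qed.

Lemma pulled_gens_fn (U : opens M) (g : sec C U) y : pulled_gens g -> U y -> Psi y = c ->
  fn g y = 0.
Proof.
move=> [V [h [f [fc ->]]]] Uy yc; have Vy : V (Psi y) by exact: h.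
by rewrite fn_res// fn_sharp// yc; apply: fc; rewrite -yc.
Qed.

(** Over the complement of [c], which is open, the condition defining the ideal of [c] is void, so 1
    belongs to it and so does its pullback. *)
Lemma pulled_gens_away (U : opens M) : (forall y, U y -> Psi y <> c) ->
  pulled_gens (1 : sec C U).
Proof.
move=> Uc.
have cc : closed [set c] by apply: accessible_closed_set1; exact/hausdorff_accessible/manifold_hausdorff.
pose V := @Opens _ (~` [set c]) (closed_openC cc).
have h : U `<=` bmap_pre Psi V by move=> y Uy; exact: Uc.
exists V, h, 1; rewrite !rmorph1; split => // Vc; by case: Vc.
Qed.

(** The last two clauses compare the two systems of generators near [x]. The second of them is
    stated against an arbitrary sheaf of ideals [J], in accordance with the definition of
    [generated_on] as an intersection. *)
Lemma regular_coordinates x : regular_value Psi c -> Psi x = c ->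
  [/\ (n0 <= m0)%N, (n1 <= m1)%N & (n2 <= m2)%N] /\
  exists (U : opens M) (xx : 'I_m0 -> sec C U) (ee : 'I_m1 -> sec C U) (pp : 'I_m2 -> sec C U),
  [/\ U x /\ local_coordinates xx ee pp,
      forall y, U y -> (Psi y = c <-> forall i : 'I_m0, (i < n0)%N -> fn (xx i) y = 0),
      forall W : opens M, W `<=` U -> @coordinate_gens _ _ _ _ M n0 n1 n2 U xx ee pp W `<=` @pulled_gens W
    & forall J, ideal_sheaf_on U J ->
        (forall W : opens M, W `<=` U -> @coordinate_gens _ _ _ _ M n0 n1 n2 U xx ee pp W `<=` J W) ->
        forall W : opens M, W `<=` U -> @pulled_gens W `<=` J W].
Proof.
move=> regc xc; have reg := regc x xc.
have [d ad dc] := atlas_cover c.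
have [VN VNc [tauN TN]] := locally_trivial c.
pose V0 := opensI d.1 VN.
have V0c : V0 c by [].
have chN : is_chart V0 d.2 := is_chart_sub (@opensIl _ d.1 VN) (atlas_is_chart ad).
have TV : trivialization V0 tauN := trivialization_sub TN (@opensIr _ d.1 VN).
have smy i : smooth_fun V0 (fun y => d.2 y 0 i + - d.2 c 0 i).
  by apply: smooth_funD; [exact: chart_coord_smooth|exact: smooth_fun_cst].
have [ys ysP] := choice (fun l => let: ex_intro2 s p q := fn_surj (smy l) in
  ex_intro (fun s : sec (sheaf N) V0 => homogeneous 0 s /\
    forall z, V0 z -> fn s z = d.2 z 0 l + - d.2 c 0 l) s (conj p q)).
have [es esE] := choice (fun l : 'I_n1 => triv_surj TV (@subset_refl _ V0)
  (model_section_const V0 (wgen1 l : walg R n1 n2))).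
have [ps psE] := choice (fun l : 'I_n2 => triv_surj TV (@subset_refl _ V0)
  (model_section_const V0 (wgen2 l : walg R n1 n2))).
have es1 l : homogeneous 1 (es l).
  apply: (homogeneous_tau TV (@subset_refl _ V0)) => y Vy; rewrite esE//.
  exact: whomogeneous_wgen1.
have ps2 l : homogeneous 2 (ps l).
  apply: (homogeneous_tau TV (@subset_refl _ V0)) => y Vy; rewrite psE//.
  exact: whomogeneous_wgen2.
have ys0 l : homogeneous 0 (ys l) by have [] := ysP l.
have ysE l z : V0 z -> fn (ys l) z = d.2 z 0 l - d.2 c 0 l by have [_] := ysP l; apply.
have [k ak kx] := atlas_cover x.
have [UM UMx [tauM TM]] := locally_trivial x.
pose U0 := opensI (opensI k.1 UM) (bmap_pre Psi V0).
have U0k : U0 `<=` k.1 by move=> y [[]].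
have U0M : U0 `<=` UM by move=> y [[]].
have hU : U0 `<=` bmap_pre Psi V0 by move=> y [].
have U0x : U0 x by split => //; rewrite /= /preimage /= xc.
have chM : is_chart U0 k.2 := is_chart_sub U0k (atlas_is_chart ak).
have TU : trivialization U0 tauM := trivialization_sub TM U0M.
have U00 : U0 `<=` U0 := @subset_refl _ U0.
have [F FP] := choice (fun l => let: ex_intro2 s p q :=
    chart_smooth_via chM U00 (fn_smooth (pullsec hU (ys l))) in
  ex_intro (fun s => Cinf (k.2 @` U0) s /\
    forall z, U0 z -> fn (pullsec hU (ys l)) z = s (k.2 z)) s (conj p q)).
have FE l z : U0 z -> fn (ys l) (Psi z) = F l (k.2 z).
  by move=> U0z; rewrite -(fn_pullsec hU)//; have [_ ->] := FP l.
have FC l : Cinf (k.2 @` U0) (F l) by have [] := FP l.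
have [a0 J0] : exists a : 'M[R]_(m0, n0),
    (\matrix_(i, l) 'D_(delta_mx 0 l) (F i) (k.2 x)) *m a = 1%:M.
  apply: (regular_body reg hU U0x chN chM U00 ys0 _ FC FE).
  exists (\row_i - d.2 c 0 i) => i y V0y; rewrite ysE// mxE//.
have [a1 J1] := regular_odd reg hU U0x TV TU U00 es1 esE.
have [a2 J2] := regular_even reg hU U0x TV TU U00 ps2 psE.
split; first by split; [exact: mulmx1_min J0|exact: mulmx1_min J1|exact: mulmx1_min J2].
have lt0 : (n0 <= m0)%N by exact: mulmx1_min J0.
have lt1 : (n1 <= m1)%N by exact: mulmx1_min J1.
have lt2 : (n2 <= m2)%N by exact: mulmx1_min J2.
have [U [h [xx [ee [pp [[Ux lc] xxE eeE ppE]]]]]] := new_coordinates TU U0x chM FC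
  (fun j => homogeneous_pullsec hU (es1 j)) (fun j => homogeneous_pullsec hU (ps2 j)) J0 J1 J2.
have xx0 i : homogeneous 0 (xx i).
  by have [phi [tau [_ H _ _]]] := lc; have [] := H i.
have xxs (i : 'I_m0) (j : 'I_n0) : i = j :> nat -> xx i = res C h (pullsec hU (ys j)).
  move=> ij; apply: fn_inj; [exact: xx0|by apply: homogeneous_res; exact: homogeneous_pullsec|].
  move=> z Uz; rewrite fn_res// fn_pullsec; last exact: (h z).
  by rewrite (xxE i j)// FE//; exact: (h z).
have pulled (f : sec (sheaf N) V0) (W : opens M) (hW : W `<=` U) : fn f c = 0 ->
    pulled_gens (res C hW (res C h (pullsec hU f))).
  move=> fc; apply: pulled_gens_res; apply: pulled_gens_res.
  by exists V0, hU, f; split.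
have ysc j : fn (ys j) c = 0 by rewrite ysE// subrr.
have esc j : fn (es j) c = 0 by apply: (fn_homogeneous (es1 j)).
have psc j : fn (ps j) c = 0 by apply: (fn_homogeneous (ps2 j)).
have PsiU y : U y -> (Psi y = c <-> forall i : 'I_m0, (i < n0)%N -> fn (xx i) y = 0).
  move=> Uy; have V0y : V0 (Psi y) := hU _ (h _ Uy).
  split=> [yc i ilt|H].
    rewrite (xxs i (Ordinal ilt))// fn_res// fn_pullsec ?yc//; exact: (h y).
  have [[_ inj _] _] := chN; apply: inj => //.
  apply/rowP => j; apply/eqP; rewrite -subr_eq0 -ysE//; apply/eqP.
  have := H (widen_ord lt0 j) (ltn_ord j).
  by rewrite (xxs _ j)// fn_res// fn_pullsec//; exact: (h y).
exists U, xx, ee, pp; split => //.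
  move=> W WU g [hW [[i ilt ->]|[i ilt ->]|[i ilt ->]]].
  - by rewrite (xxs i (Ordinal ilt))//; exact: pulled.
  - by rewrite (eeE i (Ordinal ilt))//; exact: pulled.
  - by rewrite (ppE i (Ordinal ilt))//; exact: pulled.
move=> J JU gensJ W WU g [V [hV [f [fc ->]]]].
have [_ _ _ loc] := JU W WU; apply: loc => y Wy; have Uy := WU _ Wy.
have [yc|yc] := pselect (Psi y = c); last first.
  (* Off the fibre one of the first [n0] coordinates is nonzero at [y]; it is invertible nearby and
     makes [J] the unit ideal there. *)
  have [i ilt xiy] : exists2 i : 'I_m0, (i < n0)%N & fn (xx i) y != 0.
    apply: contrapT => H; apply: yc; apply/PsiU => // i ilt.
    by apply/eqP/negPn/negP => ni; apply: H; exists i.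
  have [V' [h' [u [V'y xu]]]] := local_inverse (xx0 i) Uy xiy.
  pose W' := opensI W V'.
  have W'W : W' `<=` W := @opensIl _ W V'.
  have W'V : W' `<=` V' := @opensIr _ W V'.
  have W'U : W' `<=` U := subset_trans W'W WU.
  exists W', W'W; split; first by split.
  apply: (ideal_sheaf_unit _ JU W'U).
  have [_ JM _ _] := JU W' W'U.
  have Jx : J W' (res C W'U (xx i)).
    by apply: gensJ => //; exists W'U; constructor 1; exists i.
  have := congr1 (res C W'V) xu; rewrite rmorphM rmorph1 (res_res h' W'V W'U) => <-.
  by have [] := JM (res C W'V u) _ Jx.
have Vc : V c by rewrite -yc; exact: hV.
have [V1 [h1 [h10 [V1c VK]]]] := point_ideal_expand chN TV V0c ys0 ysE esE psE Vc (fc Vc).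
pose W' := opensI W (bmap_pre Psi V1).
have W'W : W' `<=` W := @opensIl _ W _.
have W'1 : W' `<=` bmap_pre Psi V1 := @opensIr _ W _.
have W'U : W' `<=` U := subset_trans W'W WU.
have W'y : W' y by split => //; rewrite /= /preimage /= yc.
have [[JZ JD] JM _ _] := JU W' W'U.
exists W', W'W; split => //.
have resE (V2 : opens N) (k1 : V1 `<=` V2) (k2 : W' `<=` bmap_pre Psi V2) (u : sec (sheaf N) V2) :
    res C W'1 (sharp Psi V1 (res (sheaf N) k1 u)) = res C k2 (sharp Psi V2 u).
  by rewrite (sharp_res (n := Psi) k1 (bmap_pre_sub k1)) (res_res _ _ k2).
have W'2 : W' `<=` bmap_pre Psi V := subset_trans W'W hV.
rewrite (res_res hV W'W W'2) -(resE _ h1).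
have W'0 : W' `<=` bmap_pre Psi V0 by move=> z /W'U /h /hU.
have genE (u : sec (sheaf N) V0) : res C W'1 (sharp Psi V1 (res (sheaf N) h10 u)) =
    res C W'U (res C h (pullsec hU u)).
  rewrite (resE _ h10 W'0) /pullsec (res_res h W'U (subset_trans W'U h)).
  by rewrite (res_res hU _ W'0).
(* The sections over [V1] whose pullback to [W'] lies in [J] form an ideal that contains the
   coordinates centred at [c]. *)
apply: (VK (fun u => J W' (res C W'1 (sharp Psi V1 u)))).
- by rewrite !raddf0.
- by move=> u v Ju Jv; rewrite !raddfD; exact: JD.
- move=> a u Ju; rewrite !rmorphM /=.
  have [H1 _] := JM (res C W'1 (sharp Psi V1 a)) _ Ju.
  by have [_ H2] := JM (res C W'1 (sharp Psi V1 a)) _ Ju.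
- move=> j; rewrite genE -(xxs (widen_ord lt0 j) j)//; apply: gensJ => //.
  by exists W'U; constructor 1; exists (widen_ord lt0 j) => //=; exact: ltn_ord.
- move=> j; rewrite genE -(eeE (widen_ord lt1 j) j)//; apply: gensJ => //.
  by exists W'U; constructor 2; exists (widen_ord lt1 j) => //=; exact: ltn_ord.
- move=> j; rewrite genE -(ppE (widen_ord lt2 j) j)//; apply: gensJ => //.
  by exists W'U; constructor 3; exists (widen_ord lt2 j) => //=; exact: ltn_ord.
Qed.

End RegularCoordinates.

Theorem proposition2p24 (R : realType) (m0 m1 m2 n0 n1 n2 : nat)
    (M : Nmanifold R m0 m1 m2) (N : Nmanifold R n0 n1 n2)
    (Psi : Nmorphism M N) (c : N) :
  regular_value Psi c -> regular_ideal (pullback_ideal Psi (point_ideal c)).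
Proof.
move=> regc; set I := pullback_ideal _ _.
have IS : ideal_sheaf_on (opensT M) I by exact: generated_ideal_sheaf.
have Isub V : V `<=` opensT M by [].
have Igen V (g : sec (sheaf M) V) : pulled_gens Psi c g -> I V g.
  by move=> gG; apply: generated_on_gen.
split => //; exists [set x | Psi x = c]; split.
  move=> V f f0; split=> [If x Vx xc|fS].
    (* The sections whose degree-zero part vanishes on the fibre form a sheaf of ideals containing
       the generators, so it contains the pullback ideal. *)
    pose J (V : opens M) : set (sec (sheaf M) V) :=
      [set f | forall x, V x -> Psi x = c -> fn f x = 0].
    have JS : ideal_sheaf_on (opensT M) J.
      move=> W _; split.
      - split=> [y Wy _|g h Jg Jh y Wy yc]; first exact: fn0.
        by rewrite fn_add// (Jg y)// (Jh y)// addr0.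
      - move=> a g Jg; split=> y Wy yc; rewrite fn_mul// (Jg y)//; [exact: mulr0|exact: mul0r].
      - by move=> W' h g Jg y W'y yc; rewrite fn_res// (Jg y)//; exact: (h y).
      - move=> g H y Wy yc; have [W' [h [W'y Jg]]] := H y Wy.
        by rewrite -(fn_res h)// (Jg y).
    have := If J JS; apply => // W _ g gG y Wy yc.
    exact: pulled_gens_fn gG Wy yc.
  have [_ _ _ loc] := IS V (Isub V); apply: loc => y Vy.
  have [yc|yc] := pselect (Psi y = c); last first.
    have cc : closed [set c].
      by apply: accessible_closed_set1; exact/hausdorff_accessible/manifold_hausdorff.
    pose VN := @Opens _ (~` [set c]) (closed_openC cc).
    pose W := opensI V (bmap_pre Psi VN).
    exists W, (@opensIl _ V _); split; first by split.
    apply: (ideal_sheaf_unit _ IS (Isub W)); apply: Igen.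
    by apply: pulled_gens_away => z [].
  have [[lt0 _ _] [U [xx [ee [pp [[Uy lc] PsiU gens _]]]]]] := regular_coordinates regc yc.
  have [phi [tau [[ch T] xxE _ _]]] := lc.
  pose W := opensI V U.
  have WV : W `<=` V := @opensIl _ V U.
  have WU : W `<=` U := @opensIr _ V U.
  have Wy : W y by [].
  (* Only the first [n0] coordinates are reset. They vanish at [y], so the reset point lies on the
     fibre, where [f] is zero, and the expansion leaves only multiples of these coordinates. *)
  have [V' [g [V'W V'y gV gE]]] :=
    hadamard_chart ch WU (smooth_fun_sub WV (fn_smooth f)) Wy lt0.
  have V'V : V' `<=` V := subset_trans V'W WV.
  have V'U : V' `<=` U := subset_trans V'W WU.
  have [gs gsP] := choice (fun l => let: ex_intro2 s p q :=
      fn_surj (chart_smooth_fun ch V'U (gV l)) in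
    ex_intro (fun s : sec (sheaf M) V' => homogeneous 0 s /\
      forall z, V' z -> fn s z = g l (phi z)) s (conj p q)).
  have xxy i z : U z -> fn (xx i) z = phi z 0 i by have [_] := xxE i; apply.
  have phiy (i : 'I_m0) : (i < n0)%N -> phi y 0 i = 0.
    by move=> ilt; rewrite -xxy//; apply: (proj1 (PsiU y Uy) yc).
  exists V', V'V; split => //.
  have -> : res (sheaf M) V'V f =
      \sum_(l < m0 | (l < n0)%N) res (sheaf M) V'U (xx l) * gs l.
    apply: fn_inj; first exact: homogeneous_res.
      apply: homogeneous_sum => l _; have [gl0 _] := gsP l.
      have [xl0 _] := xxE l.
      exact: (homogeneousM (homogeneous_res _ xl0) gl0).
    move=> z V'z; rewrite fn_res// fn_sum//; have [z' [[Vz' Uz'] ez'] ->] := gE z V'z.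
    rewrite fS//; last first.
      apply/PsiU => // i ilt; rewrite xxy// ez' mxE ilt; exact: phiy.
    rewrite add0r; apply: eq_bigr => l ilt.
    rewrite fn_mul// fn_res// xxy; last exact: (V'U z).
    by rewrite phiy// subr0; have [_ ->] := gsP l.
  have [[I0 ID] IM _ _] := IS V' (Isub V').
  apply: (ring_ideal_sum I0 ID) => l ilt; have [] := IM (gs l) (res (sheaf M) V'U (xx l)) => //.
  by apply: Igen; apply: (gens V' V'U); exists V'U; constructor 1; exists l.
have [[x0 x0c]|noS] := pselect (exists x, Psi x = c); last first.
  (* With an empty fibre the inequalities $n_j\le m_j$ may fail, so zero is taken for the ranks. *)
  exists 0%N, 0%N, 0%N; split => // x xc; case: noS; by exists x.
have [[lt0 lt1 lt2] _] := regular_coordinates regc x0c.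
exists n0, n1, n2; split => // x xc.
have [_ [U [xx [ee [pp [[Ux lc] _ gens gensJ]]]]]] := regular_coordinates regc xc.
exists U => //; exists xx, ee, pp; split => // V VU.
apply/seteqP; split=> f.
  move=> If J JU HJ.
  (* [J] is a sheaf of ideals over [U] only, while the pullback ideal is generated over all of
     [M]. *)
  have H := If (extend_ideal U J) (extend_ideal_sheaf JU).
  rewrite -(res_id (@subset_refl _ V) f); apply: H => //.
  move=> W _ g gG V' h V'U; apply: (gensJ J JU) => //.
  exact: pulled_gens_res.
move=> Hf J JS GJ; apply: Hf.
  by apply: (ideal_sheaf_sub _ JS) => z.
move=> W WU g /(gens W WU); exact: GJ.
Qed.
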